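(* Let $n\in\mathbb{N}$, $\alpha\in(0,1)$, $p\in[1,+\infty]$ and $f\in BV^{\alpha,p}(\mathbb{R}^n)$. Then: (i) if $p\in\left[1,\frac{n}{1-\alpha}\right)$, then $|D^\alpha f|\ll\mathcal{H}^{n-1}$; (ii) if $p\in\left[\frac{n}{1-\alpha},+\infty\right]$, then $|D^\alpha f|\ll\mathcal{H}^{n-\alpha-\frac np}$ (with $\frac np=0$ if $p=+\infty$).
   Context: $\mathcal{H}^s$ denotes the $s$-dimensional Hausdorff measure on $\mathbb{R}^n$. For $\alpha\in(0,1)$ let $\mu_{n,\alpha}=2^{\alpha}\pi^{-n/2}\Gamma\left(\frac{n+\alpha+1}{2}\right)/\Gamma\left(\frac{1-\alpha}{2}\right)$ and, for $\varphi\in C^\infty_c(\mathbb{R}^n;\mathbb{R}^n)$, define the fractional divergence $\operatorname{div}^\alpha\varphi(x)=\mu_{n,\alpha}\int_{\mathbb{R}^n}\frac{(y-x)\cdot(\varphi(y)-\varphi(x))}{|y-x|^{n+\alpha+1}}\,dy$. For $p\in[1,+\infty]$, $BV^{\alpha,p}(\mathbb{R}^n)$ is the set of $f\in L^p(\mathbb{R}^n)$ with $|D^\alpha f|(\mathbb{R}^n):=\sup\{\int_{\mathbb{R}^n} f\operatorname{div}^\alpha\varphi\,dx:\varphi\in C^\infty_c(\mathbb{R}^n;\mathbb{R}^n),\ \|\varphi\|_{L^\infty}\le1\}<+\infty$. For such $f$ there is a unique finite $\mathbb{R}^n$-valued Radon measure $D^\alpha f$ on $\mathbb{R}^n$ with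 $\int f\operatorname{div}^\alpha\varphi\,dx=-\int\varphi\cdot dD^\alpha f$ for all $\varphi\in C^\infty_c(\mathbb{R}^n;\mathbb{R}^n)$; $|D^\alpha f|$ is its total variation measure. *)

(* Defs.v *)
From HB Require Import structures.
From mathcomp Require Import all_boot all_order all_algebra.
From mathcomp Require Import all_classical all_reals all_analysis.
Set Implicit Arguments. Unset Strict Implicit. Unset Printing Implicit Defensive.
Import Order.TTheory GRing.Theory Num.Theory.
Import numFieldNormedType.Exports.
Local Open Scope classical_set_scope.
Local Open Scope ring_scope.

Notation BorelRn R n := (g_sigma_algebraType (@open 'rV[R]_n)).

Section Rn.
Variables (R : realType) (n : nat).

Definition dotRn (x y : 'rV[R]_n) : R := \sum_(i < n) x 0 i * y 0 i.
Definition enorm (x : 'rV[R]_n) : R := Num.sqrt (dotRn x x).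

Definition rVall := 'rV[R]_n.
HB.instance Definition _ := Pointed.on rVall.
HB.instance Definition _ := @isMeasurable.Build default_measure_display
  rVall discrete_measurable discrete_measurable0
  discrete_measurableC discrete_measurableU.

Definition box_vol_inf (F : set rVall) : \bar R :=
  if `[< F = set0 >] then 0%E else
  ereal_inf [set (\prod_(i < n) (ab.2 0 i - ab.1 0 i))%:E | ab in
    [set ab : 'rV[R]_n * 'rV[R]_n | (forall i, ab.1 0 i <= ab.2 0 i) /\
       F `<=` [set x | forall i, ab.1 0 i <= x 0 i <= ab.2 0 i]] ].

Lemma box_vol_inf0 : box_vol_inf set0 = 0%E.
Proof. by rewrite /box_vol_inf; rewrite asboolT. Qed.

Lemma box_vol_inf_ge0 F : (0 <= box_vol_inf F)%E.
Proof.
rewrite /box_vol_inf; case: ifPn => // _.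
apply: le_ereal_inf_tmp => _ [ab [abi _] <-]; rewrite lee_fin.
by apply: prodr_ge0 => i _; rewrite subr_ge0.
Qed.

Definition leb_outer : set rVall -> \bar R := mu_ext box_vol_inf.

HB.instance Definition _ := isOuterMeasure.Build R rVall leb_outer
  (mu_ext0 box_vol_inf0 box_vol_inf_ge0) (mu_ext_ge0 box_vol_inf_ge0)
  (le_mu_ext box_vol_inf) (mu_ext_sigma_subadditive box_vol_inf_ge0).

Definition LebRn := caratheodory_type leb_outer.
Definition lebn : set LebRn -> \bar R := leb_outer.

Lemma lebn0 : lebn set0 = 0%E.
Proof. exact: (caratheodory_measure0 leb_outer). Qed.
Lemma lebn_ge0 (A : set LebRn) : (0 <= lebn A)%E.
Proof. exact: (mu_ext_ge0 box_vol_inf_ge0). Qed.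
Lemma lebn_sigma_additive : semi_sigma_additive lebn.
Proof. exact: caratheodory_measure_sigma_additive. Qed.

HB.instance Definition _ := isMeasure.Build _ _ _ lebn
  lebn0 lebn_ge0 lebn_sigma_additive.


Definition Gamma (s : R) : R :=
  Rintegral (@lebesgue_measure R) [set t : R | 0 < t]
    (fun t => t `^ (s - 1) * expR (- t)).

Definition mu_const (alpha : R) : R :=
  2 `^ alpha * pi `^ (- (n%:R / 2)) * Gamma ((n%:R + alpha + 1) / 2)
  / Gamma ((1 - alpha) / 2).

Fixpoint iter_dir (vs : seq 'rV[R]_n) (f : 'rV[R]_n -> 'rV[R]_n)
  : 'rV[R]_n -> 'rV[R]_n :=
  match vs with
  | [::] => f
  | v :: vs' => 'D_v (iter_dir vs' f)
  end.

Definition smooth (f : 'rV[R]_n -> 'rV[R]_n) : Prop :=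
  forall (vs : seq 'rV[R]_n) (x : 'rV[R]_n), differentiable (iter_dir vs f) x.

Definition test_field (phi : 'rV[R]_n -> 'rV[R]_n) : Prop :=
  smooth phi /\ compact (closure [set x | phi x != 0]).

Definition frac_div (alpha : R) (phi : 'rV[R]_n -> 'rV[R]_n) (x : 'rV[R]_n) : R :=
  mu_const alpha *
  Rintegral lebn setT
    ((fun y : 'rV[R]_n => dotRn (y - x) (phi y - phi x)
        / enorm (y - x) `^ (n%:R + alpha + 1)) : LebRn -> R).

Definition frac_var (alpha : R) (f : 'rV[R]_n -> R) : \bar R :=
  ereal_sup [set (Rintegral lebn setT
                   ((fun x => f x * frac_div alpha phi x) : LebRn -> R))%:E
            | phi in [set phi | test_field phi /\ forall x, enorm (phi x) <= 1]].

Definition in_Lp (p : \bar R) (f : 'rV[R]_n -> R) : Prop :=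
  measurable_fun setT (f : LebRn -> R) /\
  (Lnorm lebn p (EFin \o (f : LebRn -> R)) < +oo)%E.

Definition in_BV (alpha : R) (p : \bar R) (f : 'rV[R]_n -> R) : Prop :=
  in_Lp p f /\ (frac_var alpha f < +oo)%E.

Local Notation BorelRn := (g_sigma_algebraType (@open 'rV[R]_n)).

Definition vmeas (P N : 'I_n -> {finite_measure set BorelRn -> \bar R})
  (E : set BorelRn) : 'rV[R]_n :=
  \row_i fine (P i E - N i E)%E.

Definition vintegral (P N : 'I_n -> {finite_measure set BorelRn -> \bar R})
  (phi : 'rV[R]_n -> 'rV[R]_n) : R :=
  \sum_(i < n) (Rintegral (P i) setT ((fun x => phi x 0 i) : BorelRn -> R)
               - Rintegral (N i) setT ((fun x => phi x 0 i) : BorelRn -> R)).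

Definition is_frac_grad (alpha : R) (f : 'rV[R]_n -> R)
  (P N : 'I_n -> {finite_measure set BorelRn -> \bar R}) : Prop :=
  forall phi, test_field phi ->
    Rintegral lebn setT ((fun x => f x * frac_div alpha phi x) : LebRn -> R)
    = - vintegral P N phi.

Definition total_variation (P N : 'I_n -> {finite_measure set BorelRn -> \bar R})
  (A : set BorelRn) : \bar R :=
  ereal_sup [set (\sum_(k <oo) (enorm (vmeas P N (E k)))%:E)%E
            | E in [set E : nat -> set BorelRn |
                     (forall k, measurable (E k)) /\ trivIset setT E /\
                     \bigcup_k E k = A]].

Definition diam (E : set 'rV[R]_n) : \bar R :=
  ereal_sup [set (enorm (xy.1 - xy.2))%:E | xy in [set xy | E xy.1 /\ E xy.2]].

Definition omega (s : R) : R := pi `^ (s / 2) / Gamma (s / 2 + 1).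

Definition haus_term (s : R) (E : set 'rV[R]_n) : \bar R :=
  if `[< E = set0 >] then 0%E else (omega s * (fine (diam E) / 2) `^ s)%:E.

Definition haus_delta (s delta : R) (A : set 'rV[R]_n) : \bar R :=
  ereal_inf [set (\sum_(k <oo) haus_term s (E k))%E
            | E in [set E : nat -> set 'rV[R]_n |
                     A `<=` \bigcup_k E k /\ forall k, (diam (E k) <= delta%:E)%E]].

Definition hausdorff (s : R) (A : set 'rV[R]_n) : \bar R :=
  ereal_sup [set haus_delta s delta A | delta in [set delta : R | 0 < delta]].

Definition abs_cont_hausdorff (s : R)
  (P N : 'I_n -> {finite_measure set BorelRn -> \bar R}) : Prop :=
  forall A : set BorelRn, measurable A ->
    hausdorff s A = 0%E -> total_variation P N A = 0%E.

Definition n_over_p (p : \bar R) : R :=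
  match p with
  | EFin r => n%:R / r
  | _ => 0
  end.

End Rn.

(* Main.v *)
(* By inner regularity it suffices to show that each component of the gradient
   measure vanishes on a compact set [K] with [H^s K = 0]. Cover [K] by finitely
   many cubes centred on [K] with radii [r_j] and small [sum_j r_j^s], and test
   the gradient against [F e_i], where [F] is a smooth cutoff equal to [1] on [K]
   and supported near [K]; as the cubes shrink, the right-hand side tends to the
   mass of [K], so it suffices that [int f div^alpha(F e_i)] can be made small.
   - If [p >= n / (1 - alpha)], let [F = 1 - prod_j (1 - eta_j)] with [eta_j] a
     bump on the [j]-th cube. Scaling bounds the fractional divergence by
     [sum_j r_j^-alpha h((x - c_j) / r_j)] with [h(z) = min(1, |z|^(-n-alpha))],
     and the integral against [f] in [L^p] by [C sum_j r_j^(n - alpha - n/p)].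
   - If [p < n / (1 - alpha)], fix such a cutoff [theta] and multiply it by a
     cutoff [chi] built, from a second cover, out of cylinders parallel to the
     [i]-th axis. Integrating by parts, [div^alpha(theta chi e_i)] is a constant
     multiple of the convolution of [chi D_i theta] with [|z|^(-(n-1+alpha))];
     since [chi D_i theta] is bounded and its support has volume at most
     [C sum_j r_j^(n-1)], this is at most [tau min(1, |x|^(-(n-1+alpha)))] with
     [tau] as small as desired, and [f] is integrable against that weight. *)
Require Import Defs.
From HB Require Import structures.
From mathcomp Require Import all_boot all_order all_algebra.
From mathcomp Require Import all_classical all_reals all_analysis.
From mathcomp Require Import measurable_realfun ess_sup_inf ring lra.
Import Order.TTheory GRing.Theory Num.Theory.
Import numFieldNormedType.Exports.
Local Open Scope classical_set_scope.
Local Open Scope ring_scope.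
Set Implicit Arguments. Unset Strict Implicit. Unset Printing Implicit Defensive.

(** For [p < n / (1 - alpha)] cutoffs by cubes alone fail: the exponent [n - alpha - n/p] is then
    below [n - 1], so [H^(n-1) K = 0] does not make the sums [sum_j r_j^(n - alpha - n/p)] small. A
    cutoff that is constant along the [i]-th axis contributes nothing to the [i]-th derivative of
    the product; only the derivative of the fixed [theta] remains, and its bound does not
    deteriorate when the second cover is refined. All size estimates have one shape: the integrand
    is dominated pointwise by an explicit measurable function whose integral is known, so that
    measurability of [div^alpha] in [x] never intervenes. Integration by parts rests on translation
    invariance and dominated convergence: the difference quotients of a compactly supported function
    have integral 0. The singular kernel is reached by replacing [|y - x|^2] with [|y - x|^2 + d].
    The derivative of the regularized kernel is odd about [x], so [F] can be replaced by [F - F x]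
    before [d] tends to 0, and this difference tames the singularity. Throughout, [|x|] is the sup
    norm and [enorm] the Euclidean one. *)

Section LebesgueRn.

(** * Lebesgue outer measure: boxes, half-spaces and Borel sets *)

Context {R : realType} {n : nat}.
Implicit Types (a b c x : 'rV[R]_n) (A : set 'rV[R]_n).

Lemma box_vol_inf_box (a b : 'rV[R]_n) (F : set (rVall R n)) :
  (forall i, a 0 i <= b 0 i) ->
  F `<=` [set x | forall i, a 0 i <= x 0 i <= b 0 i] ->
  (box_vol_inf F <= (\prod_(i < n) (b 0 i - a 0 i))%:E)%E.
Proof.
move=> ab Fab; rewrite /box_vol_inf; case: ifPn => _.
  by rewrite lee_fin prodr_ge0// => i _; rewrite subr_ge0.
by apply: ereal_inf_lbound; exists (a, b).
Qed.

Lemma leb_outer_box (a b : 'rV[R]_n) (F : set (rVall R n)) :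
  (forall i, a 0 i <= b 0 i) ->
  F `<=` [set x | forall i, a 0 i <= x 0 i <= b 0 i] ->
  (leb_outer F <= (\prod_(i < n) (b 0 i - a 0 i))%:E)%E.
Proof.
move=> ab Fab; apply: le_trans (box_vol_inf_box ab Fab).
apply: ereal_inf_lbound; exists (fun k => if k is 0 then F else set0).
  by split=> // x Fx; exists 0.
rewrite (nneseries_split 0 1) ?add0n; last by move=> *; exact: box_vol_inf_ge0.
rewrite big_nat1 eseries0 ?adde0// => -[]// k _ _.
exact: box_vol_inf0.
Qed.

Definition halfspace (i : 'I_n) (t : R) : set 'rV[R]_n := [set x | x 0 i <= t].

(** A hyperplane orthogonal to an axis cuts a box into two boxes whose volumes add up exactly. This
    is the Caratheodory inequality for a single covering set. *)
Lemma box_vol_inf_halfspace (i : 'I_n) (t : R) (F : set (rVall R n)) :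
  (box_vol_inf (F `&` halfspace i t) +
   box_vol_inf (F `&` ~` halfspace i t) <= box_vol_inf F)%E.
Proof.
set H := halfspace i t; rewrite [in leRHS]/box_vol_inf; case: ifPn => [/asboolP ->|_].
  by rewrite !set0I box_vol_inf0 adde0.
apply: le_ereal_inf_tmp => _ [[a b]/= [ab Fab] <-].
have [ta|at_] := ltP t (a 0 i).
  rewrite (_ : F `&` H = set0) ?box_vol_inf0 ?add0e; last first.
    apply/seteqP; split=> // x [/Fab/(_ i)/andP[+ _] /= xt].
    by move/(lt_le_trans ta)/(le_lt_trans xt); rewrite ltxx.
  by apply: box_vol_inf_box => // x [/Fab].
have [bt|tb] := leP (b 0 i) t.
  rewrite [X in (_ + box_vol_inf X)%E](_ : _ = set0) ?box_vol_inf0 ?adde0.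
    by apply: box_vol_inf_box => // x [/Fab].
  apply/seteqP; split=> // x [/Fab/(_ i)/andP[_ xb]] /=; apply.
  exact: le_trans xb bt.
(* The plane crosses the box: each piece differs from it in one endpoint of the [i]-th side only. *)
pose b' := \row_j (if j == i then t else b 0 j).
pose a' := \row_j (if j == i then t else a 0 j).
have E : \prod_j (b 0 j - a 0 j) =
    \prod_j (b' 0 j - a 0 j) + \prod_j (b 0 j - a' 0 j).
  rewrite [LHS](bigD1 i)//= [X in _ = X + _](bigD1 i)//= [X in _ = _ + X](bigD1 i)//=.
  rewrite !mxE eqxx.
  rewrite [X in _ = _ * X + _](eq_bigr (fun j => b 0 j - a 0 j)); last first.
    by move=> j ji; rewrite !mxE (negbTE ji).
  rewrite [X in _ = _ + _ * X](eq_bigr (fun j => b 0 j - a 0 j)); last first.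
    by move=> j ji; rewrite !mxE (negbTE ji).
  by rewrite -mulrDl; congr (_ * _); lra.
rewrite E EFinD leeD//; apply: box_vol_inf_box.
- by move=> j; rewrite mxE; case: eqP => [->|].
- move=> x [/Fab + xt] j => /(_ j)/andP[-> xb] /=; rewrite mxE.
  by case: eqP => [->|].
- by move=> j; rewrite mxE; case: eqP => [->|//]; exact: ltW.
- move=> x [/Fab + /negP] => + + j => /(_ j)/andP[xa ->]; rewrite -ltNge => tx.
  by rewrite andbT mxE; case: eqP => [->|//]; exact: ltW.
Qed.

(** All sets are measurable in the discrete structure on [rVall], so covers consist of arbitrary
    sets. Intersecting the members of a cover with the half-space and with its complement therefore
    gives admissible covers of both parts. *)
Lemma measurable_halfspace (i : 'I_n) (t : R) :
  measurable (halfspace i t : set (LebRn R n)).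
Proof.
apply: le_caratheodory_measurable => X /=.
set H := halfspace i t; apply: le_ereal_inf_tmp => _ [F [_ XF] <-].

apply: (@le_trans _ _ (\sum_(k <oo) (box_vol_inf (F k `&` H) +
   box_vol_inf (F k `&` ~` H)))%E); last first.
  apply: lee_nneseries => k _; last exact: box_vol_inf_halfspace.
  by rewrite adde_ge0// box_vol_inf_ge0.
rewrite nneseriesD//; try by move=> *; exact: box_vol_inf_ge0.
apply: leeD; apply: ereal_inf_lbound.
- exists (fun k => F k `&` H) => //; split => // x [/XF[k _ Fx] Hx].
  by exists k.
- exists (fun k => F k `&` ~` H) => //; split => // x [/XF[k _ Fx] Hx].
  by exists k.
Qed.

Lemma measurable_coord (i : 'I_n) :
  measurable_fun setT ((fun x => x 0 i) : LebRn R n -> R).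
Proof.
apply: (measurability _ (RGenCInfty.measurableE R)) => _ [_ [t ->] <-].
rewrite setTI (_ : _ @^-1` _ = ~` (\bigcup_k halfspace i (t - k.+1%:R^-1))).
  apply/measurableC/bigcupT_measurable => k; exact: measurable_halfspace.
apply/seteqP; split=> x /=; rewrite in_itv/= andbT.
  move=> tx [k _ /=]; apply/negP; rewrite -ltNge.
  by apply: lt_le_trans tx; rewrite ltrBlDr ltrDl invr_gt0.
move=> h; rewrite leNgt; apply/negP => xt; apply: h.
have d0 : 0 < t - x 0 i by rewrite subr_gt0.
have [k _ /(_ k (leqnn k)) /= hk] := near_infty_natSinv_lt (PosNum d0).
have {}hk : k.+1%:R^-1 < t - x 0 i := hk.
by exists k => //; rewrite /halfspace /= lerBrDr -lerBrDl ltW.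
Qed.

(** Rational centres and radii [1/(k+1)] form a countable index set, so measurability of open sets
    reduces to that of sup-norm balls, which are finite intersections of coordinate slabs. *)
Lemma open_rV_bigcup_rat (U : set 'rV[R]_n) : open U ->
  U = \bigcup_(qk in [set qk : 'rV[rat]_n * nat |
        ball (map_mx ratr qk.1 : 'rV[R]_n) (qk.2.+1%:R^-1) `<=` U])
        ball (map_mx ratr qk.1 : 'rV[R]_n) (qk.2.+1%:R^-1).
Proof.
move=> oU; apply/seteqP; split=> [x Ux|x [qk /= + xq]]; last exact.
have /nbhs_ballP[e /= e0 xeU] := open_nbhs_nbhs (conj oU Ux).
have e20 : 0 < e / 2 by rewrite divr_gt0.
have [k _ /(_ k (leqnn k)) /= hk] := near_infty_natSinv_lt (PosNum e20).
have {}hk : k.+1%:R^-1 < e / 2 := hk.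
have rk : 0 < k.+1%:R^-1 :> R by rewrite invr_gt0.
have hq i : exists q : rat, ratr q \in `](x 0 i - k.+1%:R^-1), (x 0 i + k.+1%:R^-1)[.
  by apply: rat_in_itvoo; rewrite ltrBlDr -addrA ltrDl addr_gt0.
have xq : ball (map_mx ratr (\row_i projT1 (cid (hq i))) : 'rV[R]_n) k.+1%:R^-1 x.
  split => // i j; rewrite !mxE ord1; case: cid => q /=; rewrite in_itv/= => /andP[h1 h2].
  rewrite /ball/= ltr_norml; move: h1 h2; set d := k.+1%:R^-1 => h1 h2.
  by apply/andP; split; lra.
exists (\row_i projT1 (cid (hq i)), k) => //= y qy; apply: xeU.
have -> : e = e / 2 + e / 2 by lra.
apply: ball_triangle (le_ball (ltW hk) qy).
exact/ball_sym/(le_ball (ltW hk) xq).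
Qed.

Lemma open_measurable_LebRn (U : set 'rV[R]_n) : open U ->
  measurable (U : set (LebRn R n)).
Proof.
move=> /open_rV_bigcup_rat ->; rewrite bigcup_mkcond.
apply: countable_bigcupT_measurable => // -[q k] /=.
case: ifPn => // _.
set c := map_mx _ _; set r := _^-1.
have r0 : 0 < r by rewrite invr_gt0.
rewrite (_ : ball c r = \bigcap_(i in [set: 'I_n]) [set x : 'rV[R]_n | c 0 i - r < x 0 i < c 0 i + r]).
  apply: fin_bigcap_measurable => // i _.
  have := measurable_coord i measurableT (measurable_itv `](c 0 i - r), (c 0 i + r)[).
  by rewrite setTI; congr measurable; apply/seteqP; split => x; rewrite /= in_itv.
apply/seteqP; split=> [x [_ h] i _|x h] /=.
  by have := h 0 i; rewrite /ball/= ltr_norml => /andP[? ?]; apply/andP; split; lra.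
split=> // i j; rewrite ord1; have /andP[? ?] := h j I.
by rewrite /ball/= ltr_norml; apply/andP; split; lra.
Qed.

Lemma closed_measurable_LebRn (F : set 'rV[R]_n) : closed F ->
  measurable (F : set (LebRn R n)).
Proof.
move=> /closed_openC/open_measurable_LebRn/measurableC.
by rewrite setCK.
Qed.

Lemma continuous_measurable_LebRn (f : 'rV[R]_n -> R) : continuous f ->
  measurable_fun setT (f : LebRn R n -> R).
Proof.
move=> /continuousP cf; apply: (measurability _ (RGenOpens.measurableE R)).
move=> _ [_ [a [b ->] <-]]; rewrite setTI.
apply: open_measurable_LebRn; exact: cf.
Qed.

Lemma continuous_measurable_BorelRn (f : 'rV[R]_n -> R) : continuous f ->
  measurable_fun setT (f : BorelRn R n -> R).
Proof.
move=> /continuousP cf; apply: (measurability _ (RGenOpens.measurableE R)).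
move=> _ [_ [a [b ->] <-]]; rewrite setTI.
by apply: sub_sigma_algebra; exact: cf.
Qed.

End LebesgueRn.

(** * Affine changes of variables *)

Section Affine.
Context {R : realType} {n : nat}.
Local Notation mu := (@lebn R n).
Implicit Types (r : R) (c x : 'rV[R]_n).

Definition affine r c (x : 'rV[R]_n) : 'rV[R]_n := c + r *: x.

Lemma affineK r c : r != 0 -> cancel (affine r c) (affine r^-1 (- (r^-1 *: c))).
Proof. by move=> r0 x; rewrite /affine scalerDr scalerA mulVf// scale1r addKr. Qed.

Lemma affineVK r c : r != 0 -> cancel (affine r^-1 (- (r^-1 *: c))) (affine r c).
Proof.
by move=> r0 x; rewrite /affine scalerDr scalerN !scalerA divff// !scale1r addrA subrr add0r.
Qed.

Lemma box_vol_inf_affine_le r c (F : set (rVall R n)) : r != 0 ->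
  (box_vol_inf (affine r c @^-1` F) <= (`|r| ^- n)%:E * box_vol_inf F)%E.
Proof.
move=> r0; have k0 : 0 < `|r| ^- n by rewrite invr_gt0 exprn_gt0 ?normr_gt0.
rewrite -lee_pdivrMl// [in leRHS]/box_vol_inf; case: ifPn => [/asboolP ->|_].
  by rewrite preimage_set0 box_vol_inf0 mule0.
apply: le_ereal_inf_tmp => _ [[a b]/= [ab Fab] <-].
rewrite lee_pdivrMl// -EFinM -exprVn -[X in (_ ^+ X)]card_ord -prodr_const -big_split/=.
(* A negative [r] reverses every side of the box, so the endpoints are exchanged. *)
pose a' := \row_i (((if 0 < r then a else b) 0 i - c 0 i) / r).
pose b' := \row_i (((if 0 < r then b else a) 0 i - c 0 i) / r).
rewrite (eq_bigr (fun i => b' 0 i - a' 0 i)); last first.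
  move=> i _; rewrite !mxE; case: ifPn => rp; first by rewrite gtr0_norm//; lra.
  by rewrite ltr0_norm ?invrN; [lra|rewrite lt_neqAle r0 leNgt].
apply: box_vol_inf_box => [i|x /Fab/= h i]; rewrite !mxE.
  case: ifPn => rp; first by rewrite ler_pM2r ?invr_gt0// lerD2r.
  by rewrite ler_nM2r ?lerD2r// invr_lt0 lt_neqAle r0 leNgt.
have /andP[] := h i; rewrite !mxE => h1 h2; case: ifPn => rp.
  by rewrite ler_pdivrMr// ler_pdivlMr//; apply/andP; split; lra.
have rn : r < 0 by rewrite lt_neqAle r0 leNgt.
by rewrite ler_ndivrMr// ler_ndivlMr//; apply/andP; split; lra.
Qed.

Lemma leb_outer_affine_le r c (F : set (rVall R n)) : r != 0 ->
  (leb_outer (affine r c @^-1` F) <= (`|r| ^- n)%:E * leb_outer F)%E.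
Proof.
move=> r0; have k0 : 0 < `|r| ^- n by rewrite invr_gt0 exprn_gt0 ?normr_gt0.
rewrite -lee_pdivrMl//.
apply: le_ereal_inf_tmp => _ [G [_ FG] <-].
rewrite lee_pdivrMl// -nneseriesZl; last by move=> *; exact: box_vol_inf_ge0.
apply: (@le_trans _ _ (\sum_(k <oo) box_vol_inf (affine r c @^-1` (G k)))%E).
  apply: ereal_inf_lbound; exists (fun k => affine r c @^-1` (G k)) => //.
  by split => // x /FG[k _ Gx]; exists k.
apply: lee_nneseries => *; [exact: box_vol_inf_ge0|exact: box_vol_inf_affine_le].
Qed.

(** The reverse inequality is the previous one applied to the inverse affine map. *)
Lemma leb_outer_affine r c (F : set (rVall R n)) : r != 0 ->
  leb_outer (affine r c @^-1` F) = ((`|r| ^- n)%:E * leb_outer F)%E.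
Proof.
move=> r0; have k0 : 0 < `|r| ^- n by rewrite invr_gt0 exprn_gt0 ?normr_gt0.
apply/eqP; rewrite eq_le leb_outer_affine_le//= -lee_pdivlMl//.
have := leb_outer_affine_le (- (r^-1 *: c)) (affine r c @^-1` F) (invr_neq0 r0).
rewrite (_ : _ @^-1` (_ @^-1` F) = F); first by rewrite normfV exprVn.
by apply/seteqP; split=> x /=; rewrite affineVK.
Qed.

Lemma cara_affine r c (A : set (LebRn R n)) : r != 0 ->
  measurable A -> measurable (affine r c @^-1` A : set (LebRn R n)).
Proof.
move=> r0 mA; have {}mA : caratheodory_measurable (@leb_outer R n) A by exact: mA.
apply: le_caratheodory_measurable => X /=.
have [Y ->] : exists Y, X = affine r c @^-1` Y.
  exists (affine r^-1 (- (r^-1 *: c)) @^-1` X).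
  by apply/seteqP; split=> x /=; rewrite affineK.
change (leb_outer (affine r c @^-1` (Y `&` A)) +
  leb_outer (affine r c @^-1` (Y `&` ~` A)) <= leb_outer (affine r c @^-1` Y))%E.
rewrite !leb_outer_affine// -ge0_muleDr.
- by rewrite lee_pmul2l ?lte_fin ?invr_gt0 ?exprn_gt0 ?normr_gt0// -mA.
- exact: (mu_ext_ge0 (@box_vol_inf_ge0 R n)).
- exact: (mu_ext_ge0 (@box_vol_inf_ge0 R n)).
Qed.

Lemma measurable_affine r c : r != 0 ->
  measurable_fun setT (affine r c : LebRn R n -> LebRn R n).
Proof. by move=> r0 _ A mA; rewrite setTI; exact: cara_affine. Qed.

Lemma ge0_integral_affine r c (g : LebRn R n -> \bar R) : r != 0 ->
  measurable_fun setT g -> (forall x, 0 <= g x)%E ->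
  (\int[mu]_x g (affine r c x) = (`|r| ^- n)%:E * \int[mu]_x g x)%E.
Proof.
move=> r0 mg g0; have k0 : 0 <= `|r| ^- n by rewrite invr_ge0 exprn_ge0.
have := @ge0_integral_pushforward _ _ _ _ R _ (measurable_affine c r0) mu setT g
   measurableT mg (fun x _ => g0 x).
rewrite preimage_setT => <-.
rewrite (_ : pushforward _ _ = mscale (NngNum k0) mu) ?ge0_integral_mscale//.
by apply/funext => A; exact: leb_outer_affine.
Qed.

(** Positive and negative parts are transported separately, so no integrability is assumed. The case
    [r = 1] is translation; [r = -1] is the reflection that later makes odd kernels integrate to
    0. *)
Lemma integral_affine r c (g : LebRn R n -> \bar R) : `|r| = 1 ->
  measurable_fun setT g -> (\int[mu]_x g (affine r c x) = \int[mu]_x g x)%E.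
Proof.
move=> r1 mg; have r0 : r != 0 by rewrite -normr_gt0 r1.
have h (k : LebRn R n -> \bar R) : measurable_fun setT k -> (forall x, 0 <= k x)%E ->
    (\int[mu]_x k (affine r c x) = \int[mu]_x k x)%E.
  by move=> mk k0; rewrite ge0_integral_affine// r1 expr1n invr1 mul1e.
rewrite integralE [RHS]integralE -(h g^\+%E)//; last exact: measurable_funepos.
rewrite -(h g^\-%E)//; last exact: measurable_funeneg.
by apply: (f_equal2 (fun a b => a - b)%E); apply: eq_integral => x _;
  rewrite ?funeposE ?funenegE.
Qed.

End Affine.

(** * Bounds for integrals of possibly nonmeasurable functions *)

Section NonmeasurableBounds.
Context d (T : measurableType d) (R : realType) (mu : {measure set T -> \bar R}).

(* Unlike [ge0_le_integral], no measurability is required: the integral of a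
   nonnegative function is a supremum over the simple functions below it. *)
Lemma ge0_le_integral_sup (f g : T -> \bar R) :
  (forall x, 0 <= f x)%E -> (forall x, f x <= g x)%E ->
  (\int[mu]_x f x <= \int[mu]_x g x)%E.
Proof.
move=> f0 fg; have g0 x : (0 <= g x)%E := le_trans (f0 x) (fg x).
rewrite !ge0_integralTE//; apply: ereal_sup_le => _ [h hf <-].
by exists h => // x; exact: le_trans (hf x) (fg x).
Qed.

(** The integrals of the positive and negative parts of [h] both lie in [[0, B]], hence so does the
    absolute value of their difference. Since [h] is arbitrary, the lemma applies to integrands
    containing [frac_div]. *)
Lemma normr_Rintegral_le (h : T -> R) (g : T -> \bar R) (B : R) :
  (forall x, `|h x|%:E <= g x)%E -> (\int[mu]_x g x <= B%:E)%E ->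
  `|Rintegral mu setT h| <= B.
Proof.
move=> hg gB.
have g0 x : (0 <= g x)%E by apply: le_trans (hg x).
have hp : (\int[mu]_x ((EFin \o h)^\+ x) <= B%:E)%E.
  apply: le_trans gB; apply: ge0_le_integral_sup => // x.
  apply: le_trans (hg x); rewrite funeposE /= -EFin_max lee_fin.
  by rewrite ge_max normr_ge0 ler_norm.
have hn : (\int[mu]_x ((EFin \o h)^\- x) <= B%:E)%E.
  apply: le_trans gB; apply: ge0_le_integral_sup => // x.
  apply: le_trans (hg x); rewrite funenegE /= -EFin_max lee_fin.
  by rewrite ge_max normr_ge0 -normrN ler_norm.
have hp0 : (0 <= \int[mu]_x ((EFin \o h)^\+ x))%E by exact: integral_ge0.
have hn0 : (0 <= \int[mu]_x ((EFin \o h)^\- x))%E by exact: integral_ge0.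
rewrite /Rintegral integralE -/(EFin \o h).
move: hp hn hp0 hn0; case: (integral _ _ _) => [u||]//; case: (integral _ _ _) => [v||]//=.
rewrite !lee_fin => *; rewrite ler_norml; apply/andP; split; lra.
Qed.

Lemma integral_scale_indic2 (A B : set T) (a b : R) :
  measurable A -> measurable B -> 0 <= a -> 0 <= b ->
  (\int[mu]_x (a%:E * (\1_A x)%:E + b%:E * (\1_B x)%:E) =
   a%:E * mu A + b%:E * mu B)%E.
Proof.
move=> mA mB a0 b0.
have mI C : measurable C -> measurable_fun setT (fun z : T => (\1_C z : R)%:E).
  by move=> mC; apply/measurable_EFinP; exact/measurable_indic.
rewrite ge0_integralD//.
- rewrite !ge0_integralZl_EFin//; try by exact: mI.
  by rewrite !integral_indic// !setIT.
- by move=> x _; rewrite -EFinM lee_fin mulr_ge0.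
- by apply: measurable_funeM; exact: mI.
- by move=> x _; rewrite -EFinM lee_fin mulr_ge0.
- by apply: measurable_funeM; exact: mI.
Qed.

End NonmeasurableBounds.

Lemma nneseries_ge_term (R : realType) (u : nat -> \bar R) (k : nat) :
  (forall i, 0 <= u i)%E -> (u k <= \sum_(i <oo) u i)%E.
Proof.
move=> u0; apply: le_trans (nneseries_lim_ge k.+1 _); last by [].
by rewrite big_nat_recr//= leeDr// sume_ge0.
Qed.

Lemma nneseries_geometric_lty (R : realType) (c q : R) :
  0 <= c -> 0 <= q < 1 -> (\sum_(k <oo) (c * q ^+ k)%:E < +oo)%E.
Proof.
move=> c0 /andP[q0 q1]; apply: (@le_lt_trans _ _ (c / (1 - q))%:E); last by rewrite ltry.
apply: lime_le.
  by apply: is_cvg_nneseries => k _ _; rewrite lee_fin mulr_ge0// exprn_ge0.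
apply: nearW => m; rewrite sumEFin lee_fin -mulr_sumr ler_wpM2l//.
rewrite -div1r ler_pdivlMr ?subr_gt0// mulrC -opprB mulNr big_mkord -subrX1.
by rewrite opprB gerBl exprn_ge0.
Qed.

(** * Sup norm, Euclidean norm and cubes *)

Section NormRn.
Context {R : realType} {n : nat}.
Implicit Types (x y : 'rV[R]_n).

Lemma coord_le_norm x i : `|x 0 i| <= `|x|.
Proof.
rewrite [leRHS]/Num.Def.normr /= mx_normrE; apply/bigmax_geP; right => /=.
by exists (0, i).
Qed.

Lemma norm_le_coord x (r : R) : 0 <= r -> (forall i, `|x 0 i| <= r) -> `|x| <= r.
Proof.
move=> r0 h; rewrite [leLHS]/Num.Def.normr /= mx_normrE; apply/bigmax_leP; split=> //.
by move=> [i j] _ /=; rewrite ord1.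
Qed.

Lemma dotRn_ge0 x : 0 <= dotRn x x.
Proof. by apply: sumr_ge0 => i _; rewrite -expr2 sqr_ge0. Qed.

Lemma coord_le_enorm x i : `|x 0 i| <= enorm x.
Proof.
rewrite -sqrtr_sqr ler_wsqrtr// /dotRn (bigD1 i)//= -expr2 lerDl.
by apply: sumr_ge0 => j _; rewrite -expr2 sqr_ge0.
Qed.

Lemma enorm_ge0 x : 0 <= enorm x. Proof. exact: sqrtr_ge0. Qed.

(** This comparison bounds negative powers of [enorm] by those of the sup norm, and sup-norm radii
    by Euclidean diameters. *)
Lemma norm_le_enorm x : `|x| <= enorm x.
Proof. by apply: norm_le_coord => [|i]; [exact: enorm_ge0|exact: coord_le_enorm]. Qed.

Definition cube (c : 'rV[R]_n) (r : R) : set 'rV[R]_n := [set y | `|y - c| <= r].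

Lemma closed_cube c r : closed (cube c r).
Proof.
rewrite (_ : cube c r = (fun y => `|y - c|) @^-1` [set t | t <= r])//.
apply: closed_comp; last exact: closed_le.
move=> x _; apply: (@continuous_comp _ _ _ (fun y => y - c)); last exact: norm_continuous.
by apply: continuousB; [exact: cvg_id|exact: cst_continuous].
Qed.

Lemma measurable_cube c r : measurable (cube c r : set (LebRn R n)).
Proof. exact/closed_measurable_LebRn/closed_cube. Qed.

Lemma compact_cube c r : compact (cube c r).
Proof.
apply: bounded_closed_compact; last exact: closed_cube.
exists (r + `|c|); split=> [|M rM x /= xr]; first exact: num_real.
rewrite -(subrK c x) (le_trans (ler_normD _ _))// (le_trans _ (ltW rM))//.
by rewrite lerD2r.
Qed.

Lemma lebn_cube c r : 0 <= r -> (lebn (cube c r) <= ((2 * r) ^+ n)%:E)%E.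
Proof.
move=> r0; have -> : (2 * r) ^+ n = \prod_(i < n) ((\row_i (c 0 i + r)) 0 i - (\row_i (c 0 i - r)) 0 i : R).
  rewrite (eq_bigr (fun=> 2 * r)) ?prodr_const ?card_ord// => i _; rewrite !mxE; lra.
apply: leb_outer_box => [i|y yc i]; rewrite !mxE; first by lra.
have := le_trans (coord_le_norm _ i) yc; rewrite !mxE ler_norml => /andP[? ?].
by apply/andP; split; lra.
Qed.

End NormRn.

(** * Integrability of power weights *)

Section Weight.
Context {R : realType} {n : nat}.
Local Notation mu := (@lebn R n).
Implicit Types (a b : R) (z : 'rV[R]_n).

(** Two exponents separate the singularity at the origin from the decay at infinity; for [b >= 0],
    [weight 0 b] is [min(1, |z|^(-b))]. At the origin the conventions of [powR] give 0 if [a != 0]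
    and 1 if [a = 0]. *)
Definition weight a b z : R := if `|z| <= 1 then `|z| `^ (- a) else `|z| `^ (- b).

Lemma weight_ge0 a b z : 0 <= weight a b z.
Proof. by rewrite /weight; case: ifP => _; exact: powR_ge0. Qed.

Lemma measurable_weight a b : measurable_fun setT (weight a b : LebRn R n -> R).
Proof.
have mN : measurable_fun setT ((fun z => `|z|) : LebRn R n -> R).
  by apply: continuous_measurable_LebRn; exact: norm_continuous.
apply: measurable_fun_ifT.
- by apply: measurable_fun_ler => //; exact: measurable_cst.
- exact: (measurableT_comp (measurable_powR (- a)) mN).
- exact: (measurableT_comp (measurable_powR (- b)) mN).
Qed.

Lemma dyadic_small (t : R) : 0 < t <= 1 ->
  exists k : nat, 2 ^- k.+1 < t <= 2 ^- k.
Proof.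
move=> /andP[t0 t1].
have ex : exists k, 2 ^- k.+1 < t.
  have [k _ /(_ k.+1 (leqW (leqnn k)))] := near_infty_natSinv_expn_lt (PosNum t0).
  by rewrite /= div1r => h; exists k.
case: (ex_minnP ex) => k tk kmin; exists k; rewrite tk /=.
case: k tk kmin => [|k] tk kmin; first by rewrite expr0 invr1.
by rewrite leNgt; apply/negP => /kmin; rewrite ltnn.
Qed.

Lemma dyadic_large (t : R) : 1 < t -> exists k : nat, 2 ^+ k < t <= 2 ^+ k.+1.
Proof.
move=> t1.
have ex : exists k, t <= 2 ^+ k.+1.
  exists (Num.trunc t); rewrite (le_trans (ltW (truncnS_gt _)))//.
  by rewrite -natrX ler_nat; exact: ltnW (ltn_expl _ _).
case: (ex_minnP ex) => k tk kmin; exists k; rewrite tk andbT.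
case: k tk kmin => [|k] tk kmin; first by rewrite expr0.
by rewrite ltNge; apply/negP => /kmin; rewrite ltnn.
Qed.

(** Dyadic shells: the inner ones contribute a geometric series of ratio [2^(a-n)], the outer ones a
    series of ratio [2^(n-b)]. *)
Lemma integral_weight_lty a b : 0 <= a < n%:R -> n%:R < b ->
  (\int[mu]_z (weight a b z)%:E < +oo)%E.
Proof.
move=> /andP[a0 an] nb.
pose A : R := 2 `^ a; pose B : R := 2 `^ (- b); pose N : R := 2 ^+ n.
have A0 : 0 < A by exact: powR_gt0.
have B0 : 0 < B by exact: powR_gt0.
have N0 : 0 < N by exact: exprn_gt0.
have AN : A < N.
  by rewrite /N -powR_mulrn// /A; rewrite /powR pnatr_eq0/= ltr_expR ltr_pM2r ?ln_gt0// ltr1n.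
have BN : B * N < 1.
  rewrite /N -powR_mulrn// /B -powRD ?pnatr_eq0 ?implybT// -[X in _ < X](powRr0 2).
  by rewrite /powR pnatr_eq0/= ltr_expR ltr_pM2r ?ln_gt0 ?ltr1n// addrC subr_lt0.
(* The first term dominates the weight for [2^-(k+1) < |z| <= 2^-k], the second for
   [2^k < |z| <= 2^(k+1)]. Shells are enlarged to full cubes, whose volume is at hand. *)
pose F k z : \bar R := ((A ^+ k.+1)%:E * (\1_(cube (0 : 'rV[R]_n) (2 ^- k)) z)%:E +
  (B ^+ k)%:E * (\1_(cube (0 : 'rV[R]_n) (2 ^+ k.+1)) z)%:E)%E.
have F0 k z : (0 <= F k z)%E.
  by rewrite /F -!EFinM -EFinD lee_fin addr_ge0// mulr_ge0// ?exprn_ge0// ltW.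
have mF k : measurable_fun setT (F k : LebRn R n -> \bar R).
  apply: emeasurable_funD; apply: measurable_funeM; apply/measurable_EFinP;
    exact/measurable_indic/measurable_cube.
have WF z : ((weight a b z)%:E <= \sum_(k <oo) F k z)%E.
  rewrite /weight; case: ifPn => [z1|]; last first.
    rewrite -ltNge => /dyadic_large[k /andP[zk kz]].
    apply: le_trans (nneseries_ge_term k (F0^~ z)).
    rewrite /F; apply: (@le_trans _ _ (B ^+ k)%:E).
      rewrite lee_fin /B -powR_mulrn ?powR_ge0// -powRrM mulrC powRrM powR_mulrn//.
      rewrite !powRN lef_pV2 ?posrE ?powR_gt0 ?exprn_gt0//.
        by apply: ge0_ler_powR => //; rewrite ?nnegrE ?exprn_ge0// ?ltW// (le_lt_trans a0)// (lt_trans an).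
      exact: lt_trans zk.
    rewrite [X in (_ <= _ + _ * X)%E](_ : _ = 1%E); last first.
      by rewrite indicE mem_set// /cube /= subr0.
    by rewrite mule1 leeDr// -EFinM lee_fin mulr_ge0// exprn_ge0// ltW.
  (* The origin lies in no shell; there the weight is at most 1 and the term [k = 0] suffices. *)
  have [z0|zN0] := eqVneq `|z| 0.
    apply: le_trans (nneseries_ge_term 0 (F0^~ z)).
    rewrite /F z0 [X in (_ <= _ * X + _)%E](_ : _ = 1%E); last first.
      by rewrite indicE mem_set// /cube /= subr0 z0 invr_ge0 exprn_ge0.
    rewrite mule1; apply: (@le_trans _ _ A%:E); last first.
      by rewrite expr1 leeDl// -EFinM lee_fin mulr_ge0// exprn_ge0// ltW.
    rewrite lee_fin; have [a00|aN0] := eqVneq a 0; first by rewrite /A a00 oppr0 !powRr0.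
    by rewrite powR0 ?oppr_eq0// ltW.
  have zp : 0 < `|z| by rewrite lt_neqAle eq_sym zN0 normr_ge0.
  have [|k /andP[kz zk]] := @dyadic_small `|z|; first by rewrite zp.
  apply: le_trans (nneseries_ge_term k (F0^~ z)).
  rewrite /F; apply: (@le_trans _ _ (A ^+ k.+1)%:E).
    rewrite lee_fin /A -powR_mulrn ?powR_ge0// -powRrM mulrC powRrM powR_mulrn//.
    rewrite powRN -[X in _ <= X]invrK lef_pV2 ?posrE ?powR_gt0 ?invr_gt0 ?exprn_gt0//.
    rewrite -powRN -[X in _ `^ X]mulN1r powRrM powR_inv1 ?exprn_ge0//.
    by apply: ge0_ler_powR => //; rewrite ?nnegrE ?invr_ge0 ?exprn_ge0// ltW.
  rewrite [X in (_ <= _ * X + _)%E](_ : _ = 1%E); last first.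
    by rewrite indicE mem_set// /cube /= subr0.
  by rewrite mule1 leeDl// -EFinM lee_fin mulr_ge0// exprn_ge0// ltW.
(* The cubes of radii [2^-k] and [2^(k+1)] have volumes at most [N * N^-k] and [4^n * N^k]. *)
have iF k : (\int[mu]_z F k z <= (A * N * (A / N) ^+ k)%:E + (4 ^+ n * (B * N) ^+ k)%:E)%E.
  rewrite /F integral_scale_indic2; try by rewrite exprn_ge0// ltW.
  - apply: leeD.
      apply: (@le_trans _ _ ((A ^+ k.+1)%:E * ((2 * 2 ^- k) ^+ n)%:E)%E).
        by rewrite lee_pmul2l ?lte_fin ?exprn_gt0// lebn_cube// invr_ge0 exprn_ge0.
      rewrite -EFinM lee_fin exprS !expr_div_n -!exprM mulnC exprM -/N.
      by rewrite mulrACA.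
    apply: (@le_trans _ _ ((B ^+ k)%:E * ((2 * 2 ^+ k.+1) ^+ n)%:E)%E).
      by rewrite lee_pmul2l ?lte_fin ?exprn_gt0// lebn_cube// exprn_ge0.
    rewrite -EFinM lee_fin exprS mulrA -natrM exprMn exprMn /N -!exprM mulnC.
    by rewrite mulrCA.
  - exact: measurable_cube.
  - exact: measurable_cube.
apply: (@le_lt_trans _ _ (\int[mu]_z \sum_(k <oo) F k z)%E).
  by apply: ge0_le_integral_sup => // z; rewrite lee_fin weight_ge0.
rewrite integral_nneseries//.
apply: (@le_lt_trans _ _ (\sum_(k <oo) ((A * N * (A / N) ^+ k)%:E + (4 ^+ n * (B * N) ^+ k)%:E))%E).
  by apply: lee_nneseries => // k _ _; exact: integral_ge0.
rewrite nneseriesD; last 2 first.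
- by move=> k _ _; rewrite lee_fin mulr_ge0 ?mulr_ge0 ?exprn_ge0 ?divr_ge0 ?ltW.
- by move=> k _ _; rewrite lee_fin mulr_ge0 ?mulr_ge0 ?exprn_ge0 ?divr_ge0 ?mulr_ge0 ?ltW.
rewrite lte_add_pinfty//; apply: nneseries_geometric_lty.
- by rewrite mulr_ge0 ?ltW.
- by rewrite divr_ge0 ?ltW//= ltr_pdivrMr// mul1r.
- exact: exprn_ge0.
- by rewrite mulr_ge0 ?ltW.
Qed.

End Weight.

(** * Calculus of repeatedly differentiable functions *)

Section Smooth.
Context {R : realType} {n : nat}.
Implicit Types (x v : 'rV[R]_n) (F G : 'rV[R]_n -> R).

(** Level [k] asks that all iterated directional derivatives of order at most [k] be differentiable,
    so [Ck 0] is already differentiability and [Ck 1] gives continuous first derivatives. The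
    recursion makes closure properties provable by induction on [k]. *)
Fixpoint Ck (W : normedModType R) (k : nat) (F : 'rV[R]_n -> W) : Prop :=
  (forall x, differentiable F x) /\
  match k with 0 => True | k'.+1 => forall v, Ck k' (fun x => 'D_v F x) end.

Lemma Ck_differentiable (W : normedModType R) k (F : 'rV[R]_n -> W) x :
  Ck k F -> differentiable F x.
Proof. by case: k => [|k] [dF _]. Qed.

Lemma CkW (W : normedModType R) k (F : 'rV[R]_n -> W) : Ck k.+1 F -> Ck k F.
Proof.
elim: k F => [|k IH] F [dF DF]; first by split.
by split=> // v; apply: IH; exact: DF.
Qed.

Lemma Ck_cst (W : normedModType R) k (c : W) : Ck k (fun=> c).
Proof.
elim: k c => [|k IH] c; split => // v.
rewrite (_ : 'D_v _ = fun=> 0) //; apply/funext => x.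
  exact: (derive_cst c).
Qed.

Lemma CkD k F G : Ck k F -> Ck k G -> Ck k (fun x => F x + G x).
Proof.
elim: k F G => [|k IH] F G CF CG; split => //.
- by move=> x; apply: differentiableD; apply: Ck_differentiable; eassumption.
- by move=> x; apply: differentiableD; apply: Ck_differentiable; eassumption.
move=> v; rewrite (_ : (fun x => _) = fun x => 'D_v F x + 'D_v G x).
  by apply: IH; [case: CF => _ /(_ v)|case: CG => _ /(_ v)].
apply/funext => x; apply: deriveD; apply: diff_derivable;
  apply: Ck_differentiable; eassumption.
Qed.

Lemma CkM k F G : Ck k F -> Ck k G -> Ck k (fun x => F x * G x).
Proof.
elim: k F G => [|k IH] F G CF CG; split => //.
- by move=> x; apply: differentiableM; apply: Ck_differentiable; eassumption.
- by move=> x; apply: differentiableM; apply: Ck_differentiable; eassumption.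
move=> v; rewrite (_ : (fun x => _) = fun x => F x * 'D_v G x + G x * 'D_v F x).
  by apply: CkD; apply: IH; try exact: CkW; [case: CG => _ /(_ v)|case: CF => _ /(_ v)].
apply/funext => x; apply: deriveM; apply: diff_derivable;
  apply: Ck_differentiable; eassumption.
Qed.

Lemma CkB k F G : Ck k F -> Ck k G -> Ck k (fun x => F x - G x).
Proof.
move=> CF CG; rewrite (_ : (fun x => _) = fun x => F x + (-1) * G x).
  by apply: CkD => //; apply: CkM => //; exact: Ck_cst.
by apply/funext => x; rewrite mulN1r.
Qed.

Lemma Ck_coord k i : Ck k (fun x : 'rV[R]_n => x 0 i).
Proof.
have d x : differentiable (fun x : 'rV[R]_n => x 0 i : R) x.
  exact: differentiable_coord.
case: k => [|k]; split=> // v.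
rewrite (_ : (fun x => _) = fun=> v 0 i); first exact: Ck_cst.
apply/funext => x; rewrite deriveE//.
have lin : linear (fun x : 'rV[R]_n => x 0 i : R).
  by move=> a y z; rewrite !mxE.
pose l : {linear 'rV[R]_n -> R} := HB.pack (fun x : 'rV[R]_n => x 0 i : R) (GRing.isLinear.Build _ _ _ _ _ lin).
have cl : continuous l by move=> y; apply: differentiable_continuous; exact: d.
by rewrite (@diff_lin _ _ _ l x cl).
Qed.

Lemma Ck_prod (I : Type) (s : seq I) (P : pred I) (F : I -> 'rV[R]_n -> R) k :
  (forall i, P i -> Ck k (F i)) -> Ck k (fun x => \prod_(i <- s | P i) F i x).
Proof.
move=> CF; elim: s => [|i s IH].
  rewrite (_ : (fun x => _) = fun=> 1); first exact: Ck_cst.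
  by apply/funext => x; rewrite big_nil.
rewrite (_ : (fun x => _) = fun x => (if P i then F i x else 1) * \prod_(i <- s | P i) F i x).
  by apply: CkM => //; case: (boolP (P i)) => [/CF//|_]; exact: Ck_cst.
by apply/funext => x; rewrite big_cons; case: ifP => _ //; rewrite mul1r.
Qed.

Lemma Ck_scale k F (w : 'rV[R]_n) : Ck k F -> Ck k (fun x => F x *: w).
Proof.
elim: k F => [|k IH] F CF; split => //.
- by move=> x; apply: differentiableZl; apply: Ck_differentiable; eassumption.
- by move=> x; apply: differentiableZl; apply: Ck_differentiable; eassumption.
move=> v; rewrite (_ : (fun x => _) = fun x => 'D_v F x *: w).
  by apply: IH; case: CF => _ /(_ v).
apply/funext => x; have dF : differentiable F x by apply: Ck_differentiable CF.
rewrite !deriveE//; last exact: differentiableZl.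
by rewrite diffZl.
Qed.

(** [iter_dir] applies the head of the list last, whereas [Ck] unfolds the innermost derivative
    first; hence the induction from the end of the list. *)
Lemma Ck_iter_dir (F : 'rV[R]_n -> 'rV[R]_n) vs k :
  Ck (size vs + k) F -> Ck k (iter_dir vs F).
Proof.
elim/last_ind: vs F => [//|vs v IH] F.
have -> : iter_dir (rcons vs v) F = iter_dir vs ('D_v F).
  by elim: vs {IH} => //= w vs ->.
by rewrite size_rcons addSn => -[_ /(_ v) /IH].
Qed.

Lemma Ck_smooth (F : 'rV[R]_n -> 'rV[R]_n) : (forall k, Ck k F) -> smooth F.
Proof.
by move=> CF vs x; apply: (@Ck_differentiable _ 0); apply: Ck_iter_dir.
Qed.

(** The tower of successive derivatives is given as data, because for [flat] it is obtained
    explicitly by iterating [flat_step]. *)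
Definition smooth1 (g : R -> R) := exists gs : nat -> R -> R,
  gs 0%N = g /\ forall k (t : R), is_derive t (1 : R) (gs k) (gs k.+1 t).

Lemma derive_comp1 (g : R -> R) F x v (dg : R) :
  is_derive (F x) 1 g dg -> differentiable F x ->
  differentiable (fun x => g (F x)) x /\
  'D_v (fun x => g (F x)) x = dg * 'D_v F x.
Proof.
move=> [g1 g2] dF.
have dgF : differentiable g (F x) by exact/derivable1_diffP.
have dc : differentiable (g \o F) x by exact: differentiable_comp.
split=> //; rewrite !deriveE//.
rewrite (_ : (fun x => g (F x)) = g \o F)// diff_comp//= -deriveE//.
rewrite -[X in 'D_X _ _]mulr1 -[_ * 1]/(_ *: 1).
by rewrite deriveE// linearZ/= -[X in _ *: X]deriveE// g2 -[_ *: _]/(_ * _) mulrC.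
Qed.

Lemma Ck_comp k (g : R -> R) F : smooth1 g -> Ck k F -> Ck k (fun x => g (F x)).
Proof.
(* Differentiating replaces [gs m] by [gs m.+1], so the induction must range over the whole
   tower. *)
move=> [gs [<- dgs]] CF; suff h m : Ck k (fun x => gs m (F x)) by exact: h.
elim: k F m CF => [|k IH] F m CF; split=> //.
- move=> x; have [//] := derive_comp1 0 (dgs m (F x)) (Ck_differentiable x CF).
- move=> x; have [//] := derive_comp1 0 (dgs m (F x)) (Ck_differentiable x CF).
move=> v; rewrite (_ : (fun x => _) = fun x => gs m.+1 (F x) * 'D_v F x).
  by apply: CkM; [apply: IH; exact: CkW|case: CF => _ /(_ v)].
by apply/funext => x; have [_] := derive_comp1 v (dgs m (F x)) (Ck_differentiable x CF).
Qed.

End Smooth.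

(** * Flat functions [p(1/t) exp(-1/t)] *)

Section FlatFunction.
Context {R : realType}.
Implicit Types (t s : R) (p : {poly R}).

Definition flat p t : R := if 0 < t then p.[t^-1] * expR (- t^-1) else 0.

(** For [t > 0], the derivative of [p(1/t) exp(-1/t)] is [t^-2 (p - p')(1/t) exp(-1/t)], so the
    family [flat] is closed under differentiation. *)
Definition flat_step p : {poly R} := 'X^2 * (p - p^`()).

(** Each monomial satisfies [s^i <= i! exp(s)] by the exponential series. *)
Lemma poly_expR_bounded p : exists2 C, 0 <= C &
  forall s, 0 <= s -> `|p.[s] * expR (- s)| <= C.
Proof.
exists (\sum_(i < size p) `|p`_i| * i`!%:R).
  by apply: sumr_ge0 => i _; exact: mulr_ge0.
move=> s s0; rewrite horner_coef mulr_suml (le_trans (ler_norm_sum _ _ _))//.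
apply: ler_sum => i _; rewrite -mulrA normrM ler_wpM2l//.
rewrite ger0_norm ?mulr_ge0 ?exprn_ge0 ?expR_ge0//.
rewrite expRN ler_pdivrMr ?expR_gt0//.
case: (nat_of_ord i) => [|j].
  by rewrite expr0 fact0 mul1r -[leLHS]expR0 ler_expR.
have := expR_ge1Dxn j s0; rewrite -lerBrDl => /(le_trans _)-/(_ _ (lexx _)) h.
rewrite -ler_pdivrMl ?ltr0n ?fact_gt0// mulrC (le_trans h)//.
by rewrite gerBl.
Qed.

Lemma is_derive_flat p t : is_derive t 1 (flat p) (flat (flat_step p) t).
Proof.
have [t0|t0|->] := ltgtP t 0.
- rewrite /flat (lt_gtF t0).
  apply: (@near_eq_is_derive R R R (cst 0)).
   near=> x; rewrite /= ifF//; apply: lt_gtF.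
  near: x; exact: lt_nbhsl.
- rewrite {2}/flat t0.
  have dv : is_derive t 1 (fun x : R => x^-1) (- t ^- 2).
    have tN0 : t != 0 by rewrite gt_eqF.
    split; first exact: (@derivableV _ _ id).
    by rewrite (@deriveV _ _ id)// derive_id -[_ *: _]/(_ * _) mulr1.
  have dp : is_derive t 1 (fun x : R => p.[x^-1]) (p^`().[t^-1] * (- t ^- 2)).
    exact: (@is_derive1_comp _ (horner p) (fun x => x^-1)).
  have de : is_derive t 1 (fun x : R => expR (- x^-1)) (expR (- t^-1) * (t ^- 2)).
    apply: (@is_derive1_comp _ expR (fun x => - x^-1)).
    by apply: is_derive_eq; rewrite opprK.
  have dm := is_deriveM dp de.
  apply: (@near_eq_is_derive _ _ _ ((fun x : R => p.[x^-1]) * (fun x : R => expR (- x^-1)))).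
    near=> x; rewrite /= /flat ifT//.
    near: x; exact: lt_nbhsr.
  apply: (is_derive_eq dm).
  rewrite /flat_step !hornerE -![_ *: _]/(_ * _).
  by field; rewrite gt_eqF.
- rewrite /flat ltxx.
  (* At 0, for [h > 0], the difference quotient is [h] times [('X^2 * p)(1/h) exp(-1/h)]; the second
     factor is bounded, so the quotient tends to 0. For [h < 0] it vanishes. *)
  have [C C0 hC] := poly_expR_bounded ('X^2 * p).
  have key : (fun h : R => h^-1 *: ((flat p \o shift 0) (h *: (1 : R)) - flat p 0)) @ 0^' --> (0:R).
    apply/cvgr0Pnorm_le => e e0.
    have C1 : 0 < C + 1 by lra.
    near=> h; rewrite /= addr0 [_ *: 1]mulr1 {2}/flat ltxx subr0 /flat.
    case: ifPn => h0; last by rewrite scaler0 normr0 ltW.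
    have hb : `|(h^-1 ^+ 2 * p.[h^-1]) * expR (- h^-1)| <= C.
      have := hC h^-1; rewrite !hornerE; apply.
      by rewrite invr_ge0 ltW.
    have -> : h^-1 *: (p.[h^-1] * expR (- h^-1)) =
        h * ((h^-1 ^+ 2 * p.[h^-1]) * expR (- h^-1)).
      by rewrite -[_ *: _]/(_ * _); field; rewrite gt_eqF.
    have he : `|h| <= e / (C + 1).
      by apply: ltW; near: h; apply: dnbhs0_lt; rewrite divr_gt0.
    rewrite normrM; apply: (@le_trans _ _ (e / (C + 1) * C)).
      by apply: ler_pM.
    by rewrite mulrAC ler_pdivrMr// ler_pM2l// lerDl.
  split; first by apply/cvg_ex; exists 0; exact: key.
  exact: (cvg_lim _ key).
Unshelve. all: by end_near. Qed.

Lemma smooth1_flat p : smooth1 (flat p).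
Proof.
exists (fun k => flat (iter k flat_step p)); split=> // k t.
by rewrite iterS; exact: is_derive_flat.
Qed.

End FlatFunction.

Section ProductsInUnitInterval.
Context {R : realType}.

Lemma prod_unit (I : Type) (s : seq I) (P : pred I) (u : I -> R) :
  (forall i, 0 <= u i <= 1) -> 0 <= \prod_(i <- s | P i) u i <= 1.
Proof.
move=> h; apply/andP; split; first by apply: prodr_ge0 => i _; case/andP: (h i).
by apply: prodr_ile1 => i _.
Qed.

(** Factors are exchanged one at a time; those not being exchanged lie in [[0, 1]] and cannot
    enlarge the difference. *)
Lemma prod_unit_dist (I : Type) (s : seq I) (P : pred I) (u v : I -> R) :
  (forall i, 0 <= u i <= 1) -> (forall i, 0 <= v i <= 1) ->
  `|\prod_(i <- s | P i) u i - \prod_(i <- s | P i) v i| <=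
    \sum_(i <- s | P i) `|u i - v i|.
Proof.
move=> hu hv; elim: s => [|i s IH]; first by rewrite !big_nil subrr normr0.
rewrite !big_cons; case: ifP => // Pi.
set U := \prod_(_ <- _ | _) u _; set V := \prod_(_ <- _ | _) v _.
have -> : u i * U - v i * V = (u i - v i) * U + v i * (U - V) by ring.
rewrite (le_trans (ler_normD _ _))// lerD//.
  rewrite normrM ler_piMr//; have /andP[U0 U1] := prod_unit s P hu.
  by rewrite ger0_norm.
apply: le_trans IH; rewrite normrM ler_piMl//.
by have /andP[v0 v1] := hv i; rewrite ger0_norm.
Qed.

End ProductsInUnitInterval.

(** * One-dimensional steps and bumps *)

Section Bump.
Context {R : realType}.
Implicit Types (t s : R).

Definition flat1 : R -> R := flat 1.

Lemma flat1E t : flat1 t = if 0 < t then expR (- t^-1) else 0.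
Proof. by rewrite /flat1 /flat hornerC mul1r. Qed.

Lemma flat1_le0 t : t <= 0 -> flat1 t = 0.
Proof. by rewrite flat1E => t0; rewrite ltNge t0. Qed.

Lemma flat1_ge0 t : 0 <= flat1 t.
Proof. by rewrite flat1E; case: ifP => // _; exact: expR_ge0. Qed.

Lemma flat1_ndecr t s : t <= s -> flat1 t <= flat1 s.
Proof.
move=> ts; have [t0|t0] := leP t 0; first by rewrite flat1_le0// flat1_ge0.
have s0 := lt_le_trans t0 ts.
by rewrite !flat1E t0 s0 ler_expR lerN2 lef_pV2 ?posrE.
Qed.

Lemma flat1_1_gt0 : 0 < flat1 1.
Proof. by rewrite flat1E ltr01 expR_gt0. Qed.

Lemma lipschitz_of_is_derive (g dg : R -> R) (C : R) :
  (forall t, is_derive t (1 : R) g (dg t)) -> (forall t, `|dg t| <= C) ->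
  forall t s, `|g t - g s| <= C * `|t - s|.
Proof.
move=> h hC t s; wlog ts : t s / s < t => [H|].
  have [|ts|->] := ltgtP s t; [exact: H| |by rewrite !subrr normr0 mulr0].
  by rewrite distrC (distrC t); exact: H.
have cg : {within `[s, t], continuous g}.
  by apply: derivable_within_continuous => x _; by have [] := h x.
have [c _ ->] := MVT ts (fun x _ => h x) cg.
by rewrite normrM ler_wpM2r.
Qed.

Lemma flat1_lipschitz : exists2 C : R, 0 <= C &
  forall t s, `|flat1 t - flat1 s| <= C * `|t - s|.
Proof.
have [C C0 hC] := poly_expR_bounded (flat_step (1 : {poly R})).
exists C => //; apply: lipschitz_of_is_derive (is_derive_flat 1) _ => t.
rewrite /flat; case: ifPn => t0; last by rewrite normr0.
by apply: hC; rewrite invr_ge0 ltW.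
Qed.

(** Composing [flat1] with itself replaces the usual quotient of flat functions: only division by
    the constant [flat1 1] occurs, so smoothness and the Lipschitz bound follow from composition
    alone. *)
Definition step_down t : R := flat1 (1 - flat1 t / flat1 1) / flat1 1.

Lemma step_down_le0 t : t <= 0 -> step_down t = 1.
Proof.
by move=> t0; rewrite /step_down (flat1_le0 t0) mul0r subr0 divff// gt_eqF// flat1_1_gt0.
Qed.

Lemma step_down_ge1 t : 1 <= t -> step_down t = 0.
Proof.
move=> t1; rewrite /step_down [X in X / _]flat1_le0 ?mul0r// subr_le0.
by rewrite ler_pdivlMr ?flat1_1_gt0// mul1r flat1_ndecr.
Qed.

Lemma step_down_unit t : 0 <= step_down t <= 1.
Proof.
rewrite /step_down divr_ge0 ?flat1_ge0//= ler_pdivrMr ?flat1_1_gt0// mul1r.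
by rewrite flat1_ndecr// gerBl divr_ge0// flat1_ge0.
Qed.

Lemma step_down_lipschitz : exists2 C : R, 0 <= C &
  forall t s, `|step_down t - step_down s| <= C * `|t - s|.
Proof.
have [C C0 hC] := flat1_lipschitz; pose e := (flat1 1)^-1.
have e0 : 0 <= e by rewrite invr_ge0 flat1_ge0.
exists (e * (C * (e * C))); first by rewrite !mulr_ge0.
move=> t s; rewrite /step_down -/e -mulrBl normrM (ger0_norm e0) mulrC -!mulrA.
rewrite ler_wpM2l// (le_trans (hC _ _))// ler_wpM2l//.
have -> : 1 - flat1 t * e - (1 - flat1 s * e) = e * (flat1 s - flat1 t) by ring.
rewrite normrM (ger0_norm e0) ler_wpM2l// distrC; exact: hC.
Qed.

Definition bump t : R := step_down (t - 1) * step_down (- t - 1).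

Lemma bump_unit t : 0 <= bump t <= 1.
Proof.
have /andP[a0 a1] := step_down_unit (t - 1).
have /andP[b0 b1] := step_down_unit (- t - 1).
move: a0 a1 b0 b1; rewrite /bump; move: (step_down _) (step_down _) => a b *.
by rewrite mulr_ge0//= mulr_ile1.
Qed.

Lemma bump1 t : `|t| <= 1 -> bump t = 1.
Proof.
rewrite ler_norml => /andP[? ?].
by rewrite /bump !step_down_le0 ?mulr1//; lra.
Qed.

Lemma bump0 t : 2 <= `|t| -> bump t = 0.
Proof.
rewrite ler_normr; case/orP => h; last first.
  by rewrite /bump (@step_down_ge1 (- t - 1)) ?mulr0//; lra.
by rewrite /bump (@step_down_ge1 (t - 1)) ?mul0r//; lra.
Qed.

Lemma bump_lipschitz : exists2 C : R, 0 <= C &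
  forall t s, `|bump t - bump s| <= C * `|t - s|.
Proof.
have [C C0 hC] := step_down_lipschitz; exists (C + C); first by rewrite addr_ge0.
move=> t s; rewrite /bump.
set a := step_down (t - 1); set b := step_down (- t - 1).
set c := step_down (s - 1); set d := step_down (- s - 1).
have -> : a * b - c * d = (a - c) * b + c * (b - d) by ring.
rewrite [leRHS]mulrDl; apply: le_trans (ler_normD _ _) _; apply: lerD.
  rewrite normrM; apply: (@le_trans _ _ (`|a - c|)).
    have /andP[? ?] := step_down_unit (- t - 1).
    by rewrite ler_piMr// ger0_norm.
  apply: le_trans (hC _ _) _; have -> : t - 1 - (s - 1) = t - s by ring.
  by [].
rewrite normrM; apply: (@le_trans _ _ (`|b - d|)).
  have /andP[? ?] := step_down_unit (s - 1).
  by rewrite ler_piMl// ger0_norm.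
apply: le_trans (hC _ _) _; have -> : - t - 1 - (- s - 1) = s - t by ring.
by rewrite distrC.
Qed.

End Bump.

(** * Cutoffs of cubes, cylinders and finite families *)

Section Cutoff.
Context {R : realType} {n : nat}.
Implicit Types (A : pred 'I_n) (c x y : 'rV[R]_n) (r : R).

(** The predicate selects the coordinates that are localized: [predT] gives a cube, [predC1 i] an
    infinite cylinder parallel to the [i]-th axis. *)
Definition cutoff A c r x : R := \prod_(i < n | A i) bump ((x 0 i - c 0 i) / r).

Lemma cutoff_unit A c r x : 0 <= cutoff A c r x <= 1.
Proof. by apply: prod_unit => i; exact: bump_unit. Qed.

Lemma Ck_bump k c r i : Ck k (fun x : 'rV[R]_n => bump ((x 0 i - c 0 i) / r)).
Proof.
have stepC F : Ck k F -> Ck k (fun x => step_down (F x)).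
  move=> CF; apply: CkM; last exact: Ck_cst.
  apply: Ck_comp; first exact: smooth1_flat.
  apply: CkB; first exact: Ck_cst.
  apply: CkM; last exact: Ck_cst.
  by apply: Ck_comp => //; exact: smooth1_flat.
have CF : Ck k (fun x : 'rV[R]_n => (x 0 i - c 0 i) / r).
  by apply: CkM; [apply: CkB; [exact: Ck_coord|exact: Ck_cst]|exact: Ck_cst].
apply: CkM; apply: stepC; apply: CkB; [exact: CF|exact: Ck_cst| |exact: Ck_cst].
rewrite (_ : (fun x => - _) = fun x => (-1) * ((x 0 i - c 0 i) / r)).
  by apply: CkM => //; exact: Ck_cst.
by apply/funext => x; rewrite mulN1r.
Qed.

Lemma Ck_cutoff k A c r : Ck k (cutoff A c r).
Proof. by apply: Ck_prod => i _; exact: Ck_bump. Qed.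

Lemma cutoff1 A c r x : 0 < r -> (forall i, A i -> `|x 0 i - c 0 i| <= r) ->
  cutoff A c r x = 1.
Proof.
move=> r0 h; apply: big1 => i Ai; apply: bump1.
by rewrite normrM normfV (gtr0_norm r0) ler_pdivrMr// mul1r h.
Qed.

Lemma cutoff0 A c r x i : 0 < r -> A i -> 2 * r <= `|x 0 i - c 0 i| ->
  cutoff A c r x = 0.
Proof.
move=> r0 Ai h; rewrite /cutoff (bigD1 i)//= bump0 ?mul0r//.
by rewrite normrM normfV (gtr0_norm r0) ler_pdivlMr.
Qed.

Lemma cutoff_scale A c r x : cutoff A c r x = cutoff A 0 1 (r^-1 *: (x - c)).
Proof. by apply: eq_bigr => i _; rewrite !mxE subr0 divr1 mulrC. Qed.

(** The essential point is that [L] does not depend on the cube: the radius enters only through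
    [1/r]. *)
Lemma cutoff_lipschitz A : exists2 L, 0 <= L &
  forall c r x y, 0 < r -> `|cutoff A c r x - cutoff A c r y| <= L / r * `|x - y|.
Proof.
have [C C0 hC] := @bump_lipschitz R; exists (C *+ n); first exact: mulrn_wge0.
move=> c r x y r0; rewrite (le_trans (prod_unit_dist _ _ _ _))//; try by move=> i; exact: bump_unit.
rewrite -mulrA mulrnAl -[X in _ *+ X](card_ord n) -sumr_const big_mkcond/=.
apply: ler_sum => i _; case: ifP => _; last by rewrite !mulr_ge0// invr_ge0 ltW.
rewrite (le_trans (hC _ _))// ler_wpM2l// -mulrBl normrM normfV (gtr0_norm r0) mulrC.
rewrite ler_pM2l ?invr_gt0// //.
have -> : x 0 i - c 0 i - (y 0 i - c 0 i) = x 0 i - y 0 i by ring.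
by have := coord_le_norm (x - y) i; rewrite !mxE.
Qed.

(* The smooth surrogate of the maximum of the cutoffs of a finite family of cubes. *)
Definition union_cutoff A (L : seq ('rV[R]_n * R)) x : R :=
  1 - \prod_(q <- L) (1 - cutoff A q.1 q.2 x).

Lemma onem_cutoff_unit A q x : 0 <= 1 - cutoff A q.1 q.2 x <= 1.
Proof.
by have /andP[? ?] := cutoff_unit A q.1 q.2 x; apply/andP; split; lra.
Qed.

Lemma union_cutoff_unit A L x : 0 <= union_cutoff A L x <= 1.
Proof.
have /andP[? ?] := @prod_unit R _ L predT _ (onem_cutoff_unit A ^~ x).
by rewrite /union_cutoff; apply/andP; split; lra.
Qed.

(** This reduces the fractional divergence of the whole family to that of single cubes, without any
    control of their overlaps. *)
Lemma union_cutoff_dist A L x y : `|union_cutoff A L x - union_cutoff A L y| <=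
  \sum_(q <- L) `|cutoff A q.1 q.2 x - cutoff A q.1 q.2 y|.
Proof.
have E (a b : R) : 1 - a - (1 - b) = b - a by ring.
rewrite /union_cutoff E.
apply: le_trans (prod_unit_dist _ _ _ _) _; try by move=> q; exact: onem_cutoff_unit.
by apply: ler_sum => q _; rewrite E.
Qed.

Lemma Ck_union_cutoff k A L : Ck k (union_cutoff A L).
Proof.
apply: CkB; first exact: Ck_cst.
apply: Ck_prod => q _; apply: CkB; first exact: Ck_cst.
exact: Ck_cutoff.
Qed.

Lemma union_cutoff1 A L q x : q \in L -> cutoff A q.1 q.2 x = 1 ->
  union_cutoff A L x = 1.
Proof.
rewrite /union_cutoff => + h; elim: L => [//|p L IH]; rewrite inE => /predU1P[<-|/IH e].
  by rewrite big_cons h subrr mul0r subr0.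
rewrite big_cons; have -> : \prod_(q0 <- L) (1 - cutoff A q0.1 q0.2 x) = 0 by lra.
by rewrite mulr0 subr0.
Qed.

Lemma union_cutoff0 A L x : (forall q, q \in L -> cutoff A q.1 q.2 x = 0) ->
  union_cutoff A L x = 0.
Proof.
rewrite /union_cutoff => h; suff -> : \prod_(q <- L) (1 - cutoff A q.1 q.2 x) = 1 by rewrite subrr.
elim: L h => [|p L IH] h; first by rewrite big_nil.
rewrite big_cons IH; last by move=> q qL; apply: h; rewrite inE qL orbT.
by rewrite h ?subr0 ?mulr1// mem_head.
Qed.

End Cutoff.

Lemma ge0_integral_scaleD_indic d (T : measurableType d) (R : realType)
    (m : {measure set T -> \bar R}) (a : R) (w : T -> R) (C : set T) :
  0 <= a -> measurable_fun setT w -> (forall x, 0 <= w x) -> measurable C ->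
  (\int[m]_x (a * (w x + \1_C x))%:E = a%:E * (\int[m]_x (w x)%:E + m C))%E.
Proof.
move=> a0 mw w0 mC; under eq_integral do rewrite EFinM EFinD.
have mI : measurable_fun setT (fun x : T => (\1_C x : R)%:E).
  by apply/measurable_EFinP; exact/measurable_indic.
have mW : measurable_fun setT (fun x : T => (w x)%:E) by exact/measurable_EFinP.
rewrite ge0_integralZl_EFin//; last 2 first.
- by move=> x _; rewrite adde_ge0// lee_fin.
- exact: emeasurable_funD.
rewrite ge0_integralD//; first by rewrite integral_indic// setIT.
by move=> x _; rewrite lee_fin.
Qed.

(** * Pointwise bounds for the fractional divergence of cutoffs *)

Section FractionalEstimate.
Context {R : realType} {n : nat}.
Local Notation mu := (@lebn R n).
Implicit Types (x y z c : 'rV[R]_n) (F : 'rV[R]_n -> R).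

Lemma dotRn_delta x (a : R) i : dotRn x (a *: delta_mx 0 i) = x 0 i * a.
Proof.
rewrite /dotRn (bigD1 i)//= !mxE !eqxx mulr1 big1 ?addr0// => j ji.
by rewrite !mxE eqxx (negbTE ji) !mulr0.
Qed.

Lemma le_powRN (a b g : R) : 0 < a -> a <= b -> 0 <= g -> b `^ (- g) <= a `^ (- g).
Proof.
move=> a0 ab g0; have b0 := lt_le_trans a0 ab.
rewrite !powRN lef_pV2 ?posrE ?powR_gt0//.
by apply: ge0_ler_powR => //; rewrite nnegrE ltW.
Qed.

(** The coordinate of [y - x] left by the dot product absorbs one power of [enorm (y - x)]. At
    [y = x] both sides are 0. *)
Lemma frac_integrand_le F i (g : R) x y : 0 <= g ->
  `|dotRn (y - x) (F y *: delta_mx 0 i - F x *: delta_mx 0 i) /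
      enorm (y - x) `^ (g + 1)| <= `|F y - F x| * `|y - x| `^ (- g).
Proof.
move=> g0; have [->|xy] := eqVneq y x; first by rewrite !subrr normr0 mul0r (_ : dotRn _ _ = 0) ?mul0r ?normr0// /dotRn big1// => j _; rewrite !mxE mul0r.
have z0 : 0 < `|y - x| by rewrite normr_gt0 subr_eq0.
have e0 : 0 < enorm (y - x) := lt_le_trans z0 (norm_le_enorm _).
rewrite -scalerBl dotRn_delta normrM normfV (ger0_norm (powR_ge0 _ _)) normrM.
rewrite mulrAC mulrC ler_wpM2l//.
apply: le_trans (le_powRN z0 (norm_le_enorm _) g0).
rewrite powRN ler_pdivrMr ?powR_gt0// powRD; last by rewrite (gt_eqF e0) implybT.
rewrite mulKf ?gt_eqF ?powR_gt0// (powRr1 (ltW e0)).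
exact: coord_le_enorm.
Qed.

Lemma cutoff_all0 c r x : 0 < r -> 2 * r < `|x - c| -> cutoff predT c r x = 0.
Proof.
move=> r0 h; have [i hi] : exists i, 2 * r <= `|x 0 i - c 0 i|.
  have [//|H] := pselect (exists i, 2 * r <= `|x 0 i - c 0 i|).
  move: h; rewrite ltNge => /negP[].
  apply: norm_le_coord => [|i]; first by rewrite mulr_ge0// ltW.
  rewrite !mxE leNgt; by apply/negP => /ltW hi; apply: H; exists i.
exact: (cutoff0 r0 _ hi).
Qed.

(** Near the diagonal the Lipschitz bound gains one power, leaving the exponent [n + alpha - 1],
    which is below [n]; the indicator takes over when [x] is far from the cutoff. The factor in [x]
    records the decay [|x|^-(n+alpha)]. *)
Lemma cutoff_kernel_bound (alpha : R) : (0 < n)%N -> 0 < alpha < 1 ->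
  exists2 C : R, 0 <= C & forall x y,
  `|cutoff predT 0 1 y - cutoff predT 0 1 x| * `|y - x| `^ (- (n%:R + alpha)) <=
  C * weight 0 (n%:R + alpha) x *
    (weight (n%:R + alpha - 1) (n%:R + alpha) (y - x) + \1_(cube (0 : 'rV[R]_n) 2) y).
Proof.
move=> n0 /andP[al0 al1]; set g := n%:R + alpha.
have n1 : 1 <= n%:R :> R by rewrite ler1n.
have g0 : 0 <= g by rewrite /g; lra.
have [L L0 hL] := @cutoff_lipschitz R n predT.
have c4 : 1 <= 4 `^ g by rewrite -[X in X <= _](powRr0 4) ler_powR//; lra.
exists ((1 + L) * 4 `^ g); first by rewrite mulr_ge0 ?powR_ge0// addr_ge0.
move=> x y; set D := `|_ - _|.
have /andP[ux0 ux1] := cutoff_unit predT 0 1 x.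
have /andP[uy0 uy1] := cutoff_unit predT 0 1 y.
have D0 : 0 <= D by exact: normr_ge0.
have D1 : D <= 1.
  by rewrite /D ler_norml; move: ux0 ux1 uy0 uy1; move: (cutoff _ _ _ _) (cutoff _ _ _ _) => u v *; apply/andP; split; lra.
have DL : D <= L * `|y - x| by have := hL 0 1 y x ltr01; rewrite divr1.
have I0 : 0 <= \1_(cube (0 : 'rV[R]_n) 2) y :> R by [].
have W0 := weight_ge0 (g - 1) g (y - x).
have H0 := weight_ge0 0 g x.
(* For [|x| <= 4] the weight in [x] is at least [4^-g], which explains the factor [4^g]; [1 + L]
   covers both the Lipschitz bound and [D <= 1]. *)
have [x4|x4] := leP `|x| 4.
  have Hx : 1 <= 4 `^ g * weight 0 g x.
    rewrite /weight; case: ifPn => x1; first by rewrite oppr0 powRr0 mulr1.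
    have xp : 0 < `|x| by rewrite (lt_trans ltr01)// ltNge.
    rewrite powRN ler_pdivlMr ?powR_gt0// mul1r.
    by apply: ge0_ler_powR => //; rewrite nnegrE.
  have DW : D * `|y - x| `^ (- g) <= (1 + L) * weight (g - 1) g (y - x).
    have [yx|yx] := eqVneq y x.
      have -> : D = 0 by rewrite /D yx subrr normr0.
      by rewrite mul0r mulr_ge0// addr_ge0.
    have z0 : 0 < `|y - x| by rewrite normr_gt0 subr_eq0.
    rewrite /weight; case: ifPn => z1.
      have -> : - (g - 1) = 1 - g by ring.
      rewrite powRD; last by rewrite (gt_eqF z0) implybT.
      rewrite (powRr1 (ltW z0)) mulrA ler_wpM2r ?powR_ge0//.
      by rewrite (le_trans DL)// ler_wpM2r// lerDr.
    by rewrite ler_wpM2r ?powR_ge0// (le_trans D1)// lerDl.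
  apply: le_trans DW _; rewrite -!mulrA ler_wpM2l ?addr_ge0// mulrA.
  apply: (@le_trans _ _ (4 `^ g * weight 0 g x * weight (g - 1) g (y - x))).
    by rewrite ler_peMl.
  by rewrite ler_wpM2l ?lerDl// mulr_ge0// powR_ge0.
(* For [|x| > 4] only [y] in the cube of radius 2 matters, and there [|y - x| >= |x|/2]. *)
have fx : cutoff predT 0 1 x = 0 by apply: cutoff_all0 => //; rewrite subr0 mulr1 (lt_trans _ x4)// ltr_nat.
have [y2|y2] := leP `|y| 2; last first.
  have -> : D = 0 by rewrite /D fx cutoff_all0 ?subr0 ?normr0// mulr1.
  by rewrite mul0r !mulr_ge0 ?addr_ge0 ?powR_ge0.
rewrite indicE mem_set ?(_ : cube _ _ y) /cube/= ?subr0//.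
have xz : `|x| / 2 <= `|y - x|.
  have := ler_normB y (y - x); rewrite opprB addrC subrK => h.
  by clear -h y2 x4; lra.
have x20 : 0 < `|x| / 2 by clear -x4; lra.
have hx : weight 0 g x = `|x| `^ (- g).
  by rewrite /weight ifF//; apply/negbTE; rewrite -ltNge (lt_trans _ x4)// ltr1n.
apply: (@le_trans _ _ (2 `^ g * weight 0 g x)).
  apply: (@le_trans _ _ (1 * `|y - x| `^ (- g))); first by rewrite ler_wpM2r ?powR_ge0.
  rewrite mul1r (le_trans (le_powRN x20 xz g0))// hx powRM ?invr_ge0//.
  by rewrite mulrC -[X in X `^ (- g) * _]powR_inv1// -powRrM mulrNN mul1r.
apply: (@le_trans _ _ ((1 + L) * 4 `^ g * weight 0 g x)).
  rewrite ler_wpM2r// (@le_trans _ _ (4 `^ g))//.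
    by apply: ge0_ler_powR; rewrite ?nnegrE// ler_nat.
  by rewrite ler_peMl ?powR_ge0// lerDl.
by rewrite ler_peMr ?lerDr// !mulr_ge0 ?powR_ge0 ?addr_ge0.
Qed.

Lemma measurable_scale (w : 'rV[R]_n -> R) c r : r != 0 ->
  measurable_fun setT (w : LebRn R n -> R) ->
  measurable_fun setT ((fun x => w (r^-1 *: (x - c))) : LebRn R n -> R).
Proof.
move=> r0 mw.
have -> : (fun x => w (r^-1 *: (x - c))) = w \o affine r^-1 (- (r^-1 *: c)).
  by apply/funext => x /=; rewrite /affine scalerBr addrC.
exact: (measurableT_comp mw (measurable_affine _ (invr_neq0 r0))).
Qed.

Lemma measurable_shift (w : 'rV[R]_n -> R) c :
  measurable_fun setT (w : LebRn R n -> R) ->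
  measurable_fun setT ((fun x => w (x - c)) : LebRn R n -> R).
Proof.
move=> /(measurable_scale c (oner_neq0 R)).
by under eq_fun do rewrite invr1 scale1r.
Qed.

Lemma integral_scale (g : 'rV[R]_n -> R) c r : 0 < r ->
  measurable_fun setT (g : LebRn R n -> R) -> (forall x, 0 <= g x) ->
  (\int[mu]_x (g (r^-1 *: (x - c)))%:E = (r ^+ n)%:E * \int[mu]_x (g x)%:E)%E.
Proof.
move=> r0 mg g0; have r'0 : 0 < r^-1 by rewrite invr_gt0.
have -> : (r ^+ n)%:E = (`|r^-1| ^- n)%:E :> \bar R.
  by rewrite (gtr0_norm r'0) exprVn invrK.
have E x : r^-1 *: (x - c) = affine r^-1 (- (r^-1 *: c)) x.
  by rewrite /affine scalerBr addrC.
under eq_integral do rewrite E.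
have := @ge0_integral_affine R n r^-1 (- (r^-1 *: c)) (fun x => (g x)%:E).
by apply; [rewrite gt_eqF|apply/measurable_EFinP|].
Qed.

Lemma integral_shift (g : 'rV[R]_n -> R) c :
  measurable_fun setT (g : LebRn R n -> R) ->
  (\int[mu]_x (g (x - c))%:E = \int[mu]_x (g x)%:E)%E.
Proof.
move=> mg; have E x : x - c = affine 1 (- c) x by rewrite /affine scale1r addrC.
under eq_integral do rewrite E.
have := @integral_affine R n 1 (- c) (fun x => (g x)%:E).
by apply; [rewrite normr1|apply/measurable_EFinP].
Qed.

(** Rescaling the unit estimate: the volume gives [r^n] and the kernel [r^-(n+alpha)], hence
    [r^-alpha]. A majorant is returned instead of a bound on the integral so that majorants of
    several cubes can be added. *)
Lemma cutoff_majorant (alpha : R) : (0 < n)%N -> 0 < alpha < 1 ->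
  exists2 C : R, 0 <= C & forall c r x, 0 < r ->
  exists g : LebRn R n -> \bar R, [/\ measurable_fun setT g,
   forall y, (0 <= g y)%E,
   forall y, ((`|cutoff predT c r y - cutoff predT c r x| *
       `|y - x| `^ (- (n%:R + alpha)))%:E <= g y)%E &
   (\int[mu]_y g y <= (C * r `^ (- alpha) *
      weight 0 (n%:R + alpha) (r^-1 *: (x - c)))%:E)%E].
Proof.
move=> n0 al; have [C0 C0_ge0 hC0] := cutoff_kernel_bound n0 al.
have /andP[al0 al1] := al; set g := n%:R + alpha.
have n1 : 1 <= n%:R :> R by rewrite ler1n.
pose w := weight (g - 1) g : 'rV[R]_n -> R.
have iw : (\int[mu]_z (w z)%:E < +oo)%E.
  apply: integral_weight_lty; first by rewrite /g; apply/andP; split; lra.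
  by rewrite /g; lra.
have iw0 : (0 <= \int[mu]_z (w z)%:E)%E.
  by apply: integral_ge0 => z _; rewrite lee_fin weight_ge0.
pose I := fine (\int[mu]_z (w z)%:E)%E.
have iwE : (\int[mu]_z (w z)%:E = I%:E)%E by rewrite fineK// ge0_fin_numE.
have I0 : 0 <= I by rewrite -lee_fin -iwE.
(* [I] is the mass of the translated weight and [4^n] bounds the volume of the cube of radius 2. *)
exists (C0 * (I + 4 ^+ n)); first by rewrite mulr_ge0// addr_ge0// exprn_ge0.
move=> c r x r0; pose x' := r^-1 *: (x - c).
pose k (y : 'rV[R]_n) : R := C0 * r `^ (- g) * weight 0 g x' *
  (w (y - x') + \1_(cube (0 : 'rV[R]_n) 2) y).
have k0 y : 0 <= k y.
  by rewrite /k !mulr_ge0 ?powR_ge0 ?weight_ge0// addr_ge0// weight_ge0.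
have mw : measurable_fun setT ((fun y => w (y - x')) : LebRn R n -> R).
  exact/measurable_shift/measurable_weight.
have mk1 : measurable_fun setT ((fun y => w (y - x') + \1_(cube (0 : 'rV[R]_n) 2) y) : LebRn R n -> R).
  by apply: (measurable_funD mw); exact/measurable_indic/measurable_cube.
have mk : measurable_fun setT (k : LebRn R n -> R) by exact: measurable_funM.
exists (fun y => (k (r^-1 *: (y - c)))%:E); split.
- by apply/measurable_EFinP; apply: measurable_scale => //; rewrite gt_eqF.
- by move=> y; rewrite lee_fin.
- move=> y; rewrite lee_fin (cutoff_scale _ c) (cutoff_scale _ _ _ x) -/x'.
  set y' := r^-1 *: (y - c).
  have -> : y - x = r *: (y' - x').
    by rewrite -scalerBr scalerA divff ?gt_eqF// scale1r opprB addrA subrK.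
  rewrite normrZ (gtr0_norm r0) (powRM _ (ltW r0) (normr_ge0 _)) mulrCA /k.
  rewrite (mulrC C0) -!mulrA ler_pM2l ?powR_gt0// !mulrA.
  exact: hC0.
rewrite integral_scale//.
rewrite /k ge0_integral_scaleD_indic; first last.
- exact: measurable_cube.
- by move=> y; exact: weight_ge0.
- exact: mw.
- by rewrite !mulr_ge0 ?powR_ge0 ?weight_ge0.
rewrite (integral_shift _ (measurable_weight _ _)) iwE.
apply: (@le_trans _ _ ((r ^+ n)%:E * ((C0 * r `^ (- g) * weight 0 g x')%:E * (I%:E + (4 ^+ n)%:E)))%E).
  rewrite lee_pmul2l ?lte_fin ?exprn_gt0//.
  apply: lee_wpmul2l; first by rewrite lee_fin !mulr_ge0 ?powR_ge0 ?weight_ge0.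
  rewrite leeD2l//; have := @lebn_cube R n 0 2 (ler0n _ _).
  by rewrite -natrM.
rewrite -EFinD -!EFinM lee_fin.
have -> : r `^ (- alpha) = r ^+ n * r `^ (- g).
  rewrite -(powR_mulrn _ (ltW r0)) -powRD; last by rewrite (gt_eqF r0) implybT.
  by congr powR; rewrite /g; ring.
rewrite -/x' le_eqVlt; apply/orP; left; apply/eqP; move: (r `^ _) (weight _ _ _) (r ^+ n) (4 ^+ n) => u v s t; ring.
Qed.

Lemma frac_div_union_cutoff_le (alpha : R) i : (0 < n)%N -> 0 < alpha < 1 ->
  exists2 C : R, 0 <= C & forall (L : seq ('rV[R]_n * R)) x,
  (forall q, q \in L -> 0 < q.2) ->
  `|frac_div alpha (fun y => union_cutoff predT L y *: delta_mx 0 i) x| <=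
  C * \sum_(q <- L) q.2 `^ (- alpha) * weight 0 (n%:R + alpha) (q.2^-1 *: (x - q.1)).
Proof.
move=> n0 al; have [C C0 hC] := cutoff_majorant n0 al.
exists (`|mu_const n alpha| * C); first by rewrite mulr_ge0.
move=> L x L0; rewrite /frac_div normrM -mulrA ler_wpM2l//.
have /andP[al0 al1] := al.
have n1 : 1 <= n%:R :> R by rewrite ler1n.
have key : exists g : LebRn R n -> \bar R, [/\ measurable_fun setT g,
    forall y, (0 <= g y)%E,
    forall y, ((\sum_(q <- L) `|cutoff predT q.1 q.2 y - cutoff predT q.1 q.2 x| *
       `|y - x| `^ (- (n%:R + alpha)))%:E <= g y)%E &
   (\int[mu]_y g y <= (C * \sum_(q <- L) q.2 `^ (- alpha) *
      weight 0 (n%:R + alpha) (q.2^-1 *: (x - q.1)))%:E)%E].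
  elim: L L0 => [|q L IH] L0.
    exists (fun=> 0%E); split => //.
    - by move=> y; rewrite big_nil.
    - by rewrite big_nil mulr0 integral0.
  have [|g1 [mg1 g10 gb1 ig1]] := IH; first by move=> p pL; apply: L0; rewrite inE pL orbT.
  have [g2 [mg2 g20 gb2 ig2]] := hC q.1 q.2 x (L0 _ (mem_head _ _)).
  exists (fun y => g2 y + g1 y)%E; split.
  - exact: emeasurable_funD.
  - by move=> y; rewrite adde_ge0.
  - by move=> y; rewrite big_cons EFinD leeD.
  - by rewrite ge0_integralD// big_cons mulrDr mulrA EFinD leeD.
have [g [mg g0 gb ig]] := key.
apply: normr_Rintegral_le ig => y; apply: le_trans (gb y); rewrite lee_fin.
have g00 : 0 <= n%:R + alpha by lra.
apply: le_trans (frac_integrand_le _ _ _ _ g00) _.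
by rewrite -mulr_suml ler_wpM2r ?powR_ge0// union_cutoff_dist.
Qed.

End FractionalEstimate.

(** * Majorants for products with an [L^p] function *)

Section LpMajorants.
Context d (T : measurableType d) (R : realType) (m : {measure set T -> \bar R}).
Implicit Types (f h : T -> R) (q : R).

Lemma ge0_integral_comb (a b : R) (u v : T -> R) : 0 <= a -> 0 <= b ->
  measurable_fun setT u -> measurable_fun setT v ->
  (forall x, 0 <= u x) -> (forall x, 0 <= v x) ->
  (\int[m]_x (a * (b * u x + v x))%:E =
   a%:E * (b%:E * \int[m]_x (u x)%:E + \int[m]_x (v x)%:E))%E.
Proof.
move=> a0 b0 mu mv u0 v0.
have mU : measurable_fun setT (fun x : T => (u x)%:E) by exact/measurable_EFinP.
have mV : measurable_fun setT (fun x : T => (v x)%:E) by exact/measurable_EFinP.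
have mbU : measurable_fun setT (fun x : T => (b%:E * (u x)%:E)%E) by exact: measurable_funeM.
under eq_integral do rewrite EFinM EFinD EFinM.
rewrite ge0_integralZl_EFin//; last 2 first.
- by move=> x _; rewrite adde_ge0// ?mule_ge0// lee_fin.
- exact: emeasurable_funD.
rewrite ge0_integralD//; last 2 first.
- by move=> x _; rewrite mule_ge0// lee_fin.
- by move=> x _; rewrite lee_fin.
by rewrite ge0_integralZl_EFin// => x _; rewrite lee_fin.
Qed.

Lemma ge0_integral_scaleD (a : R) (u v : T -> \bar R) : 0 <= a ->
  measurable_fun setT u -> measurable_fun setT v ->
  (forall x, 0 <= u x)%E -> (forall x, 0 <= v x)%E ->
  measurable_fun setT (fun x => a%:E * u x + v x)%E /\
  (\int[m]_x (a%:E * u x + v x) = a%:E * \int[m]_x u x + \int[m]_x v x)%E.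
Proof.
move=> a0 mu mv u0 v0.
have mau : measurable_fun setT (fun x => a%:E * u x)%E by exact: measurable_funeM.
split; first exact: emeasurable_funD.
rewrite ge0_integralD//; last by move=> x _; rewrite mule_ge0// lee_fin.
by rewrite ge0_integralZl_EFin.
Qed.

Lemma Lnorm_integral_powR f q : 1 <= q -> (Lnorm m q%:E (EFin \o f) < +oo)%E ->
  exists2 A : R, 0 <= A & (\int[m]_x (`|f x| `^ q)%:E = A%:E)%E.
Proof.
move=> q1 fq; have q0 : q != 0 by rewrite gt_eqF// (lt_le_trans ltr01).
have := poweR_lty q fq; rewrite poweR_Lnorm// => ilt.
have i0 : (0 <= \int[m]_x (`|f x| `^ q)%:E)%E.
  by apply: integral_ge0 => x _; rewrite lee_fin powR_ge0.
have iE : (\int[m]_x (`|f x| `^ q)%:E = \int[m]_x (`|(EFin \o f) x| `^ q))%E.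
  by apply: eq_integral => x _; rewrite -poweR_EFin.
have fin : (\int[m]_x (`|f x| `^ q)%:E)%E \is a fin_num by rewrite ge0_fin_numE// iE.
exists (fine (\int[m]_x (`|f x| `^ q)%:E)%E); first exact: fine_ge0.
by rewrite fineK.
Qed.

Lemma Lnorm_infty_ae f : (Lnorm m +oo%E (EFin \o f) < +oo)%E ->
  exists2 M : R, 0 <= M & \forall x \ae m, `|f x| <= M.
Proof.
rewrite unlock; case: ifPn => [m0 fM|]; last first.
  (* If the whole space is null, the supremum norm carries no information, but every property holds
     almost everywhere. *)
  rewrite lt0e negb_and negbK measure_ge0 orbF => /eqP m0 _; exists 0 => //.
  by exists setT; split.
have [M hM] := ess_supr_bounded (f := fun x => `|f x|) fM.
exists (Num.max M 0); first by rewrite le_max lexx orbT.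
by apply: filterS hM => x xM; rewrite le_max xM.
Qed.

(** If [a <= 1] the product is at most [h], otherwise at most [a <= a^q]. Because [h <= 1], no
    conjugate exponent appears and [q = 1] is included. *)
Lemma young_weight (a h q : R) : 0 <= a -> 0 <= h <= 1 -> 1 <= q ->
  a * h <= a `^ q + h.
Proof.
move=> a0 /andP[h0 h1] q1; have [a1|/ltW a1] := leP a 1.
  by rewrite (@le_trans _ _ h) ?ler_piMl// lerDr powR_ge0.
rewrite (@le_trans _ _ a) ?ler_piMr// (le_trans (le1r_powR a1 q1))// lerDl//.
Qed.

(** Setting the majorant to [+oo] on the exceptional null set makes the bound hold at every point
    without changing the integral. *)
Lemma ae_bounded_majorant f h (M : R) : measurable_fun setT f ->
  measurable_fun setT h -> (forall x, 0 <= h x) -> 0 <= M ->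
  (\forall x \ae m, `|f x| <= M) ->
  exists G : T -> \bar R, [/\ measurable_fun setT G, forall x, (0 <= G x)%E,
    forall x, ((`|f x| * h x)%:E <= G x)%E &
    (\int[m]_x G x = M%:E * \int[m]_x (h x)%:E)%E].
Proof.
move=> mf mh h0 M0 fM.
pose G x : \bar R := if `|f x| <= M then (M * h x)%:E else +oo%E.
have mMh : measurable_fun setT (fun x => (M * h x)%:E : \bar R).
  by apply/measurable_EFinP; exact: measurable_funM.
have mG : measurable_fun setT G.
  apply: measurable_fun_ifT => //.
  apply: measurable_fun_ler => //; exact: measurableT_comp.
have G0 x : (0 <= G x)%E.
  by rewrite /G; case: ifP => // _; rewrite lee_fin mulr_ge0.
exists G; split => //.
  by move=> x; rewrite /G; case: ifP => [fx|_]; rewrite ?leey// lee_fin ler_wpM2r.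
transitivity (\int[m]_x (M * h x)%:E)%E.
  apply: ge0_ae_eq_integral => //.
    by move=> x _; rewrite lee_fin mulr_ge0.
  by apply: filterS fM => x fx _; rewrite /G fx.
under eq_integral do rewrite EFinM.
rewrite ge0_integralZl_EFin//; last exact/measurable_EFinP.
by move=> x _; rewrite lee_fin.
Qed.

(* A scale-invariant substitute for Hoelder's inequality, proved by Young's
   inequality: [t] is the measure of the region on which the weight [h] lives,
   and [n_over_p 1 p] is [1/p]. *)
Lemma Lp_majorant (p : \bar R) f (I : R) : (1 <= p)%E -> measurable_fun setT f ->
  (Lnorm m p (EFin \o f) < +oo)%E -> 0 <= I ->
  exists2 B : R, 0 <= B & forall t h, 0 < t -> measurable_fun setT h ->
    (forall x, 0 <= h x <= 1) -> (\int[m]_x (h x)%:E <= (t * I)%:E)%E ->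
  exists G : T -> \bar R, [/\ measurable_fun setT G, forall x, (0 <= G x)%E,
    forall x, ((`|f x| * h x)%:E <= G x)%E &
    (\int[m]_x G x <= (B * (t / t `^ (n_over_p 1 p)))%:E)%E].
Proof.
case: p => [q| |//] /=.
  rewrite lee_fin => q1 mf fq I0; have q0 : 0 < q := lt_le_trans ltr01 q1.
  have [A A0 iA] := Lnorm_integral_powR q1 fq.
  exists (A + I); first exact: addr_ge0.
  (* Young's inequality is applied to [s |f|] and [h]; with [s^q = t] both resulting integrals are
     of order [t], and dividing by [s] gives [t / t^(1/q)]. *)
  move=> t h t0 mh h01 ih; pose s := t `^ q^-1.
  have s0 : 0 < s by exact: powR_gt0.
  have sq : s `^ q = t by rewrite /s -powRrM mulVf ?gt_eqF// powRr1// ltW.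
  have h0 x : 0 <= h x by case/andP: (h01 x).
  have mfq : measurable_fun setT (fun x => `|f x| `^ q).
    by apply: (measurableT_comp (measurable_powR q)); exact: measurableT_comp.
  exists (fun x => (s^-1 * (t * (`|f x| `^ q) + h x))%:E); split.
  - apply/measurable_EFinP; apply: measurable_funM => //.
    by apply: measurable_funD => //; exact: measurable_funM.
  - move=> x; rewrite lee_fin mulr_ge0 ?invr_ge0 ?(ltW s0)// addr_ge0//.
    by rewrite mulr_ge0 ?powR_ge0// ltW.
  - move=> x; rewrite lee_fin ler_pdivlMl// mulrA -sq -powRM//; last exact: ltW.
    by apply: young_weight => //; rewrite mulr_ge0// ltW.
  rewrite ge0_integral_comb//; last 2 first.
  - by rewrite invr_ge0 ltW.
  - exact: ltW.
  rewrite iA div1r -/s; apply: (@le_trans _ _ (s^-1%:E * (t%:E * A%:E + (t * I)%:E))%E).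
    by rewrite lee_pmul2l ?lte_fin ?invr_gt0// leeD2l.
  have -> : (t%:E * A%:E + (t * I)%:E = (t * (A + I))%:E)%E.
    by rewrite -EFinM -EFinD mulrDr.
  by rewrite -EFinM lee_fin mulrA [leLHS]mulrC (mulrC s^-1).
move=> _ mf /Lnorm_infty_ae[M M0 fM] I0; exists (M * I); first exact: mulr_ge0.
move=> t h t0 mh h01 ih.
have h0 x : 0 <= h x by case/andP: (h01 x).
have [G [mG G0 fG iG]] := ae_bounded_majorant mf mh h0 M0 fM.
exists G; split => //; rewrite iG powRr0 divr1.
apply: (@le_trans _ _ (M%:E * (t * I)%:E)%E); first by rewrite lee_wpmul2l// lee_fin.
by rewrite -EFinM lee_fin mulrAC mulrA.
Qed.

End LpMajorants.

(** * Pairing an [L^p] function with the fractional divergence *)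

Section FractionalPairing.
Context {R : realType} {n : nat}.
Local Notation mu := (@lebn R n).
Implicit Types (x c : 'rV[R]_n) (f : 'rV[R]_n -> R).

Lemma weight0_unit (b : R) x : 0 <= b -> 0 <= weight 0 b x <= 1.
Proof.
move=> b0; rewrite weight_ge0 /weight; case: ifPn => x1.
  by rewrite oppr0 powRr0 lexx.
have {}x1 : 1 < `|x| by rewrite ltNge.
rewrite powRN invf_le1 ?powR_gt0 ?(lt_trans ltr01)//.
by rewrite -[X in X <= _](powRr0 `|x|) ler_powR// ltW.
Qed.

(** The weight rescaled to a cube of radius [r] has integral [r^n I], so [Lp_majorant] with
    [t = r^n] yields [r^(n - n/p)]; the factor [r^-alpha] completes the exponent. The constant is
    independent of the family. *)
Lemma pairing_union_cutoff_le (alpha : R) (p : \bar R) f i :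
  (0 < n)%N -> 0 < alpha < 1 -> (1 <= p)%E -> in_Lp p f ->
  exists2 C : R, 0 <= C & forall L : seq ('rV[R]_n * R),
  (forall q, q \in L -> 0 < q.2) ->
  `|Rintegral mu setT ((fun x => f x *
     frac_div alpha (fun y => union_cutoff predT L y *: delta_mx 0 i) x) : LebRn R n -> R)|
  <= C * \sum_(q <- L) q.2 `^ (n%:R - alpha - n_over_p n p).
Proof.
move=> n0 al p1 [mf fp]; have [C C0 hC] := frac_div_union_cutoff_le i n0 al.
have /andP[al0 al1] := al.
pose g := n%:R + alpha; pose h := weight 0 g : 'rV[R]_n -> R.
have g0 : 0 <= g by rewrite addr_ge0// ltW.
have mh : measurable_fun setT (h : LebRn R n -> R) by exact: measurable_weight.
have h01 x : 0 <= h x <= 1 by exact: weight0_unit.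
have h0 x : 0 <= h x by case/andP: (h01 x).
have ih : (\int[mu]_x (h x)%:E < +oo)%E.
  by apply: integral_weight_lty; rewrite ?lexx ?ltr0n// /g ltrDl.
have ih0 : (0 <= \int[mu]_x (h x)%:E)%E by apply: integral_ge0 => x _; rewrite lee_fin.
pose I := fine (\int[mu]_x (h x)%:E)%E.
have ihE : (\int[mu]_x (h x)%:E = I%:E)%E by rewrite fineK// ge0_fin_numE.
have I0 : 0 <= I by rewrite -lee_fin -ihE.
have [B B0 hB] := Lp_majorant p1 mf fp I0.
exists (C * B); first exact: mulr_ge0.
move=> L L0.
have key : exists G : LebRn R n -> \bar R, [/\ measurable_fun setT G,
    forall x, (0 <= G x)%E,
    forall x, ((`|f x| * (C * \sum_(q <- L) q.2 `^ (- alpha) * h (q.2^-1 *: (x - q.1))))%:E <= G x)%E &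
   (\int[mu]_x G x <= (C * B * \sum_(q <- L) q.2 `^ (n%:R - alpha - n_over_p n p))%:E)%E].
  elim: L L0 => [|[c r] L IH] L0.
    exists (fun=> 0%E); split => //.
    - by move=> y; rewrite big_nil !mulr0.
    - by rewrite big_nil mulr0 integral0.
  have [|G1 [mG1 G10 Gb1 iG1]] := IH; first by move=> q qL; apply: L0; rewrite inE qL orbT.
  have r0 : 0 < r by exact: (L0 _ (mem_head _ _)).
  have mhr : measurable_fun setT ((fun x => h (r^-1 *: (x - c))) : LebRn R n -> R).
    by apply: measurable_scale => //; rewrite gt_eqF.
  have ihr : (\int[mu]_x (h (r^-1 *: (x - c)))%:E <= (r ^+ n * I)%:E)%E.
    by rewrite integral_scale// ihE -EFinM.
  have [G2 [mG2 G20 Gb2 iG2]] := hB _ _ (exprn_gt0 n r0) mhr (fun x => h01 _) ihr.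
  have Cr0 : 0 <= C * r `^ (- alpha) by rewrite mulr_ge0// powR_ge0.
  have [mG iG] := ge0_integral_scaleD mu Cr0 mG2 mG1 G20 G10.
  exists (fun x => (C * r `^ (- alpha))%:E * G2 x + G1 x)%E; split.
  - exact: mG.
  - by move=> y; rewrite adde_ge0// mule_ge0// lee_fin.
  - move=> y; rewrite big_cons mulrDr mulrDr EFinD leeD//=.
    by rewrite (mulrA C) mulrCA EFinM lee_wpmul2l ?lee_fin.
  rewrite iG big_cons mulrDr EFinD leeD//=.
  apply: (@le_trans _ _ ((C * r `^ (- alpha))%:E * (B * (r ^+ n / (r ^+ n) `^ (n_over_p 1 p)))%:E)%E).
    by rewrite lee_wpmul2l// lee_fin.
  rewrite -EFinM lee_fin mulrACA ler_wpM2l ?mulr_ge0//.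
  rewrite -(powR_mulrn _ (ltW r0)) -powRrM -powRN -!powRD ?(gt_eqF r0) ?implybT//.
  have -> : n%:R * n_over_p 1 p = n_over_p n p.
    by case: (p) => [q| |] /=; rewrite ?mulr0// mulrA mulr1.
  by have -> : - alpha + (n%:R - n_over_p n p) = n%:R - alpha - n_over_p n p by ring.
have [G [mG G0 Gb iG]] := key.
apply: normr_Rintegral_le iG => x; apply: le_trans (Gb x); rewrite lee_fin normrM.
by rewrite ler_wpM2l//; exact: hC.
Qed.

(** For [|x| > 1], [|f|] is compared with [|x|^-c]: below it, the product is at most [|x|^-(b+c)];
    above it, [|x|^-b <= |f|^(q-1)] and the product is at most [|f|^q]. *)
Lemma subcritical_weight_majorant (alpha : R) (p : \bar R) f :
  (0 < n)%N -> 0 < alpha < 1 -> (1 <= p)%E -> (p < (n%:R / (1 - alpha))%:E)%E ->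
  in_Lp p f ->
  exists G : LebRn R n -> \bar R, [/\ measurable_fun setT G, forall x, (0 <= G x)%E,
    forall x, ((`|f x| * weight 0 (n%:R - 1 + alpha) x)%:E <= G x)%E &
    (\int[mu]_x G x < +oo)%E].
Proof.
move=> n0 /andP[al0 al1]; case: p => [q| |//]; rewrite ?lee_fin ?lte_fin// => q1 qn [mf fq].
have n1 : 1 <= n%:R :> R by rewrite ler1n.
have q0 : 0 < q := lt_le_trans ltr01 q1.
pose b := n%:R - 1 + alpha; have b0 : 0 < b by rewrite /b; lra.
have qb : (q - 1) * (1 - alpha) < b.
  by move: qn; rewrite ltr_pdivlMr ?subr_gt0// /b => h; lra.
(* The first condition means [b + c > n], the second is used where [|f|] is large. They are
   compatible exactly when [q (1 - alpha) < n], the subcritical hypothesis. *)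
have [c [c1 cq]] : exists c : R, 1 - alpha < c /\ c * (q - 1) <= b.
  have [q1E|qN1] := eqVneq q 1.
    by exists 1; rewrite q1E subrr mulr0 (ltW b0); split => //; lra.
  have q10 : 0 < q - 1 by rewrite subr_gt0 lt_neqAle eq_sym qN1.
  exists (b / (q - 1)); rewrite ltr_pdivlMr// mulrC qb; split => //.
  by rewrite divfK// gt_eqF.
have [A A0 iA] := Lnorm_integral_powR q1 fq.
have c0 : 0 < c by lra.
pose w := weight 0 (b + c) : 'rV[R]_n -> R.
have mw : measurable_fun setT (w : LebRn R n -> R) by exact: measurable_weight.
have iw : (\int[mu]_x (w x)%:E < +oo)%E.
  by apply: integral_weight_lty; rewrite ?lexx ?ltr0n// /b; lra.
have w0 x : 0 <= w x by exact: weight_ge0.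
have mfq : measurable_fun setT ((fun x => `|f x| `^ q) : LebRn R n -> R).
  by apply: (measurableT_comp (measurable_powR q)); exact: measurableT_comp.
exists (fun x => (1 * (1 * `|f x| `^ q + w x))%:E); split.
- apply/measurable_EFinP; apply: measurable_funM; first exact: measurable_cst.
  by apply: measurable_funD; [apply: measurable_funM; [exact: measurable_cst|exact: mfq]|exact: mw].
- by move=> x; rewrite lee_fin !mul1r addr_ge0// powR_ge0.
- move=> x; rewrite lee_fin !mul1r /w /weight; case: ifPn => x1.
    rewrite oppr0 powRr0 (le_trans (young_weight _ _ q1))//.
    by rewrite ler01 lexx.
  have {}x1 : 1 < `|x| by rewrite ltNge.
  have x0 : 0 < `|x| := lt_trans ltr01 x1.
  have [fx|fx] := leP `|f x| (`|x| `^ (- c)).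
    apply: (@le_trans _ _ (`|x| `^ (- (b + c)))); last by rewrite lerDr powR_ge0.
    rewrite -/b [in leRHS]opprD [in leRHS]addrC powRD ?(gt_eqF x0) ?implybT//.
    by rewrite ler_wpM2r// powR_ge0.
  apply: (@le_trans _ _ (`|f x| `^ q)); last by rewrite lerDl powR_ge0.
  rewrite -(mulr_powRB1 (normr_ge0 _) q0) ler_wpM2l//.
  apply: (@le_trans _ _ ((`|x| `^ (- c)) `^ (q - 1))).
    by rewrite -powRrM ler_powR ?(ltW x1)// mulNr lerN2.
  apply: ge0_ler_powR; rewrite ?nnegrE ?powR_ge0 ?subr_ge0//; exact: ltW.
by rewrite ge0_integral_comb// iA !mul1e lte_add_pinfty// ltry.
Qed.

End FractionalPairing.

(** * Dominated convergence with pointwise majorants *)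

Section DominatedConvergence.
Context d (T : measurableType d) (R : realType) (m : {measure set T -> \bar R}).

Lemma ge0_integral_scale_indic (a : R) (A : set T) : 0 <= a -> measurable A ->
  (\int[m]_x (a * \1_A x)%:E = a%:E * m A)%E.
Proof.
move=> a0 mA; under eq_integral do rewrite EFinM.
rewrite ge0_integralZl_EFin//; last by apply/measurable_EFinP; exact/measurable_indic.
by rewrite integral_indic// setIT.
Qed.

Lemma integrable_majorant (f : T -> R) (G : T -> \bar R) :
  measurable_fun setT f -> (forall x, `|f x|%:E <= G x)%E ->
  (\int[m]_x G x < +oo)%E -> m.-integrable setT (EFin \o f).
Proof.
move=> mf fG iG; apply/integrableP; split; first exact/measurable_EFinP.
by apply: le_lt_trans iG; apply: ge0_le_integral_sup.
Qed.

Lemma Rintegral_dominated_cvg (f_ : nat -> T -> R) (f : T -> R) (G : T -> \bar R) :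
  (forall k, measurable_fun setT (f_ k)) -> measurable_fun setT f ->
  measurable_fun setT G ->
  (forall x, f_ ^~ x @ \oo --> f x) ->
  (forall k x, `|f_ k x|%:E <= G x)%E -> (\int[m]_x G x < +oo)%E ->
  Rintegral m setT (f_ k) @[k --> \oo] --> Rintegral m setT f.
Proof.
move=> mf_ mf mG f_f f_G iG.
have G0 x : (0 <= G x)%E by apply: le_trans (f_G 0%N x).
have [] := @dominated_convergence _ _ _ m setT measurableT
  (fun k => EFin \o f_ k) (EFin \o f) G.
- by move=> k; exact/measurable_EFinP.
- exact/measurable_EFinP.
- by apply: aeW => x _; apply: cvg_EFin; [exact: nearW|exact: f_f].
- apply/integrableP; split => //; apply: le_lt_trans iG.
  by apply: ge0_le_integral_sup => // x; rewrite gee0_abs.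
- by apply: aeW => x k _; exact: f_G.
move=> fi _ cv; apply: fine_cvg; rewrite fineK//.
exact: integrable_fin_num.
Qed.

End DominatedConvergence.

(** * Directional derivatives as limits of sequences *)

Section DirectionalDerivative.
Context {R : realType} {n : nat}.
Implicit Types (w : 'rV[R]_n -> R) (x y e : 'rV[R]_n).

(** Steps [1/(k+1)] turn the derivative into a sequential limit, the form that dominated convergence
    requires. *)
Lemma difference_quotient_cvg w y e : derivable w y e ->
  (k.+1%:R * (w (y + k.+1%:R^-1 *: e) - w y)) @[k --> \oo] --> 'D_e w y.
Proof.
move=> dw; have dw' : (fun h => h^-1 *: ((w \o shift y) (h *: e) - w y)) @ 0^' --> 'D_e w y.
  exact: dw.
have /cvgr_dnbhsP h := dw'.
rewrite (_ : (fun k => _) = fun k : nat =>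
    k.+1%:R^-1^-1 *: ((w \o shift y) (k.+1%:R^-1 *: e) - w y)); last first.
  by apply/funext => k; rewrite invrK /= (addrC _ y).
apply: (h (fun k : nat => k.+1%:R^-1)); split; first by move=> k; rewrite invr_neq0.
exact: cvg_harmonic.
Qed.

Lemma difference_le w e (C : R) y (h : R) :
  (forall x, derivable w x e) -> (forall x, `|'D_e w x| <= C) ->
  0 < h -> `|w (y + h *: e) - w y| <= C * h.
Proof.
move=> dw wC h0; pose g t := w (y + t *: e).
have dg t : is_derive t (1 : R) g ('D_e w (y + t *: e)).
  have E : (fun s : R => s^-1 *: ((g \o shift t) (s *: (1 : R)) - g t)) =
    (fun s => s^-1 *: ((w \o shift (y + t *: e)) (s *: e) - w (y + t *: e))).
    apply/funext => s; rewrite /g /= [s *: 1]mulr1 scalerDl.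
    by rewrite addrCA.
  split; first by rewrite /derivable E; exact: dw.
  by rewrite /derive E.
have := lipschitz_of_is_derive dg (fun t => wC _) h 0.
by rewrite /g scale0r addr0 subr0 (gtr0_norm h0).
Qed.

(** The margin 1 keeps [y + h e] outside the cube for all steps [h <= 1], so every difference
    quotient vanishes. *)
Lemma derive_outside_cube w e (r : R) y : `|e| <= 1 ->
  (forall x, r < `|x| -> w x = 0) -> derivable w y e -> r + 1 < `|y| -> 'D_e w y = 0.
Proof.
move=> e1 w0 dw ry.
have cv := difference_quotient_cvg dw.
have z : (fun k : nat => k.+1%:R * (w (y + k.+1%:R^-1 *: e) - w y)) = fun=> 0.
  apply/funext => k; rewrite !w0 ?subr0 ?mulr0//; first by lra.
  have ke : `|k.+1%:R^-1 *: e| <= 1.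
    rewrite normrZ ger0_norm ?invr_ge0// mulr_ile1 ?invr_ge0//.
    by rewrite invf_le1// ler1n.
  have := ler_normB (y + k.+1%:R^-1 *: e) (k.+1%:R^-1 *: e); rewrite addrK.
  by move: ke; set u := `|_ *: e|; set v := `|y + _|; clear -ry; lra.
by move: cv; rewrite z => /cvg_lim <-//; rewrite lim_cst.
Qed.

End DirectionalDerivative.

(** * Integrals of derivatives of compactly supported functions *)

Section IntegrationByParts.
Context {R : realType} {n : nat}.
Local Notation mu := (@lebn R n).
Implicit Types (w F : 'rV[R]_n -> R) (x y e : 'rV[R]_n).

Lemma integral_cube_lty (C r : R) : 0 <= C -> 0 <= r ->
  (\int[mu]_x (C * \1_(cube (0 : 'rV[R]_n) r) x)%:E < +oo)%E.
Proof.
move=> C0 r0; rewrite ge0_integral_scale_indic//; last exact: measurable_cube.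
apply: (@le_lt_trans _ _ (C%:E * ((2 * r) ^+ n)%:E)%E); last by rewrite -EFinM ltry.
by rewrite lee_wpmul2l ?lee_fin// lebn_cube.
Qed.

Lemma measurable_cube_majorant (C r : R) :
  measurable_fun setT ((fun x => (C * \1_(cube (0 : 'rV[R]_n) r) x)%:E) : LebRn R n -> \bar R).
Proof.
apply/measurable_EFinP; apply: measurable_funM; first exact: measurable_cst.
exact/measurable_indic/measurable_cube.
Qed.

Lemma compact_support_majorant w (C r : R) y :
  (forall x, `|w x| <= C) -> (forall x, r < `|x| -> w x = 0) ->
  (`|w y|%:E <= (C * \1_(cube (0 : 'rV[R]_n) r) y)%:E)%E.
Proof.
move=> wC w0; rewrite lee_fin indicE; have [yr|yr] := leP `|y| r.
  by rewrite mem_set ?mulr1// /cube/= subr0.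
by rewrite w0// normr0 memNset ?mulr0// /cube/= subr0; apply/negP; rewrite -ltNge.
Qed.

(** By translation invariance each difference quotient has integral 0. The quotients are bounded by
    [C] and supported in the cube of radius [r + 1], so the limit can be taken under the
    integral. *)
Lemma integral_derive_eq0 w e (C M r : R) : `|e| <= 1 -> 0 <= r ->
  (forall x, derivable w x e) -> continuous w -> continuous (fun x => 'D_e w x) ->
  (forall x, `|'D_e w x| <= C) -> (forall x, `|w x| <= M) ->
  (forall x, r < `|x| -> w x = 0) ->
  Rintegral mu setT ((fun x => 'D_e w x) : LebRn R n -> R) = 0.
Proof.
move=> e1 r0 dw cw cdw wC wM w0.
have C0 : 0 <= C := le_trans (normr_ge0 _) (wC 0).
have M0 : 0 <= M := le_trans (normr_ge0 _) (wM 0).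
have mw : measurable_fun setT (w : LebRn R n -> R) by exact: continuous_measurable_LebRn.
have mwk k : measurable_fun setT ((fun y => w (y + k.+1%:R^-1 *: e)) : LebRn R n -> R).
  have := measurable_shift (- (k.+1%:R^-1 *: e)) mw.
  by under eq_fun do rewrite opprK.
have iw : mu.-integrable setT (EFin \o (w : LebRn R n -> R)).
  apply: (integrable_majorant mw); last exact: (integral_cube_lty M0 r0).
  by move=> y; exact: compact_support_majorant.
pose q k (y : 'rV[R]_n) := k.+1%:R * (w (y + k.+1%:R^-1 *: e) - w y).
have wshift k (y : 'rV[R]_n) : r + 1 < `|y| -> w (y + k.+1%:R^-1 *: e) = 0.
  move=> ry; apply: w0.
  have ke : `|k.+1%:R^-1 *: e| <= 1.
    rewrite normrZ ger0_norm ?invr_ge0// mulr_ile1 ?invr_ge0//.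
    by rewrite invf_le1// ler1n.
  have := ler_normB (y + k.+1%:R^-1 *: e) (k.+1%:R^-1 *: e); rewrite addrK.
  by move: ke; set u := `|_ *: e|; set v := `|y + _|; clear -ry; lra.
have mq k : measurable_fun setT (q k : LebRn R n -> R).
  apply: measurable_funM; first exact: measurable_cst.
  by apply: measurable_funB.
have q0 k : Rintegral mu setT (q k : LebRn R n -> R) = 0.
  have iwk : mu.-integrable setT (EFin \o ((fun y => w (y + k.+1%:R^-1 *: e)) : LebRn R n -> R)).
    apply: (integrable_majorant (mwk k)); last first.
      by apply: (integral_cube_lty M0 (_ : 0 <= r + 1)); rewrite addr_ge0.
    by move=> y; apply: (compact_support_majorant (w := fun y => w (y + k.+1%:R^-1 *: e))) => // x; exact: wshift.
  rewrite /q RintegralZl//; last first.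
    exact: (@integrableB _ _ _ _ _ measurableT _ _ iwk iw).
  have E : (\int[mu]_x (w (x + k.+1%:R^-1 *: e))%:E = \int[mu]_x (w x)%:E)%E.
    rewrite -(integral_shift (- (k.+1%:R^-1 *: e)) mw).
    by apply: eq_integral => x _; rewrite opprK.
  by rewrite RintegralB// /Rintegral E subrr mulr0.
have cv := @Rintegral_dominated_cvg _ _ _ mu (fun k => q k : LebRn R n -> R) (fun x => 'D_e w x)
  (fun x => (C * \1_(cube (0 : 'rV[R]_n) (r + 1)) x)%:E) mq
  (continuous_measurable_LebRn cdw) (measurable_cube_majorant _ _).
have : (fun k => Rintegral mu setT (q k : LebRn R n -> R)) @ \oo -->
  Rintegral mu setT ((fun x => 'D_e w x) : LebRn R n -> R).
  apply: cv.
  - by move=> x; exact: difference_quotient_cvg.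
  - move=> k x; apply: compact_support_majorant => y.
      rewrite /q normrM ger0_norm// mulrC -ler_pdivlMr//.
      by apply: difference_le => //; rewrite invr_gt0.
    by move=> ry; rewrite /q wshift// w0 ?subrr ?mulr0//; lra.
  - by apply: integral_cube_lty => //; rewrite addr_ge0.
rewrite (_ : (fun k => _) = fun=> 0); last by apply/funext => k; exact: q0.
by move=> /cvg_lim <-//; rewrite lim_cst.
Qed.

End IntegrationByParts.

Section NullModification.
Context d (T : measurableType d) (R : realType) (m : {measure set T -> \bar R}).

(* Makes a pointwise majorant out of an almost everywhere one. *)
Lemma null_modification (A : set T) (G : T -> \bar R) : measurable A -> m A = 0%E ->
  measurable_fun setT G -> (forall x, 0 <= G x)%E ->
  (\int[m]_x (G x + +oo * (\1_A x)%:E) = \int[m]_x G x)%E.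
Proof.
move=> mA A0 mG G0.
have I0 x : (0 <= +oo * (\1_A x)%:E :> \bar R)%E by rewrite mule_ge0// lee_fin.
apply: ge0_ae_eq_integral => //.
- apply: emeasurable_funD => //; apply: emeasurable_funM; first exact: measurable_cst.
  by apply/measurable_EFinP; exact/measurable_indic.
- by move=> x _; rewrite adde_ge0.
exists A; split => // x /= h; apply: contrapT => xA; apply: h => _.
by rewrite indicE memNset// mule0 adde0.
Qed.

Lemma ge0_integral_scaleR (a : R) (w : T -> R) : 0 <= a -> measurable_fun setT w ->
  (forall x, 0 <= w x) -> (\int[m]_x (a * w x)%:E = a%:E * \int[m]_x (w x)%:E)%E.
Proof.
move=> a0 mw w0; under eq_integral do rewrite EFinM.
have mW : measurable_fun setT (fun x : T => (w x)%:E) by exact/measurable_EFinP.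
by rewrite ge0_integralZl_EFin// => x _; rewrite lee_fin.
Qed.

End NullModification.

Section ContinuousOperations.
Context {R : realType} {T : topologicalType}.
Implicit Types (f g : T -> R).

Lemma continuous_mul f g : continuous f -> continuous g -> continuous (fun y => f y * g y).
Proof. by move=> cf cg y; exact: (@continuousM _ _ f g y (cf y) (cg y)). Qed.

Lemma continuous_sub f g : continuous f -> continuous g -> continuous (fun y => f y - g y).
Proof. by move=> cf cg y; exact: (@continuousB _ _ _ f g y (cf y) (cg y)). Qed.

End ContinuousOperations.

(** * Integration by parts against the regularized kernel *)

Section RegularizedKernel.
Context {R : realType} {n : nat}.
Local Notation mu := (@lebn R n).
Variables (x : 'rV[R]_n) (i : 'I_n).
Implicit Types (F : 'rV[R]_n -> R) (y z : 'rV[R]_n) (b d : R).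
Local Notation e := (delta_mx 0 i : 'rV[R]_n).

Lemma norm_delta_le1 : `|e| <= 1.
Proof.
by apply: norm_le_coord => // j; rewrite mxE eqxx /=; case: (j == i); rewrite ?normr1 ?normr0.
Qed.

Definition quad d y : R := dotRn (y - x) (y - x) + d.

Lemma quad_gt0 d y : 0 < d -> 0 < quad d y.
Proof. by move=> d0; rewrite ltr_wpDl// dotRn_ge0. Qed.

Lemma quad_ged d y : d <= quad d y.
Proof. by rewrite lerDr dotRn_ge0. Qed.

Lemma sqr_coord_le_dotRn z : (z 0 i) ^+ 2 <= dotRn z z.
Proof.
rewrite /dotRn (bigD1 i)//= -expr2 lerDl.
by apply: sumr_ge0 => j _; rewrite -expr2 sqr_ge0.
Qed.

Lemma sqr_norm_le_dotRn z : `|z| ^+ 2 <= dotRn z z.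
Proof.
rewrite -[leRHS](sqr_sqrtr (dotRn_ge0 z)) ler_sqr ?nnegrE ?sqrtr_ge0//.
exact: norm_le_enorm.
Qed.

Lemma Ck_quad k d : Ck k (quad d).
Proof.
apply: CkD; last exact: Ck_cst.
rewrite (_ : (fun y => _) = fun y => \sum_(j <- index_enum 'I_n) (y 0 j - x 0 j) * (y 0 j - x 0 j)).
  elim: (index_enum _) => [|j s IH].
    rewrite (_ : (fun y => _) = fun=> 0); first exact: Ck_cst.
    by apply/funext => y; rewrite big_nil.
  rewrite (_ : (fun y => _) = fun y => (y 0 j - x 0 j) * (y 0 j - x 0 j) +
      \sum_(l <- s) (y 0 l - x 0 l) * (y 0 l - x 0 l)).
    by apply: CkD => //; apply: CkM; apply: CkB; try exact: Ck_coord; exact: Ck_cst.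
  by apply/funext => y; rewrite big_cons.
by apply/funext => y; apply: eq_bigr => j _; rewrite !mxE.
Qed.

Lemma dotRn_add_delta z (h : R) :
  dotRn (z + h *: e) (z + h *: e) = dotRn z z + h * (2 * z 0 i + h).
Proof.
rewrite /dotRn (bigD1 i)//= [in RHS](bigD1 i)//= !mxE !eqxx mulr1.
rewrite (eq_bigr (fun j => z 0 j * z 0 j)); first by ring.
by move=> j ji; rewrite !mxE (negbTE ji) andbF mulr0 addr0.
Qed.

Lemma derive_quad d y : 'D_e (quad d) y = 2 * (y - x) 0 i.
Proof.
have key : (fun h : R => h^-1 *: ((quad d \o shift y) (h *: e) - quad d y)) @ 0^' -->
    2 * (y - x) 0 i.
  apply: (@cvg_trans _ ((fun h : R => 2 * (y - x) 0 i + h) @ 0^')).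
    apply: near_eq_cvg; near=> h.
    have h0 : h != 0 by near: h; exact: nbhs_dnbhs_neq.
    have E : h *: e + y - x = (y - x) + h *: e by rewrite -addrA addrC.
    rewrite /quad /= E dotRn_add_delta.
    rewrite -[_ *: _]/(_ * _); move: (dotRn _ _) ((y - x) 0 i) => u v.
    by field.
  have H : (fun h : R => 2 * (y - x) 0 i + h) @ 0^' --> 2 * (y - x) 0 i + 0.
    by apply: cvgD; [exact: cvg_cst|exact: cvg_within].
  by rewrite addr0 in H.
exact: (cvg_lim _ key).
Unshelve. all: by end_near. Qed.

(* [kern b d] regularizes [|y - x|^-b], and [- b * dkern b d] is its derivative
   in the direction [e]. *)
Definition kern b d y : R := quad d y `^ (- (b / 2)).
Definition dkern b d y : R := (y - x) 0 i * quad d y `^ (- (b / 2) - 1).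

Lemma derive_kern b d y : 0 < d ->
  differentiable (kern b d) y /\ 'D_e (kern b d) y = - b * dkern b d y.
Proof.
move=> d0; have q0 := quad_gt0 y d0.
have dq : differentiable (quad d) y by exact: (Ck_differentiable (k := 0) _ (Ck_quad 0 d)).
have [h1 h2] := derive_comp1 e (is_derive1_powR (- (b / 2)) q0) dq.
by split; first exact: h1; rewrite h2 derive_quad /dkern; field.
Qed.

Lemma continuous_kern b d : 0 < d -> continuous (kern b d).
Proof. by move=> d0 y; apply: differentiable_continuous; exact: (derive_kern b y d0).1. Qed.

Lemma continuous_coord j : continuous (fun y : 'rV[R]_n => y 0 j).
Proof.
move=> y; apply: differentiable_continuous.
exact: (Ck_differentiable (k := 0) _ (Ck_coord 0 j)).
Qed.

Lemma continuous_dkern b d : 0 < d -> continuous (dkern b d).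
Proof.
move=> d0 y; apply: (@continuousM _ _ (fun y => (y - x) 0 i) (fun y => quad d y `^ (- (b / 2) - 1))).
  have -> : (fun y : 'rV[R]_n => (y - x) 0 i) = fun y => y 0 i - x 0 i.
    by apply/funext => z; rewrite !mxE.
  apply: continuousB; [exact: continuous_coord|exact: cst_continuous].
have := @continuous_kern (b + 2) d d0 y; rewrite /kern.
by have -> : - ((b + 2) / 2) = - (b / 2) - 1 by field.
Qed.

(** The coordinate of [y - x] is at most the square root of [quad], which raises the exponent by one
    half. *)
Lemma dkern_le b d y : 0 < d -> `|dkern b d y| <= quad d y `^ (- ((b + 1) / 2)).
Proof.
move=> d0; have q0 := quad_gt0 y d0.
rewrite /dkern normrM (ger0_norm (powR_ge0 _ _)).
have -> : - ((b + 1) / 2) = 2^-1 + (- (b / 2) - 1) by field.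
rewrite [leRHS]powRD; last by rewrite (gt_eqF q0) implybT.
rewrite ler_wpM2r ?powR_ge0// powR12_sqrt ?(ltW q0)// -sqrtr_sqr ler_wsqrtr//.
by rewrite (le_trans (sqr_coord_le_dotRn _))// lerDl ltW.
Qed.

Lemma quad_powRN_le_d c d y : 0 < d -> 0 <= c -> quad d y `^ (- c) <= d `^ (- c).
Proof. by move=> d0 c0; apply: le_powRN => //; exact: quad_ged. Qed.

(** The bound is uniform in [d], as the limit requires. The point [x] is excluded because a negative
    power of 0 is 0 by convention. *)
Lemma quad_powRN_le_norm c d y : 0 < d -> 0 <= c -> y != x ->
  quad d y `^ (- (c / 2)) <= `|y - x| `^ (- c).
Proof.
move=> d0 c0 yx; have z0 : 0 < `|y - x| by rewrite normr_gt0 subr_eq0.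
have -> : `|y - x| `^ (- c) = (`|y - x| ^+ 2) `^ (- (c / 2)).
  by rewrite -powR_mulrn ?normr_ge0// -powRrM; congr powR; field.
apply: le_powRN; rewrite ?exprn_gt0 ?divr_ge0//.
by rewrite (le_trans (sqr_norm_le_dotRn _))// lerDl ltW.
Qed.

Lemma integrable_dkern b d : 0 < d -> 0 < b -> n%:R < b + 1 ->  (0 < n)%N ->
  mu.-integrable setT (EFin \o (dkern b d : LebRn R n -> R)).
Proof.
move=> d0 b0 nb n0; pose K := 1 + d `^ (- ((b + 1) / 2)).
have K0 : 0 <= K by rewrite addr_ge0 ?powR_ge0.
have b1 : 0 <= b + 1 by rewrite addr_ge0// ltW.
have mw : measurable_fun setT ((fun y => weight 0 (b + 1) (y - x)) : LebRn R n -> R).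
  exact/measurable_shift/measurable_weight.
have iw : (\int[mu]_y (weight 0 (b + 1) (y - x))%:E < +oo)%E.
  rewrite (integral_shift x (measurable_weight 0 (b + 1))).
  by apply: integral_weight_lty; rewrite ?lexx ?ltr0n.
apply: (@integrable_majorant _ _ _ mu _ (fun y => (K * weight 0 (b + 1) (y - x))%:E)).
- by apply: continuous_measurable_LebRn; exact: continuous_dkern.
- move=> y; rewrite lee_fin (le_trans (dkern_le b y d0))//.
  rewrite /weight; case: ifPn => z1.
    rewrite oppr0 powRr0 mulr1 (le_trans (quad_powRN_le_d y d0 _)) ?divr_ge0//.
    by rewrite /K lerDr.
  have yx : y != x by apply: contra z1 => /eqP ->; rewrite subrr normr0.
  rewrite (le_trans (quad_powRN_le_norm d0 b1 yx))// ler_peMl ?powR_ge0//.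
  by rewrite /K lerDl powR_ge0.
rewrite (ge0_integral_scaleR _ K0 mw); last by move=> y; exact: weight_ge0.
by rewrite lte_mul_pinfty// ?lee_fin.
Qed.

(** The kernel changes sign under the reflection [y |-> 2 x - y], which preserves the measure. *)
Lemma Rintegral_dkern b d : 0 < d -> 0 < b -> n%:R < b + 1 -> (0 < n)%N ->
  Rintegral mu setT (dkern b d : LebRn R n -> R) = 0.
Proof.
move=> d0 b0 nb n0; have ik := integrable_dkern d0 b0 nb n0.
have mk : measurable_fun setT (dkern b d : LebRn R n -> R).
  by apply: continuous_measurable_LebRn; exact: continuous_dkern.
have E : Rintegral mu setT (dkern b d : LebRn R n -> R) =
   Rintegral mu setT ((fun y => -1 * dkern b d y) : LebRn R n -> R).
  rewrite /Rintegral; congr fine.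
  have mkE : measurable_fun setT ((fun y => (dkern b d y)%:E) : LebRn R n -> \bar R).
    exact/measurable_EFinP.
  have N1 : `|-1 : R| = 1 by rewrite normrN1.
  rewrite -(integral_affine (2 *: x) N1 mkE).
  apply: eq_integral => y _; congr EFin; rewrite /dkern /quad.
    have -> : affine (-1) (2 *: x) y - x = - (y - x).
      by rewrite /affine scaleN1r scaler_nat mulr2n opprB addrAC addrK.
    have -> : dotRn (- (y - x)) (- (y - x)) = dotRn (y - x) (y - x).
      by apply: eq_bigr => j _; rewrite !mxE mulrNN.
    by rewrite mxE mulN1r mulNr.
rewrite RintegralZl// in E.
by apply/eqP; rewrite -[_ == 0](mulrn_eq0 _ 2) mulr2n {2}E mulN1r subrr.
Qed.

Lemma derive_le_lipschitz F (L : R) y : (forall u v, `|F u - F v| <= L * `|u - v|) ->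
  0 <= L -> derivable F y e -> `|'D_e F y| <= L.
Proof.
move=> FL L0 dF; have cv : (fun k => `|k.+1%:R * (F (y + k.+1%:R^-1 *: e) - F y)|) @ \oo --> `|'D_e F y|.
  exact: cvg_norm (difference_quotient_cvg dF).
rewrite -(cvg_lim _ cv)//; apply: limr_le; first by apply/cvg_ex; eexists; exact: cv.
apply: nearW => k; rewrite normrM ger0_norm//.
apply: (@le_trans _ _ (k.+1%:R * (L * k.+1%:R^-1))); last by rewrite mulrCA divff ?mulr1// pnatr_eq0.
rewrite ler_wpM2l// (le_trans (FL _ _))// ler_wpM2l// addrAC subrr add0r normrZ.
by rewrite ger0_norm ?invr_ge0// ler_piMr ?invr_ge0// norm_delta_le1.
Qed.

Section WithTestFunction.
Variables (F : 'rV[R]_n -> R) (L M r : R).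
Hypotheses (CF : Ck 1 F) (FL : forall u v, `|F u - F v| <= L * `|u - v|)
  (L0 : 0 <= L) (FM : forall u, `|F u| <= M) (r0 : 0 <= r)
  (F0 : forall u, r < `|u| -> F u = 0).

Lemma derivable_test y : derivable F y e.
Proof. by apply: diff_derivable; exact: (Ck_differentiable _ CF). Qed.

Lemma continuous_test : continuous F.
Proof. by move=> y; apply: differentiable_continuous; exact: (Ck_differentiable _ CF). Qed.

Lemma continuous_derive_test : continuous (fun y => 'D_e F y).
Proof.
by case: CF => _ /(_ e) CD y; apply: differentiable_continuous; exact: CD.1.
Qed.

(** The derivative of [F * kern] integrates to 0, and subtracting [F x] is free because [dkern] does
    too. With the difference in place the integrand has a majorant independent of [d]. *)
Lemma regularized_integration_by_parts b d : 0 < d -> 0 < b -> n%:R < b + 1 -> (0 < n)%N ->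
  Rintegral mu setT ((fun y => 'D_e F y * kern b d y) : LebRn R n -> R) =
  b * Rintegral mu setT ((fun y => (F y - F x) * dkern b d y) : LebRn R n -> R).
Proof.
move=> d0 b0 nb n0.
have M0 : 0 <= M := le_trans (normr_ge0 _) (FM 0).
pose K0 := d `^ (- (b / 2)); pose K1 := d `^ (- ((b + 1) / 2)).
have kK y : `|kern b d y| <= K0.
  rewrite ger0_norm ?powR_ge0//; apply: quad_powRN_le_d => //.
  by rewrite divr_ge0// ltW.
have b1 : 0 <= b + 1 by rewrite addr_ge0// ltW.
have dK y : `|dkern b d y| <= K1.
  by rewrite (le_trans (dkern_le b y d0))// quad_powRN_le_d// divr_ge0.
have K00 : 0 <= K0 by exact: powR_ge0.
have K10 : 0 <= K1 by exact: powR_ge0.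
have DL y : `|'D_e F y| <= L by apply: derive_le_lipschitz => //; exact: derivable_test.
have D0 y : r + 1 < `|y| -> 'D_e F y = 0.
  by apply: derive_outside_cube => //; [exact: norm_delta_le1|exact: derivable_test].
have ck := @continuous_kern b d d0; have cdk := @continuous_dkern b d d0.
have cF := continuous_test; have cD := continuous_derive_test.
have r1 : 0 <= r + 1 by rewrite addr_ge0.
have iDk : mu.-integrable setT (EFin \o ((fun y => 'D_e F y * kern b d y) : LebRn R n -> R)).
  apply: integrable_majorant (integral_cube_lty (mulr_ge0 L0 K00) r1).
    by apply: continuous_measurable_LebRn; exact: continuous_mul.
  move=> y; apply: (compact_support_majorant (w := fun y => 'D_e F y * kern b d y)) => u.
    by rewrite normrM ler_pM.
  by move=> /D0 ->; rewrite mul0r.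
have iFk : mu.-integrable setT (EFin \o ((fun y => F y * dkern b d y) : LebRn R n -> R)).
  apply: integrable_majorant (integral_cube_lty (mulr_ge0 M0 K10) r0).
    by apply: continuous_measurable_LebRn; exact: continuous_mul.
  move=> y; apply: (compact_support_majorant (w := fun y => F y * dkern b d y)) => u.
    by rewrite normrM ler_pM.
  by move=> /F0 ->; rewrite mul0r.
have ik := integrable_dkern d0 b0 nb n0.
have Dw y : 'D_e (fun y => F y * kern b d y) y = 'D_e F y * kern b d y - b * (F y * dkern b d y).
  have [dk Dk] := derive_kern b y d0.
  rewrite (_ : (fun y => F y * kern b d y) = F * kern b d)//.
  rewrite deriveM; [|exact: derivable_test|exact: diff_derivable].
  rewrite Dk -![_ *: _]/(_ * _).
  by move: ('D_e F y) (kern b d y) (F y) (dkern b d y) => u v s t; ring.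
have := @integral_derive_eq0 R n (fun y => F y * kern b d y) e (L * K0 + b * (M * K1)) (M * K0) r norm_delta_le1 r0.
have -> : (fun y => 'D_e (fun y => F y * kern b d y) y) =
    fun y => 'D_e F y * kern b d y - b * (F y * dkern b d y) by apply/funext => y; exact: Dw.
rewrite RintegralB//; last exact: (@integrableZl _ _ _ mu setT measurableT b _ iFk).
rewrite RintegralZl// => h.
have {}h : Rintegral mu setT ((fun y => 'D_e F y * kern b d y) : LebRn R n -> R) =
    b * Rintegral mu setT ((fun y => F y * dkern b d y) : LebRn R n -> R).
  apply/eqP; rewrite -subr_eq0; apply/eqP; apply: h.
  - move=> y; apply: diff_derivable.
    apply: (@differentiableM _ _ F (kern b d)); first exact: (Ck_differentiable _ CF).
    exact: (derive_kern b y d0).1.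
  - exact: continuous_mul.
  - apply: continuous_sub; first exact: continuous_mul.
    apply: continuous_mul; first exact: cst_continuous.
    exact: continuous_mul.
  - move=> y; rewrite Dw (le_trans (ler_normB _ _))// lerD//.
      by rewrite normrM ler_pM.
    by rewrite normrM (gtr0_norm b0) ler_pM2l// normrM ler_pM.
  - by move=> y; rewrite normrM ler_pM.
  - by move=> y /F0 ->; rewrite mul0r.
rewrite h; congr (_ * _).
transitivity (Rintegral mu setT ((fun y => F y * dkern b d y - F x * dkern b d y) : LebRn R n -> R)).
  rewrite RintegralB//; last exact: (@integrableZl _ _ _ mu setT measurableT (F x) _ ik).
  by rewrite RintegralZl// Rintegral_dkern// mulr0 subr0.
by apply: eq_Rintegral => y _; rewrite mulrBl.
Qed.

(** The bound is proved for every [d = 1/(k+1)] on the side carrying the derivative, where the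
    kernel is dominated by [|y - x|^-b]; it passes to the limit on the other side. The constants
    [L], [M], [r] justify the limit but do not enter the bound. *)
Lemma singular_integral_le (b : R) (G : LebRn R n -> \bar R) (B : R) :
  0 < b -> b < n%:R -> n%:R < b + 1 ->
  measurable_fun setT G -> (forall y, 0 <= G y)%E ->
  (forall y, y != x -> ((`|'D_e F y| * `|y - x| `^ (- b))%:E <= G y)%E) ->
  (\int[mu]_y G y <= B%:E)%E ->
  `|Rintegral mu setT ((fun y => (F y - F x) * ((y - x) 0 i *
       dotRn (y - x) (y - x) `^ (- (b / 2) - 1))) : LebRn R n -> R)| <= B / b.
Proof.
move=> b0 bn nb mG G0 FG iG.
have n0 : (0 < n)%N by rewrite -(ltr0n R) (lt_trans b0).
have M0 : 0 <= M := le_trans (normr_ge0 _) (FM 0).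
have b1 : 0 <= b + 1 by rewrite addr_ge0// ltW.
pose d k : R := k.+1%:R^-1.
have d0 k : 0 < d k by rewrite invr_gt0.
pose f k y := (F y - F x) * dkern b (d k) y.
have fB k : `|Rintegral mu setT (f k : LebRn R n -> R)| <= B / b.
  rewrite ler_pdivlMr// mulrC -[X in X * _](gtr0_norm b0) -normrM.
  rewrite -regularized_integration_by_parts//.
  (* At [y = x] the regularized kernel is positive and [G] gives no bound; the value [+oo] on the
     null set [{x}] repairs this. *)
  apply: (@normr_Rintegral_le _ _ _ mu _ (fun y => G y + +oo * (\1_[set x] y)%:E)%E).
    move=> y; have [->|yx] := eqVneq y x.
      rewrite indicE mem_set// mule1; apply: (@le_trans _ _ +oo%E); first exact: leey.
      by rewrite leeDr.
    rewrite indicE memNset ?mule0 ?adde0; last by move=> /eqP; rewrite (negbTE yx).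
    apply: le_trans (FG _ yx); rewrite lee_fin normrM ler_wpM2l//.
    by rewrite ger0_norm ?powR_ge0// quad_powRN_le_norm// ltW.
  have sx : [set x] = cube x 0.
    apply/seteqP; split=> y; rewrite /cube /= ?normr_le0 ?subr_eq0.
      by move=> ->.
    by move/eqP.
  rewrite null_modification//; first by rewrite sx; exact: measurable_cube.
  apply/eqP; rewrite eq_le measure_ge0 andbT sx (le_trans (lebn_cube _ _))//.
  by rewrite mulr0 expr0n gtn_eqF.
pose f0 y := (F y - F x) * ((y - x) 0 i * dotRn (y - x) (y - x) `^ (- (b / 2) - 1)).
have fcv y : f ^~ y @ \oo --> f0 y.
  have [->|yx] := eqVneq y x.
    rewrite (_ : (fun k => _) = fun=> 0); last first.
      by apply/funext => k; rewrite /f subrr mul0r.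
    by rewrite /f0 subrr mul0r; exact: cvg_cst.
  have D0 : 0 < dotRn (y - x) (y - x).
    by rewrite (lt_le_trans _ (sqr_norm_le_dotRn _))// exprn_gt0// normr_gt0 subr_eq0.
  apply: cvgM; first exact: cvg_cst.
  apply: cvgM; first exact: cvg_cst.
  have cp : {for dotRn (y - x) (y - x), continuous (fun t : R => t `^ (- (b / 2) - 1))}.
    apply: differentiable_continuous; apply/derivable1_diffP.
    by have [] := is_derive1_powR (- (b / 2) - 1) D0.
  apply: (@cvg_comp _ _ _ (fun k => quad (d k) y) (fun t : R => t `^ (- (b / 2) - 1)) _ (nbhs (dotRn (y - x) (y - x)))).
    have H : (fun k => quad (d k) y) @ \oo --> dotRn (y - x) (y - x) + 0.
      by apply: cvgD; [exact: cvg_cst|exact: cvg_harmonic].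
    by rewrite addr0 in H.
  exact: cp.
have mf k : measurable_fun setT (f k : LebRn R n -> R).
  apply: continuous_measurable_LebRn; apply: continuous_mul; last exact: continuous_dkern.
  by apply: continuous_sub; [exact: continuous_test|exact: cst_continuous].
have mf0 : measurable_fun setT (f0 : LebRn R n -> R).
  apply: measurable_funM.
    apply: continuous_measurable_LebRn.
    by apply: continuous_sub; [exact: continuous_test|exact: cst_continuous].
  apply: measurable_funM.
    apply: continuous_measurable_LebRn.
    have -> : (fun y : 'rV[R]_n => (y - x) 0 i) = fun y => y 0 i - x 0 i.
      by apply/funext => z; rewrite !mxE.
    by apply: continuous_sub; [exact: continuous_coord|exact: cst_continuous].
  apply: (measurableT_comp (measurable_powR (- (b / 2) - 1))).
  apply: continuous_measurable_LebRn => y; apply: differentiable_continuous.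
  have := Ck_differentiable y (Ck_quad 0 0).
  by rewrite (_ : quad 0 = fun y => dotRn (y - x) (y - x))//; apply/funext => z; rewrite /quad addr0.
(* The dominating function: close to [x] the Lipschitz bound lowers the exponent [b + 1] to [b < n];
   elsewhere [|F y - F x| <= 2 M] and [b + 1 > n]. *)
have mW : measurable_fun setT ((fun y => (L + 2 * M) * weight b (b + 1) (y - x)) : LebRn R n -> R).
  by apply: measurable_funM; [exact: measurable_cst|exact/measurable_shift/measurable_weight].
have LM0 : 0 <= L + 2 * M by rewrite addr_ge0// mulr_ge0.
have iW : (\int[mu]_y ((L + 2 * M) * weight b (b + 1) (y - x))%:E < +oo)%E.
  have mw : measurable_fun setT ((fun y => weight b (b + 1) (y - x)) : LebRn R n -> R).
    exact/measurable_shift/measurable_weight.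
  rewrite (ge0_integral_scaleR _ LM0 mw); last by move=> y; exact: weight_ge0.
  rewrite (integral_shift x (measurable_weight b (b + 1))).
  rewrite lte_mul_pinfty// ?lee_fin//.
  by apply: integral_weight_lty; rewrite ?(ltW b0).
have fW k y : (`|f k y|%:E <= ((L + 2 * M) * weight b (b + 1) (y - x))%:E)%E.
  rewrite lee_fin /f; have [->|yx] := eqVneq y x.
    by rewrite subrr mul0r normr0 mulr_ge0// weight_ge0.
  have z0 : 0 < `|y - x| by rewrite normr_gt0 subr_eq0.
  rewrite normrM; apply: (@le_trans _ _ (`|F y - F x| * `|y - x| `^ (- (b + 1)))).
    rewrite ler_wpM2l// (le_trans (dkern_le b y (d0 k)))//.
    exact: quad_powRN_le_norm.
  rewrite /weight; case: ifPn => z1.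
    have -> : `|y - x| `^ (- b) = `|y - x| * `|y - x| `^ (- (b + 1)).
      rewrite -{2}(powRr1 (ltW z0)) -powRD ?(gt_eqF z0) ?implybT//.
      by congr powR; ring.
    rewrite mulrA ler_wpM2r ?powR_ge0// (le_trans (FL y x))// ler_wpM2r//.
    by rewrite lerDl mulr_ge0.
  rewrite ler_wpM2r ?powR_ge0// (le_trans (ler_normB _ _))//.
  apply: (@le_trans _ _ (M + M)); first by rewrite lerD.
  have -> : M + M = 2 * M by ring.
  by rewrite lerDr.
have mWE : measurable_fun setT
    ((fun y => ((L + 2 * M) * weight b (b + 1) (y - x))%:E) : LebRn R n -> \bar R).
  exact/measurable_EFinP.
have cv : (fun k => `|Rintegral mu setT (f k : LebRn R n -> R)|) @ \oo -->
    `|Rintegral mu setT (f0 : LebRn R n -> R)|.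
  by apply: cvg_norm; exact: (Rintegral_dominated_cvg mf mf0 mWE fcv fW iW).
rewrite -(cvg_lim _ cv)//; apply: limr_le; last exact: nearW.
by apply/cvg_ex; eexists; exact: cv.
Qed.

End WithTestFunction.

End RegularizedKernel.

(** * Cylindrical cutoffs and potentials of small sets *)

Section CylindricalCutoffs.
Context {R : realType} {n : nat}.
Local Notation mu := (@lebn R n).
Implicit Types (x y u v : 'rV[R]_n) (S : set 'rV[R]_n).

(** The constant grows as the radii shrink. This is harmless for the cylindrical cutoff, where it
    only justifies a limit. *)
Lemma union_cutoff_lipschitz A (L : seq ('rV[R]_n * R)) :
  (forall q, q \in L -> 0 < q.2) ->
  exists2 C : R, 0 <= C & forall u v,
    `|union_cutoff A L u - union_cutoff A L v| <= C * `|u - v|.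
Proof.
have [C C0 hC] := @cutoff_lipschitz R n A; move=> L0.
exists (\sum_(q <- L) C / `|q.2|).
  by apply: sumr_ge0 => q _; rewrite divr_ge0.
move=> u v; apply: le_trans (union_cutoff_dist _ _ _ _) _.
rewrite mulr_suml big_seq [leRHS]big_seq; apply: ler_sum => q /L0 q0.
by rewrite (gtr0_norm q0); exact: hC.
Qed.

Lemma derive_invariant (w : 'rV[R]_n -> R) e y : derivable w y e ->
  (forall h : R, w (y + h *: e) = w y) -> 'D_e w y = 0.
Proof.
move=> dw inv; have cv := difference_quotient_cvg dw.
have E : (fun k : nat => k.+1%:R * (w (y + k.+1%:R^-1 *: e) - w y)) = fun=> 0.
  by apply/funext => k; rewrite inv subrr mulr0.
by move: cv; rewrite E => /cvg_lim <-//; rewrite lim_cst.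
Qed.

Lemma union_cutoff_ext (A : pred 'I_n) (L : seq ('rV[R]_n * R)) u v :
  (forall j, A j -> u 0 j = v 0 j) -> union_cutoff A L u = union_cutoff A L v.
Proof.
move=> uv; rewrite /union_cutoff; do 2 apply: congr1.
by apply: eq_bigr => q _; do 2 apply: congr1; apply: eq_bigr => j /uv ->.
Qed.

Lemma union_cutoff_invariant i (L : seq ('rV[R]_n * R)) y (h : R) :
  union_cutoff (predC1 i) L (y + h *: delta_mx 0 i) = union_cutoff (predC1 i) L y.
Proof.
by apply: union_cutoff_ext => j /= ji; rewrite !mxE (negbTE ji) andbF mulr0 addr0.
Qed.

(** Truncated support of one factor: the radius is doubled because [bump] vanishes only from 2 on,
    and the axis is cut at height [r] around 0. *)
Definition cylinder (i : 'I_n) (r : R) (q : 'rV[R]_n * R) : set 'rV[R]_n :=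
  [set y | forall j, `|y 0 j - (if j == i then 0 else q.1 0 j)| <=
     (if j == i then r else 2 * q.2)].

Lemma closed_cylinder i r q : closed (cylinder i r q).
Proof.
rewrite (_ : cylinder i r q = \bigcap_(j in [set: 'I_n])
  ((fun y : 'rV[R]_n => `|y 0 j - (if j == i then 0 else q.1 0 j)|) @^-1`
    [set t : R | t <= (if j == i then r else 2 * q.2)])).
  apply: closed_bigI => j _; apply: closed_comp; last exact: closed_le.
  move=> y _; apply: (@continuous_comp _ _ _ (fun y : 'rV[R]_n => y 0 j - (if j == i then 0 else q.1 0 j)));
    last exact: norm_continuous.
  by apply: continuous_sub; [exact: continuous_coord|exact: cst_continuous].
by apply/seteqP; split=> y h; [move=> j _; exact: h|move=> j; exact: (h j I)].
Qed.

(** All sides but the [i]-th have length [4 * q.2]; this is where the exponent [n - 1] of the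
    Hausdorff measure comes from. *)
Lemma lebn_cylinder i r q : 0 <= r -> 0 <= q.2 ->
  (lebn (cylinder i r q) <= (2 * r * (4 * q.2) ^+ n.-1)%:E)%E.
Proof.
move=> r0 q0.
pose c j : R := if j == i then 0 else q.1 0 j.
pose s j : R := if j == i then r else 2 * q.2.
have s0 j : 0 <= s j by rewrite /s; case: ifP => // _; rewrite mulr_ge0.
have -> : 2 * r * (4 * q.2) ^+ n.-1 =
    \prod_(j < n) ((\row_j (c j + s j)) 0 j - (\row_j (c j - s j)) 0 j : R).
  rewrite (bigD1 i)//= !mxE /c /s eqxx; congr (_ * _); first by ring.
  rewrite (eq_bigr (fun=> 4 * q.2)).
    by rewrite prodr_const; congr (_ ^+ _); rewrite cardC1 card_ord.
  by move=> j ji; rewrite !mxE (negbTE ji); ring.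
apply: leb_outer_box => [j|y yc j]; rewrite !mxE; first by have := s0 j; lra.
have := yc j; rewrite -/(c j) -/(s j) ler_norml => /andP[? ?].
by apply/andP; split; lra.
Qed.

Definition cylinders i r (L : seq ('rV[R]_n * R)) : set 'rV[R]_n :=
  \big[setU/set0]_(q <- L) cylinder i r q.

Lemma measurable_cylinders i r L : measurable (cylinders i r L : set (LebRn R n)).
Proof.
rewrite /cylinders; elim: L => [|q L IH]; first by rewrite big_nil.
by rewrite big_cons; apply: measurableU => //; exact/closed_measurable_LebRn/closed_cylinder.
Qed.

Lemma lebn_cylinders i r (L : seq ('rV[R]_n * R)) : 0 <= r ->
  (forall q, q \in L -> 0 < q.2) ->
  (lebn (cylinders i r L) <= (2 * r * 4 ^+ n.-1 * \sum_(q <- L) q.2 ^+ n.-1)%:E)%E.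
Proof.
move=> r0; rewrite /cylinders; elim: L => [|q L IH] L0.
  by rewrite !big_nil mulr0 measure0.
rewrite !big_cons mulrDr EFinD.
have q0 : 0 <= q.2 by apply/ltW/L0/mem_head.
apply: (@le_trans _ _ (lebn (cylinder i r q) + lebn (\big[setU/set0]_(j <- L) cylinder i r j))%E).
  apply: measureU2; first exact/closed_measurable_LebRn/closed_cylinder.
  exact: measurable_cylinders.
apply: leeD; last by apply: IH => p pL; apply: L0; rewrite inE pL orbT.
by rewrite (le_trans (lebn_cylinder i r0 q0))// exprMn mulrA.
Qed.

Lemma cylinder_support i r (L : seq ('rV[R]_n * R)) y :
  (forall q, q \in L -> 0 < q.2) -> `|y| <= r -> union_cutoff (predC1 i) L y != 0 ->
  cylinders i r L y.
Proof.
move=> L0 yr; apply: contraNP; rewrite /cylinders => h; apply/eqP.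
apply: union_cutoff0 => q qL; apply: contrapT => cq; apply: h.
elim: L qL L0 => [//|p L IH]; rewrite inE big_cons => /predU1P[<-|qL] L0; last first.
  by right; apply: IH => // s sL; apply: L0; rewrite inE sL orbT.
left=> j; case: eqVneq => [->|ji]; first by rewrite subr0 (le_trans (coord_le_norm _ _)).
rewrite leNgt; apply/negP => /ltW hj; apply: cq.
exact: (cutoff0 (L0 _ (mem_head _ _)) _ hj).
Qed.

(* The kernel [|y - x|^-b] is uniformly integrable, with the optimal decay in [x]. *)
Lemma kernel_small_set (b r tau : R) : 0 < b < n%:R -> 1 <= r -> 0 < tau ->
  exists2 eps : R, 0 < eps & forall S x, measurable (S : set (LebRn R n)) ->
  S `<=` cube 0 r -> (lebn S <= eps%:E)%E ->
  exists G : LebRn R n -> \bar R, [/\ measurable_fun setT G, forall y, (0 <= G y)%E,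
    forall y, y != x -> ((\1_S y * `|y - x| `^ (- b))%:E <= G y)%E &
    (\int[mu]_y G y <= (tau * weight 0 b x)%:E)%E].
Proof.
move=> /andP[b0 bn] r1 tau0.
pose w := weight b (n%:R + 1) : 'rV[R]_n -> R.
have w0 z : 0 <= w z by exact: weight_ge0.
have mw : measurable_fun setT (w : LebRn R n -> R) by exact: measurable_weight.
have iw : (\int[mu]_z (w z)%:E < +oo)%E.
  by apply: integral_weight_lty; rewrite ?(ltW b0) ?bn// ltrDl.
have iw0 : (0 <= \int[mu]_z (w z)%:E)%E by apply: integral_ge0 => z _; rewrite lee_fin.
pose I := fine (\int[mu]_z (w z)%:E)%E.
have iwE : (\int[mu]_z (w z)%:E = I%:E)%E by rewrite fineK// ge0_fin_numE.
have I0 : 0 <= I by rewrite -lee_fin -iwE.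
have r0 : 0 < r := lt_le_trans ltr01 r1.
pose h0 := (2 * r) `^ (- b).
have h00 : 0 < h0 by rewrite powR_gt0// mulr_gt0.
(* [h0] bounds [weight 0 b] from below on the cube of radius [2 r]. With [rho^(n-b) = s], the part
   of the kernel within distance [rho] contributes at most [s * I], less than [tau * h0 / 2]. *)
pose s := tau * h0 / (2 * (I + 1)).
have I1 : 0 < I + 1 by rewrite ltr_wpDl.
have s0 : 0 < s by rewrite divr_gt0 ?mulr_gt0.
have nb0 : 0 < n%:R - b by rewrite subr_gt0.
pose rho := s `^ (n%:R - b)^-1.
have rho0 : 0 < rho by exact: powR_gt0.
have rhoE : rho `^ (n%:R - b) = s.
  by rewrite /rho -powRrM mulVf ?gt_eqF// powRr1// ltW.
(* Beyond distance [rho] the kernel is at most [rho^-b], so a set of measure [e1] contributes at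
   most the other half. *)
pose e1 := rho `^ b * (tau * h0 / 2).
have e10 : 0 < e1 by rewrite mulr_gt0 ?powR_gt0// divr_gt0// mulr_gt0.
pose e2 := tau / 2 `^ b.
have e20 : 0 < e2 by rewrite divr_gt0// powR_gt0.
exists (Num.min e1 e2); first by rewrite lt_min e10.
move=> S x mS Sr Seps.
have S1 : (lebn S <= e1%:E)%E.
  by apply: le_trans Seps _; rewrite lee_fin ge_min lexx.
have S2 : (lebn S <= e2%:E)%E.
  by apply: le_trans Seps _; rewrite lee_fin ge_min lexx orbT.
have mS1 : measurable_fun setT ((\1_S : _ -> R) : LebRn R n -> R) by exact: measurable_indic.
(* For [|x| > 2 r] one has [|y - x| >= |x|/2] on [S]; the kernel is at most [2^b |x|^-b] there, and
   [e2] cancels [2^b]. *)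
have [x2|x2] := leP `|x| (2 * r); last first.
  have xp : 0 < `|x| by rewrite (lt_trans _ x2)// mulr_gt0.
  have wx : weight 0 b x = `|x| `^ (- b).
    rewrite /weight ifF//; apply/negbTE; rewrite -ltNge (le_lt_trans _ x2)//.
    by rewrite (le_trans r1)// ler_peMl ?ler1n// ltW.
  pose K := 2 `^ b * `|x| `^ (- b).
  have K0 : 0 <= K by rewrite mulr_ge0 ?powR_ge0.
  exists (fun y => (K * \1_S y)%:E); split.
  - by apply/measurable_EFinP; apply: measurable_funM => //; exact: measurable_cst.
  - by move=> y; rewrite lee_fin mulr_ge0.
  - move=> y yx; rewrite lee_fin indicE; case: (boolP (y \in S)) => yS; last by rewrite mul0r mulr0.
    rewrite mul1r mulr1 /K; move: yS; rewrite inE => /Sr; rewrite /cube/= subr0 => yr.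
    have x20 : 0 < `|x| / 2 by rewrite divr_gt0.
    have xz : `|x| / 2 <= `|y - x|.
      have := ler_normB y (y - x); rewrite opprB addrC subrK => h.
      by clear -h yr x2; lra.
    apply: le_trans (le_powRN x20 xz (ltW b0)) _.
    rewrite powRM ?invr_ge0// mulrC -[X in X `^ (- b) * _]powR_inv1// -powRrM.
    by rewrite mulrNN mul1r.
  rewrite ge0_integral_scale_indic//.
  apply: (@le_trans _ _ (K%:E * e2%:E)%E); first by rewrite lee_wpmul2l// lee_fin.
  rewrite -EFinM lee_fin wx /K /e2 le_eqVlt; apply/orP; left; apply/eqP.
  have : 2 `^ b != 0 :> R by rewrite gt_eqF// powR_gt0.
  by clear; move: (2 `^ b) (`|x| `^ (- b)) => u v u0; field.
have wx : h0 <= weight 0 b x.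
  rewrite /weight; case: ifPn => x1.
    rewrite oppr0 powRr0 /h0 powRN invf_le1 ?powR_gt0 ?mulr_gt0//.
    have r21 : 1 <= 2 * r by clear -r1; lra.
    by rewrite -[X in X <= _](powRr0 (2 * r)) ler_powR// (ltW b0).
  by apply: le_powRN; rewrite ?(ltW b0)// (lt_trans ltr01)// ltNge.
have rb0 : 0 <= rho `^ (- b) by exact: powR_ge0.
pose v y := w (rho^-1 *: (y - x)).
have mv : measurable_fun setT (v : LebRn R n -> R).
  by apply: measurable_scale => //; rewrite gt_eqF.
exists (fun y => (rho `^ (- b) * (1 * v y + \1_S y))%:E); split.
- apply/measurable_EFinP; apply: measurable_funM; first exact: measurable_cst.
  by apply: measurable_funD; [apply: measurable_funM; [exact: measurable_cst|exact: mv]|exact: mS1].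
- by move=> y; rewrite lee_fin mulr_ge0// addr_ge0// mul1r w0.
- move=> y yx; rewrite lee_fin mul1r.
  have z0 : 0 < `|y - x| by rewrite normr_gt0 subr_eq0.
  have [zr|zr] := leP `|y - x| rho.
    have vE : rho `^ (- b) * v y = `|y - x| `^ (- b).
      rewrite /v /w /weight normrZ ger0_norm ?invr_ge0 ?(ltW rho0)//.
      rewrite ler_pdivrMl// mulr1 zr -powRM ?(ltW rho0) ?mulr_ge0 ?invr_ge0 ?(ltW rho0)//.
      by rewrite mulrA divff ?gt_eqF// mul1r.
    rewrite mulrDr vE (@le_trans _ _ (`|y - x| `^ (- b)))//.
      by rewrite ler_piMl ?powR_ge0// indicE; case: (_ \in _).
    by rewrite lerDl mulr_ge0.
  rewrite mulrDr (@le_trans _ _ (rho `^ (- b) * \1_S y))//.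
    by rewrite mulrC ler_wpM2r// le_powRN// ltW.
  by rewrite lerDr mulr_ge0// w0.
rewrite ge0_integral_comb//; last by move=> y; exact: w0.
rewrite mul1e integral_scale// iwE integral_indic// setIT.
apply: (@le_trans _ _ ((rho `^ (- b))%:E * ((rho ^+ n * I)%:E + e1%:E))%E).
  by rewrite lee_wpmul2l ?lee_fin// -EFinM leeD2l.
rewrite -EFinD -EFinM lee_fin mulrDr.
have -> : rho `^ (- b) * (rho ^+ n * I) = s * I.
  rewrite mulrA -(powR_mulrn _ (ltW rho0)) -powRD ?(gt_eqF rho0) ?implybT//.
  by rewrite addrC rhoE.
have -> : rho `^ (- b) * e1 = tau * h0 / 2.
  by rewrite /e1 mulrA powRN mulVf ?mul1r// gt_eqF// powR_gt0.
apply: (@le_trans _ _ (tau * h0)); last by rewrite ler_pM2l.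
rewrite [leRHS](_ : _ = s * (I + 1) + tau * h0 / 2); last first.
  by rewrite /s; field; rewrite gt_eqF.
by rewrite lerD2r ler_pM2l// lerDl.
Qed.

(** With [b = n - 1 + alpha], the power [enorm^-(n+alpha+1)] is the power [-(b/2) - 1] of the
    squared norm, the limit of [dkern b d] as [d] tends to 0. *)
Lemma frac_div_scalar (alpha : R) (F : 'rV[R]_n -> R) i x : 0 < alpha ->
  frac_div alpha (fun y => F y *: delta_mx 0 i) x = mu_const n alpha *
   Rintegral mu setT ((fun y => (F y - F x) * ((y - x) 0 i *
       dotRn (y - x) (y - x) `^ (- ((n%:R - 1 + alpha) / 2) - 1))) : LebRn R n -> R).
Proof.
move=> al0; rewrite /frac_div; congr (_ * _); apply: eq_Rintegral => y _.
rewrite -scalerBl dotRn_delta [RHS]mulrA (mulrC (F y - F x)); congr (_ * _).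
by rewrite -powRN /enorm -powR12_sqrt ?dotRn_ge0// -powRrM; congr powR; field.
Qed.

(* The second cutoff is invariant along the [i]-th axis, so the [i]-th derivative
   of the product is bounded independently of [K], while its support lies in a
   union of cylinders of small volume. *)
Lemma cylindrical_frac_div_small (alpha : R) (th : 'rV[R]_n -> R) i (L r tau : R) :
  (0 < n)%N -> 0 < alpha < 1 -> (forall k, Ck k th) ->
  (forall u v, `|th u - th v| <= L * `|u - v|) -> 0 <= L ->
  (forall u, 0 <= th u <= 1) -> 0 <= r -> (forall u, r < `|u| -> th u = 0) ->
  0 < tau ->
  exists2 eps : R, 0 < eps & forall K : seq ('rV[R]_n * R),
    (forall q, q \in K -> 0 < q.2) -> \sum_(q <- K) q.2 ^+ n.-1 <= eps ->
    forall x, `|frac_div alpha (fun y => (th y * union_cutoff (predC1 i) K y) *: delta_mx 0 i) x|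
      <= tau * weight 0 (n%:R - 1 + alpha) x.
Proof.
move=> n0 /andP[al0 al1] Cth thL L0 th01 r0 th0 tau0.
have prodB (a b c d : R) : a * c - b * d = (a - b) * c + b * (c - d) by ring.
have n1 : 1 <= n%:R :> R by rewrite ler1n.
pose b := n%:R - 1 + alpha; have b0 : 0 < b by rewrite /b; lra.
have bn : b < n%:R by rewrite /b; lra.
have nb : n%:R < b + 1 by rewrite /b; lra.
(* The factor by which the estimate of the potential is multiplied is [c - 1]; dividing [tau] by
   [c], which is positive, absorbs it. *)
pose c := `|mu_const n alpha| * (L + 1) / b + 1.
have L1 : 0 < L + 1 by rewrite ltr_wpDl.
have c0 : 0 < c by rewrite ltr_wpDl// divr_ge0 ?(ltW b0)// mulr_ge0// ltW.
have r11 : 1 <= r + 1 by rewrite lerDr.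
have bb : 0 < b < n%:R by rewrite b0.
have [eps eps0 heps] := kernel_small_set bb (r := r + 1) r11 (divr_gt0 tau0 c0).
(* The constant in the volume of the cylinders cut at [r + 1], the radius beyond which the
   derivative of [th] is known to vanish. *)
pose m := 2 * (r + 1) * 4 ^+ n.-1.
have m0 : 0 < m by rewrite !mulr_gt0 ?exprn_gt0// ltr_wpDl.
exists (eps / m); first exact: divr_gt0.
move=> K K0 Ksum x; pose chi := union_cutoff (predC1 i) K.
pose S := cylinders i (r + 1) K `&` cube 0 (r + 1).
have mS : measurable (S : set (LebRn R n)).
  by apply: measurableI; [exact: measurable_cylinders|exact: measurable_cube].
have Sle : (lebn S <= eps%:E)%E.
  apply: le_trans (le_outer_measure (@leb_outer R n) _ _ (@subIsetl _ _ _)) _.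
  apply: le_trans (lebn_cylinders i _ K0) _; first by rewrite ltW// ltr_wpDl.
  by rewrite lee_fin -/m mulrC -ler_pdivlMr.
have [G [mG G0 SG iG]] := heps S x mS (@subIsetr _ _ _) Sle.
have [Lc Lc0 chiL] := union_cutoff_lipschitz (predC1 i) K0.
have chi01 u := union_cutoff_unit (predC1 i) K u.
have Cchi k : Ck k chi by exact: Ck_union_cutoff.
pose F y := th y * chi y.
have CF : Ck 1 F by apply: CkM.
have FL u v : `|F u - F v| <= (L + Lc) * `|u - v|.
  rewrite /F prodB.
  have /andP[? ?] := chi01 u; have /andP[? ?] := th01 v.
  rewrite [leRHS]mulrDl; apply: le_trans (ler_normD _ _) _; apply: lerD; rewrite normrM.
    by rewrite (le_trans _ (thL u v))// ler_piMr// ger0_norm.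
  by rewrite (le_trans _ (chiL u v))// ler_piMl// ger0_norm.
have FM u : `|F u| <= 1.
  have /andP[? ?] := chi01 u; have /andP[? ?] := th01 u.
  by rewrite normrM !ger0_norm// mulr_ile1.
have F0 u : r < `|u| -> F u = 0 by move=> /th0; rewrite /F => ->; rewrite mul0r.
pose e : 'rV[R]_n := delta_mx 0 i.
have dth y : derivable th y e by apply: diff_derivable; exact: (Ck_differentiable y (Cth 0%N)).
have dchi y : derivable chi y e by apply: diff_derivable; exact: (Ck_differentiable y (Cchi 0%N)).
have DF y : 'D_e F y = chi y * 'D_e th y.
  rewrite (_ : F = th * chi)// deriveM//.
  rewrite (derive_invariant (dchi y)); last by move=> h; exact: union_cutoff_invariant.
  by rewrite -![_ *: _]/(_ * _) mulr0 add0r.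
have DS y : `|'D_e F y| <= L * \1_S y.
  rewrite DF normrM indicE; have [yr|yr] := leP `|y| (r + 1); last first.
    rewrite (derive_outside_cube (norm_delta_le1 i) th0 (dth y) yr) normr0 mulr0 mulr_ge0//.
  have [->|ny] := eqVneq (chi y) 0; first by rewrite normr0 mul0r mulr_ge0.
  rewrite mem_set; last first.
    split; last by rewrite /cube/= subr0.
    exact: cylinder_support.
  rewrite mulr1; have /andP[? ?] := chi01 y.
  rewrite -[leRHS]mul1r; apply: ler_pM => //; first by rewrite ger0_norm.
  exact: (derive_le_lipschitz thL L0 (dth y)).
rewrite frac_div_scalar// normrM -/F.
have key : `|Rintegral mu setT ((fun y => (F y - F x) * ((y - x) 0 i *
       dotRn (y - x) (y - x) `^ (- (b / 2) - 1))) : LebRn R n -> R)| <=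
    (L + 1) * (tau / c * weight 0 b x) / b.
  have LL0 : 0 <= L + Lc by exact: addr_ge0.
  have sil := @singular_integral_le R n x i F (L + Lc) 1 r CF FL LL0 FM r0 F0 b
    (fun y => (L + 1)%:E * G y)%E ((L + 1) * (tau / c * weight 0 b x)) b0 bn nb.
  apply: sil.
  - exact: measurable_funeM.
  - by move=> y; rewrite mule_ge0// lee_fin ltW.
  - move=> y yx; apply: (@le_trans _ _ ((L + 1)%:E * (\1_S y * `|y - x| `^ (- b))%:E)%E).
      rewrite -EFinM lee_fin mulrA ler_wpM2r ?powR_ge0// (le_trans (DS y))//.
      by rewrite ler_wpM2r// lerDl.
    by rewrite lee_wpmul2l ?lee_fin ?(ltW L1)//; exact: SG.
  rewrite ge0_integralZl_EFin//; last exact: ltW.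
  by rewrite EFinM lee_wpmul2l ?lee_fin ?(ltW L1).
apply: le_trans (ler_wpM2l (normr_ge0 _) key) _.
have -> : `|mu_const n alpha| * ((L + 1) * (tau / c * weight 0 b x) / b) =
   (c - 1) / c * (tau * weight 0 b x).
  rewrite {2}/c addrK; move: (gt_eqF b0) (gt_eqF c0); clear.
  by move: (weight _ _ _) => w /negbT ? /negbT ?; field; apply/andP.
rewrite ler_piMl ?mulr_ge0 ?weight_ge0 ?(ltW tau0)//.
by rewrite ler_pdivrMr// mul1r gerBl.
Qed.

Lemma cylindrical_pairing_small (alpha : R) (p : \bar R) (f th : 'rV[R]_n -> R) i (L r tau : R) :
  (0 < n)%N -> 0 < alpha < 1 -> (1 <= p)%E -> (p < (n%:R / (1 - alpha))%:E)%E ->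
  in_Lp p f -> (forall k, Ck k th) ->
  (forall u v, `|th u - th v| <= L * `|u - v|) -> 0 <= L ->
  (forall u, 0 <= th u <= 1) -> 0 <= r -> (forall u, r < `|u| -> th u = 0) ->
  0 < tau ->
  exists2 eps : R, 0 < eps & forall K : seq ('rV[R]_n * R),
    (forall q, q \in K -> 0 < q.2) -> \sum_(q <- K) q.2 ^+ n.-1 <= eps ->
    `|Rintegral mu setT ((fun x => f x * frac_div alpha
      (fun y => (th y * union_cutoff (predC1 i) K y) *: delta_mx 0 i) x) : LebRn R n -> R)| <= tau.
Proof.
move=> n0 al p1 pn fp Cth thL L0 th01 r0 th0 tau0.
have [G [mG G0 fG iG]] := subcritical_weight_majorant n0 al p1 pn fp.
have iG0 : (0 <= \int[mu]_x G x)%E by exact: integral_ge0.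
pose B := fine (\int[mu]_x G x)%E.
have iGE : (\int[mu]_x G x = B%:E)%E by rewrite fineK// ge0_fin_numE.
have B0 : 0 <= B by rewrite -lee_fin -iGE.
have B1 : 0 < B + 1 by rewrite ltr_wpDl.
have [eps eps0 heps] := cylindrical_frac_div_small i n0 al Cth thL L0 th01 r0 th0 (divr_gt0 tau0 B1).
exists eps => // K K0 Ks; have h := heps K K0 Ks.
pose a := tau / (B + 1); have a0 : 0 < a by exact: divr_gt0.
apply: (@normr_Rintegral_le _ _ _ mu _ (fun x => a%:E * G x)%E).
  move=> x; apply: (@le_trans _ _ (a%:E * (`|f x| * weight 0 (n%:R - 1 + alpha) x)%:E)%E).
    by rewrite -EFinM lee_fin normrM mulrCA ler_wpM2l//; exact: h.
  by rewrite lee_wpmul2l ?lee_fin ?(ltW a0)//; exact: fG.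
rewrite ge0_integralZl_EFin ?(ltW a0)// iGE -EFinM lee_fin /a mulrAC.
by rewrite ler_pdivrMr// ler_pM2l// lerDl.
Qed.

End CylindricalCutoffs.

(** * Positivity of the Hausdorff normalization *)

Section GammaPositivity.
Context {R : realType}.

(** [Gamma] is a real-valued integral, which would be 0 if the extended integral were infinite, so
    finiteness is proved along with positivity. Without it [omega] could be 0 and Hausdorff nullity
    would be void. *)
Lemma Gamma_gt0 (a : R) : 1 <= a -> 0 < Gamma a.
Proof.
move=> a1; rewrite /Gamma /Rintegral.
pose g t : R := t `^ (a - 1) * expR (- t).
have g0 t : 0 <= g t by rewrite mulr_ge0 ?powR_ge0 ?expR_ge0.
have mg : measurable_fun setT g.
  apply: measurable_funM; first exact: measurable_powR.
  by apply: measurableT_comp => //; exact: measurable_funN.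
have [C C0 hC] : exists2 C : R, 0 <= C & forall t, 0 < t -> g t <= C * exponential_pdf 2^-1 t.
  pose m := (Num.trunc (a - 1)).+1.
  (* At [t/2] this polynomial is [1 + t^m], which dominates [t^(a-1)]. One factor [exp(-t/2)]
     absorbs it, the other is the exponential density of rate [1/2]. *)
  have [C C0 hC] := poly_expR_bounded (1 + (2 *: 'X) ^+ m : {poly R}).
  exists (2 * C); first exact: mulr_ge0.
  move=> t t0; rewrite exponential_pdfE ?(ltW t0)//.
  have s0 : 0 <= t / 2 by rewrite divr_ge0// ltW.
  have tm : t `^ (a - 1) <= 1 + t ^+ m.
    have am : a - 1 <= m%:R by rewrite ltW// truncnS_gt.
    have [t1|t1] := leP t 1.
      apply: (@le_trans _ _ 1); last by rewrite lerDl exprn_ge0// ltW.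
      rewrite [leRHS](_ : _ = 1 `^ (a - 1)); last by rewrite powR1.
      by apply: ge0_ler_powR; rewrite ?nnegrE ?subr_ge0// ltW.
    rewrite -powR_mulrn ?(ltW t0)// (le_trans (ler_powR (ltW t1) am))//.
    by rewrite lerDr.
  have := hC _ s0.
  rewrite hornerD hornerC horner_exp hornerZ hornerX [2 * (t / 2)]mulrC divfK//.
  move/(le_trans (ler_norm _)) => h.
  rewrite /g; have -> : expR (- t) = expR (- (t / 2)) * expR (- (t / 2)).
    by rewrite -expRD; congr expR; field.
  rewrite [- 2^-1 * t]mulNr [2^-1 * t]mulrC.
  have -> : 2 * C * (2^-1 * expR (- (t / 2))) = C * expR (- (t / 2)) by field.
  rewrite mulrA ler_wpM2r ?expR_ge0// (le_trans _ h)// ler_wpM2r ?expR_ge0//.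
have fin : (\int[lebesgue_measure]_(t in [set t : R | (0 < t)%R]) (g t)%:E < +oo)%E.
  apply: (@le_lt_trans _ _ (\int[lebesgue_measure]_t (C%:E * (exponential_pdf 2^-1 t)%:E)%E)%E).
    apply: (@le_trans _ _ (\int[lebesgue_measure]_(t in [set t : R | (0 < t)%R]) (C * exponential_pdf 2^-1 t)%:E)%E).
      apply: ge0_le_integral => //=.
      - by rewrite -set_itv_o_infty.
      - by move=> t _; rewrite lee_fin.
      - by apply/measurable_EFinP; exact: measurable_funTS.
      - by apply/measurable_EFinP/measurable_funTS/measurable_funM => //; exact: measurable_exponential_pdf.
    apply: ge0_subset_integral => //.
    - by rewrite -set_itv_o_infty.
    - by apply/measurable_EFinP/measurable_funM => //; exact: measurable_exponential_pdf.
    - by move=> t _; rewrite lee_fin mulr_ge0// exponential_pdf_ge0.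
  rewrite ge0_integralZl_EFin//; last 2 first.
    by move=> t _; rewrite lee_fin exponential_pdf_ge0.
    by apply/measurable_EFinP; exact: measurable_exponential_pdf.
  by rewrite integral_exponential_pdf ?mule1 ?ltry.
apply: fine_gt0; rewrite [X in _ && X]fin andbT.
have m12 : measurable (`[1, 2]%classic : set R) by exact: measurable_itv.
apply: (@lt_le_trans _ _ (\int[lebesgue_measure]_(t in `[1%R, 2%R]) (cst (expR (- 2))%:E t))%E).
  rewrite integral_cst//= lebesgue_measure_itv/= lte_fin ltr1n/= -EFinD -EFinM lte_fin.
  by rewrite mulr_gt0 ?expR_gt0//; lra.
apply: (@le_trans _ _ (\int[lebesgue_measure]_(t in `[1%R, 2%R]) (g t)%:E)%E).
  apply: ge0_le_integral => //=.
  - by apply/measurable_EFinP; exact: measurable_funTS.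
  - move=> t; rewrite in_itv/= => /andP[t1 t2]; rewrite lee_fin -[leLHS]mul1r.
    apply: ler_pM; rewrite ?expR_ge0// ?ler_expR ?lerN2//.
    by rewrite -[X in X <= _](powRr0 t) ler_powR// subr_ge0.
apply: ge0_subset_integral => //.
- by rewrite -set_itv_o_infty.
- by apply/measurable_EFinP; exact: measurable_funTS.
- by move=> t _; rewrite lee_fin.
- by move=> t /=; rewrite in_itv/= => /andP[t1 _]; exact: lt_le_trans t1.
Qed.

Lemma omega_gt0 (s : R) : 0 <= s -> 0 < omega s.
Proof.
move=> s0; rewrite /omega divr_gt0 ?powR_gt0 ?pi_gt0// Gamma_gt0//.
by rewrite lerDr divr_ge0.
Qed.
End GammaPositivity.

(** * Finite covers of Hausdorff-null compact sets *)

Section HausdorffCovers.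
Context {R : realType} {n : nat}.
Implicit Types (A K : set 'rV[R]_n).

Lemma diam_ge0 A : (A !=set0 -> 0 <= diam A)%E.
Proof.
move=> [x Ax]; apply: le_trans (ereal_sup_ubound _); last by exists (x, x).
by rewrite lee_fin enorm_ge0.
Qed.

Lemma enorm_le_diam A x y : A x -> A y -> ((enorm (x - y))%:E <= diam A)%E.
Proof. by move=> Ax Ay; apply: ereal_sup_ubound; exists (x, y). Qed.

Lemma haus_term_ge0 (s : R) A : 0 <= s -> (0 <= haus_term s A)%E.
Proof.
move=> s0; rewrite /haus_term; case: ifP => // _.
by rewrite lee_fin mulr_ge0 ?powR_ge0// ltW// omega_gt0.
Qed.

Lemma haus_delta_ge0 (s d : R) A : 0 <= s -> (0 <= haus_delta s d A)%E.
Proof.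
move=> s0; apply: le_ereal_inf_tmp => _ [E _ <-].
by apply: nneseries_ge0 => k _ _; exact: haus_term_ge0.
Qed.

Lemma haus_null_subset (s : R) A B : 0 <= s -> A `<=` B -> hausdorff s B = 0%E ->
  hausdorff s A = 0%E.
Proof.
move=> s0 AB B0; apply/eqP; rewrite eq_le; apply/andP; split.
  rewrite -B0; apply: ge_ereal_sup => _ [d /= d0 <-].
  apply: (@le_trans _ _ (haus_delta s d B)); last by apply: ereal_sup_ubound; exists d.
  by apply: le_ereal_inf => _ [E [BE dE] <-]; exists E => //; split=> //; exact: subset_trans BE.
apply: le_trans (ereal_sup_ubound _); last by exists 1 => //=; exact: ltr01.
exact: haus_delta_ge0.
Qed.

Lemma haus_null_cover (s d e : R) A : 0 <= s -> hausdorff s A = 0%E -> 0 < d -> 0 < e ->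
  exists E : nat -> set 'rV[R]_n, [/\ A `<=` \bigcup_k E k,
    forall k, (diam (E k) <= d%:E)%E & (\sum_(k <oo) haus_term s (E k) < e%:E)%E].
Proof.
move=> s0 A0 d0 e0.
have : (haus_delta s d A < e%:E)%E.
  apply: (@le_lt_trans _ _ 0%E); last by rewrite lte_fin.
  by rewrite -A0; apply: ereal_sup_ubound; exists d.
move=> /ereal_inf_lt[_ [E [AE dE] <-] h]; by exists E; split.
Qed.

Lemma norm_sub_le_diam A (d : R) x y : (diam A <= d%:E)%E -> A x -> A y ->
  `|x - y| <= fine (diam A).
Proof.
move=> Ad Ax Ay; apply: le_trans (norm_le_enorm _) _.
have A0 : (0 <= diam A)%E by apply: diam_ge0; exists x.
rewrite -lee_fin fineK; first exact: enorm_le_diam.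
by rewrite ge0_fin_numE// (le_lt_trans Ad)// ltry.
Qed.

(** In dimension 0 every nonempty piece costs [omega 0], even a single point, since [0^0 = 1]. *)
Lemma haus_null_dim0 K : hausdorff 0 K = 0%E -> K = set0.
Proof.
move=> K0; apply/seteqP; split=> // x Kx.
have w0 : 0 < @omega R 0 by exact: omega_gt0.
have [E [KE _]] := haus_null_cover (lexx 0) K0 ltr01 w0.
have [k _ Ek] := KE x Kx.
have t0 j : (0 <= haus_term 0 (E j))%E by exact: haus_term_ge0.
rewrite ltNge => /negP; apply; apply: le_trans (nneseries_ge_term k t0).
rewrite /haus_term asboolF ?powRr0 ?mulr1//.
by move=> E0; move: Ek; rewrite E0.
Qed.

(** Pieces of a Hausdorff cover that meet [K] are replaced by balls centred on [K], and compactness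
    leaves finitely many. For [s = 0] the set is empty, because positive radii could not have a
    small sum of zeroth powers. *)
Lemma compact_small_cover (s d e : R) K : 0 <= s -> compact K -> hausdorff s K = 0%E ->
  0 < d -> 0 < e ->
  exists L : seq ('rV[R]_n * R), [/\ forall q, q \in L -> K q.1 /\ 0 < q.2 <= d,
    \sum_(q <- L) q.2 `^ s <= e & forall x, K x -> exists2 q, q \in L & `|x - q.1| <= q.2].
Proof.
rewrite le_eqVlt => /predU1P[<-|s0] cK K0 d0 e0.
  exists [::]; split=> //; first by rewrite big_nil ltW.
  by move=> x; rewrite (haus_null_dim0 K0).
have w0 : 0 < omega s by rewrite omega_gt0// ltW.
(* Chosen so that [u] times the Hausdorff term of a piece of diameter [D] is [(2 D)^s]. *)
pose u : R := 4 `^ s / omega s.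
have u0 : 0 < u by rewrite divr_gt0 ?powR_gt0.
have d20 : 0 < d / 2 by exact: divr_gt0.
have e20 : 0 < e / 2 by exact: divr_gt0.
have [E [KE Ed Es]] := haus_null_cover (ltW s0) K0 d20 (divr_gt0 e20 u0).
pose D k := fine (diam (E k)).
(* [rho] provides positive radii for the pieces of diameter [0]. *)
pose rho k : R := Num.min d ((e / 2 / (2 ^ k.+1)%:R) `^ s^-1).
have ek k : 0 < e / 2 / (2 ^ k.+1)%:R by rewrite divr_gt0.
have rho0 k : 0 < rho k by rewrite lt_min d0 powR_gt0.
have rhos k : rho k `^ s <= e / 2 / (2 ^ k.+1)%:R.
  apply: (@le_trans _ _ (((e / 2 / (2 ^ k.+1)%:R) `^ s^-1) `^ s)).
    by rewrite ge0_ler_powR ?(ltW s0)// ?nnegrE ?powR_ge0 ?(ltW (rho0 k))// ge_min lexx orbT.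
  by rewrite -powRrM mulVf ?gt_eqF// powRr1// ltW.
(* Twice the diameter puts the piece strictly inside the open ball when [D k > 0]. *)
pose r k := Num.max (2 * D k) (rho k).
have r0 k : 0 < r k by rewrite lt_max rho0 orbT.
pose J := [set k | E k `&` K !=set0].
have /choice[c hc] : forall k, exists c, J k -> E k c /\ K c.
  move=> k; case: (pselect (J k)) => [[c cE]|nJ]; first by exists c.
  by exists 0.
have D0 k : J k -> 0 <= D k by move=> /hc[Ec _]; rewrite fine_ge0// diam_ge0//; exists (c k).
have Dd k : J k -> D k <= d / 2.
  move=> /hc[Ec _]; have A0 : (0 <= diam (E k))%E by apply: diam_ge0; exists (c k).
  by rewrite -lee_fin fineK// ge0_fin_numE// (le_lt_trans (Ed k))// ltry.
have rs k : J k -> ((r k `^ s)%:E <= u%:E * haus_term s (E k) + (e / 2 / (2 ^ k.+1)%:R)%:E)%E.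
  move=> Jk; have := D0 k Jk; have [Ec _] := hc k Jk.
  rewrite /haus_term asboolF; last by move=> E0; move: Ec; rewrite E0.
  rewrite -/(D k) -EFinM -EFinD lee_fin => Dk0.
  have -> : u * (omega s * (D k / 2) `^ s) = (2 * D k) `^ s.
    by rewrite /u mulrA divfK ?gt_eqF// -powRM ?divr_ge0//; congr (_ `^ s); field.
  rewrite /r; case: (leP (2 * D k)) => _; last by rewrite lerDl ltW.
  by rewrite (le_trans (rhos k))// lerDr powR_ge0.
have : cover_compact K by rewrite -compact_cover.
move=> /(_ nat J (fun k => ball (c k) (r k)))[||F FJ KF].
- by move=> k _; exact: ball_open.
- move=> x Kx; have [k _ Ek] := KE x Kx; have Jk : J k by exists x.
  exists k => //; rewrite -ball_normE/= /r lt_max.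
  have [Ec _] := hc k Jk.
  have cx : `|c k - x| <= D k by exact: norm_sub_le_diam (Ed k) Ec Ek.
  have := D0 k Jk; rewrite le_eqVlt => /predU1P[D00|Dp].
    by apply/orP; right; rewrite (le_lt_trans cx)// -D00.
  by rewrite (le_lt_trans cx)// ltr_pMl// ltr1n.
(* All indices of [J] below [N] are kept, not only the finite subcover, so that the sum is a partial
   sum of the series. *)
pose N := (\max_(k <- finmap.enum_fset F) k).+1.
exists [seq (c k, r k) | k <- iota 0 N & k \in J]; split.
- move=> q /mapP[k]; rewrite mem_filter => /andP[/set_mem Jk _] ->/=.
  have [_ Kc] := hc k Jk; split=> //; rewrite r0/= /r ge_max ge_min lexx andbT.
  by have := Dd k Jk; clear; move: (D k) => t; lra.
- rewrite big_map big_filter -lee_fin -sumEFin.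
  apply: (@le_trans _ _ (\sum_(0 <= k < N) (u%:E * haus_term s (E k) + (e / 2 / (2 ^ k.+1)%:R)%:E))%E).
    rewrite /index_iota subn0 big_mkcond/=; apply: lee_sum => k _.
    case: ifPn => [|_]; first by rewrite inE => /rs.
    by rewrite adde_ge0 ?mule_ge0 ?haus_term_ge0 ?lee_fin ?(ltW u0) ?(ltW s0)// ltW.
  apply: le_trans (nneseries_lim_ge _ _) _.
    by move=> k _ _; rewrite adde_ge0 ?mule_ge0 ?haus_term_ge0 ?lee_fin ?(ltW u0) ?(ltW s0)// ltW.
  rewrite nneseriesD; last 2 first.
    by move=> k _ _; rewrite mule_ge0 ?haus_term_ge0 ?lee_fin ?(ltW u0) ?(ltW s0).
    by move=> k _ _; rewrite lee_fin ltW.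
  rewrite nneseriesZl; last by move=> k _; rewrite haus_term_ge0// ltW.
  have -> : e%:E = ((e / 2)%:E + (e / 2)%:E)%E by rewrite -EFinD -splitr.
  apply: leeD; last by apply: epsilon_trick0; exact: ltW.
  by rewrite -lee_pdivlMl// -EFinM mulrC ltW.
- move=> x /KF[k kF]; rewrite -ball_normE => h.
  exists (c k, r k); last by rewrite distrC ltW.
  apply: (map_f (fun k => (c k, r k))); rewrite mem_filter mem_iota add0n leq0n (FJ k kF) !andTb.
  by rewrite ltnS; exact: leq_bigmax_seq.
Qed.

End HausdorffCovers.

(** * Inner regularity of finite Borel measures *)

Section Regularity.
Context {R : realType} {n : nat}.
Implicit Types (A F U K : set 'rV[R]_n).
Local Notation Borel := (BorelRn R n).

Lemma open_measurable_Borel U : open U -> measurable (U : set Borel).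
Proof. exact: sub_sigma_algebra. Qed.

Lemma closed_measurable_Borel F : closed F -> measurable (F : set Borel).
Proof.
by move=> cF; rewrite -[F]setCK; apply: measurableC; apply: open_measurable_Borel; exact: closed_openC.
Qed.

Variable mu : {finite_measure set Borel -> \bar R}.

Let mufin (A : set Borel) : measurable A -> (mu A < +oo)%E.
Proof. by move=> mA; rewrite ltey_eq fin_num_measure. Qed.

Let nonincreasing_small (E : nat -> set Borel) (e : R) : 0 < e ->
  (forall k, measurable (E k)) -> {homo E : n m / (n <= m)%N >-> (m <= n)%O} ->
  \bigcap_k E k = set0 -> exists k, (mu (E k) <= e%:E)%E.
Proof.
move=> e0 mE hE E0.
have h := nonincreasing_cvg_mu (mufin (mE 0%N)) mE (bigcapT_measurable mE) hE.
rewrite E0 measure0 in h.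
have [N _ hN] : ((mu \o E) @ \oo) [set z | (z < e%:E)%E].
  by apply: h; apply: open_ereal_lt'; rewrite lte_fin.
by exists N; apply: ltW; exact: (hN N (leqnn N)).
Qed.

(** Sandwiching between a closed and an open set is symmetric under complements, which approximation
    from inside alone is not; this makes an induction over Borel sets possible. *)
Let approx (A : set Borel) := forall e : R, 0 < e -> exists F U : set Borel,
  [/\ closed (F : set 'rV[R]_n), open (U : set 'rV[R]_n), F `<=` A, A `<=` U &
      (mu (U `\` F) <= e%:E)%E].

Let approx_open U : open U -> approx U.
Proof.
move=> oU e e0.
(* Points at distance at least [1/(k+1)] from the complement: closed sets that exhaust [U]. *)
pose F k : set Borel := [set x : 'rV[R]_n | forall y, ~ U y -> k.+1%:R^-1 <= `|x - y|].
have cF k : closed (F k : set 'rV[R]_n).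
  rewrite (_ : F k = \bigcap_(y in ~` U) ((fun x : 'rV[R]_n => `|x - y|) @^-1`
     [set t : R | k.+1%:R^-1 <= t])).
    apply: closed_bigI => y _; apply: closed_comp; last exact: closed_ge.
    move=> x _; apply: (@continuous_comp _ _ _ (fun x : 'rV[R]_n => x - y));
      last exact: norm_continuous.
    by apply: (@continuousB _ _ _ id (fun=> y)); [exact: cvg_id|exact: cst_continuous].
  by apply/seteqP; split=> x.
have FU k : F k `<=` U.
  move=> x Fx; apply: contrapT => /Fx; rewrite subrr normr0 => h.
  by move: h; rewrite invr_le0 leNgt ltr0n.
have [//| |j k jk||k hk] := @nonincreasing_small (fun k => U `\` F k) e.
- move=> k; apply: measurableD; first exact: open_measurable_Borel.
  exact: closed_measurable_Borel.
- apply/subsetPset => x [Ux nF]; split=> // Fj; apply: nF => y /Fj.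
  by apply: le_trans; rewrite lef_pV2 ?posrE// ler_nat.
- apply/seteqP; split=> // x h; have Ux : U x by have [] := h 0%N I.
  have /nbhs_ballP[r /= r0 hr] : nbhs x U by apply: open_nbhs_nbhs.
  have [k kr] : exists k, k.+1%:R^-1 <= r.
    exists (Num.trunc r^-1); rewrite -[leRHS]invrK lef_pV2 ?posrE ?invr_gt0//.
    by rewrite ltW// truncnS_gt.
  have [_] := h k I; apply => y nU; rewrite leNgt; apply/negP => xy; apply: nU.
  by apply: hr; rewrite -ball_normE/=; exact: lt_le_trans xy kr.
by exists (F k), U; split.
Qed.

Let approxC (A : set Borel) : approx A -> approx (~` A).
Proof.
move=> hA e e0; have [F [U [cF oU FA AU le]]] := hA e e0.
exists (~` U), (~` F); split.
- exact: open_closedC.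
- exact: closed_openC.
- exact: subsetC.
- exact: subsetC.
by rewrite setDE setCK setIC -setDE.
Qed.

(** A countable union of closed sets need not be closed, so half of the error pays for truncating it
    to a finite union. *)
Let approx_bigcup (A : nat -> set Borel) : (forall k, approx (A k)) -> approx (\bigcup_k A k).
Proof.
move=> hA e e0.
have e20 : 0 < e / 2 by rewrite divr_gt0.
have /choice[FU hFU] : forall k, exists FU : set Borel * set Borel,
    [/\ closed (FU.1 : set 'rV[R]_n), open (FU.2 : set 'rV[R]_n), FU.1 `<=` A k, A k `<=` FU.2 &
      (mu (FU.2 `\` FU.1) <= (e / 2 / (2 ^ k.+1)%:R)%:E)%E].
  move=> k; have [|F [U h]] := hA k (e / 2 / (2 ^ k.+1)%:R); first by rewrite divr_gt0.
  by exists (F, U).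
pose F k := (FU k).1; pose U k := (FU k).2.
have mF k : measurable (F k) by apply: closed_measurable_Borel; have [] := hFU k.
have mU k : measurable (U k) by apply: open_measurable_Borel; have [] := hFU k.
pose G k : set Borel := \big[setU/set0]_(j < k) F j.
have mG k : measurable (G k) by apply: bigsetU_measurable.
have [//| |j k jk||k hk] := @nonincreasing_small (fun k => \bigcup_j F j `\` G k) (e / 2).
- by move=> k; apply: measurableD => //; exact: bigcupT_measurable.
- apply/subsetPset; apply: setDS.
  exact: (@subset_bigsetU _ F).
- apply/seteqP; split=> // x h; have [[j _ Fj] _] := h 0%N I.
  have [_] := h j.+1 I; apply; rewrite /G big_ord_recr/=; by right.
exists (G k), (\bigcup_j U j); split.
- rewrite /G; apply: closed_bigsetU => j _; by have [] := hFU j.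
- by apply: bigcup_open => j _; have [] := hFU j.
- rewrite /G => x /(@bigsetU_bigcup _ F)[j _ Fj]; exists j => //.
  by have [_ _ h _ _] := hFU j; exact: h.
- by apply: subset_bigcup => j _; have [] := hFU j.
apply: (@le_trans _ _ (mu (\bigcup_j (U j `\` F j)) + mu (\bigcup_j F j `\` G k))%E).
  apply: le_trans (measureU2 _ _ _).
  - apply: le_measure; rewrite ?inE.
    + by apply: measurableD => //; exact: bigcupT_measurable.
    + apply: measurableU; first by apply: bigcupT_measurable => j; exact: measurableD.
      by apply: measurableD => //; exact: bigcupT_measurable.
    + move=> x [[j _ Uj] nG]; case: (pselect (F j x)) => Fj; last by left; exists j.
      by right; split=> //; exists j.
  - by apply: bigcupT_measurable => j; exact: measurableD.
  - by apply: measurableD => //; exact: bigcupT_measurable.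
rewrite (splitr e) EFinD; apply: leeD => //.
apply: (@le_trans _ _ (\sum_(j <oo) mu (U j `\` F j))%E).
  by apply: measure_sigma_subadditive => // [j|]; [exact: measurableD|apply: bigcupT_measurable => j; exact: measurableD].
apply: (@le_trans _ _ (\sum_(j <oo) (e / 2 / (2 ^ j.+1)%:R)%:E)%E).
  by apply: lee_nneseries => // j _; have [] := hFU j.
by apply: epsilon_trick0; exact: ltW.
Qed.

(** The closed approximation is made compact by intersecting it with a large cube; finiteness of the
    measure makes the loss small. *)
Lemma borel_inner_regular (A : set Borel) (e : R) : measurable A -> 0 < e ->
  exists K : set Borel, [/\ compact (K : set 'rV[R]_n), K `<=` A & (mu (A `\` K) <= e%:E)%E].
Proof.
move=> mA e0; have e20 : 0 < e / 2 by rewrite divr_gt0.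
have [F [U [cF oU FA AU le]]] : exists F U : set Borel,
  [/\ closed (F : set 'rV[R]_n), open (U : set 'rV[R]_n), F `<=` A, A `<=` U &
      (mu (U `\` F) <= (e / 2)%:E)%E].
  have : approx A; last by apply.
  apply: (@dynkin_induction _ Borel (@open 'rV[R]_n) approx) => //.
  - by move=> B C; exact: openI.
  - exact: approx_open openT.
  - by move=> S _; exact: approxC.
  - by move=> S _ _; exact: approx_bigcup.
have mF := closed_measurable_Borel cF; have mU := open_measurable_Borel oU.
have mC k : measurable (cube 0 k%:R : set Borel).
  by apply: closed_measurable_Borel; exact: closed_cube.
have [//| |j k jk||k hk] := @nonincreasing_small (fun k => F `\` cube 0 k%:R) (e / 2).
- by move=> k; exact: measurableD.
- apply/subsetPset; apply: setDS => x; rewrite /cube/= => h; apply: le_trans h _.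
  by rewrite ler_nat.
- apply/seteqP; split=> // x h.
  have [_] := h (Num.trunc `|x|).+1 I; apply; rewrite /cube/= subr0.
  by rewrite ltW// truncnS_gt.
exists (F `&` cube 0 k%:R); split.
- rewrite setIC; apply: compact_closedI => //; exact: compact_cube.
- by move=> x [/FA].
apply: (@le_trans _ _ (mu (U `\` F) + mu (F `\` cube 0 k%:R))%E).
  apply: le_trans (measureU2 _ _ _).
  - apply: le_measure; rewrite ?inE.
    + by apply: measurableD => //; exact: measurableI.
    + by apply: measurableU; exact: measurableD.
    + move=> x [Ax nFC]; case: (pselect (F x)) => Fx; last by left; split => //; exact: AU.
      by right; split=> // c; apply: nFC.
  - exact: measurableD.
  - exact: measurableD.
by rewrite (splitr e) EFinD leeD.
Qed.

End Regularity.

(** The union of a compact set good for [P] and one good for [N] approximates [A] for both measures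
    at once. *)
Lemma eq_measure_on_compacts {R : realType} {n : nat}
    (P N : {finite_measure set BorelRn R n -> \bar R}) (A : set (BorelRn R n)) :
  measurable A ->
  (forall K : set (BorelRn R n), compact (K : set 'rV[R]_n) -> K `<=` A -> P K = N K) ->
  P A = N A.
Proof.
move=> mA h.
have fP := fin_num_measure P A mA; have fN := fin_num_measure N A mA.
apply/eqP; rewrite -(fineK fP) -(fineK fN) eqe; apply/eqP.
apply/eqP; rewrite -subr_eq0 -normr_le0; apply/ler_addgt0Pl => e e0; rewrite addr0.
have [K1 [c1 A1 e1]] := borel_inner_regular P mA e0.
have [K2 [c2 A2 e2]] := borel_inner_regular N mA e0.
have mc (K : set (BorelRn R n)) : compact (K : set 'rV[R]_n) -> measurable K.
  by move=> cK; apply: closed_measurable_Borel; apply: compact_closed => //; exact: (@norm_hausdorff R 'rV[R]_n).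
pose K := K1 `|` K2.
have cK : compact (K : set 'rV[R]_n) by exact: compactU.
have mK := mc _ cK.
have KA : K `<=` A by move=> x [/A1|/A2].
have small (m : {finite_measure set BorelRn R n -> \bar R}) K' : K' `<=` K -> measurable K' ->
    (m (A `\` K') <= e%:E)%E -> 0 <= fine (m A) - fine (m K) <= e.
  move=> K'K mK' le.
  have mAE : m A = (m (A `\` K) + m K)%E.
    have := measureDI m mA mK; by rewrite setIidr.
  have fK := fin_num_measure m K mK.
  have fD := fin_num_measure m (A `\` K) (measurableD mA mK).
  rewrite mAE fineD// addrK fine_ge0//= -lee_fin fineK//.
  apply: le_trans le; apply: le_measure; rewrite ?inE; [exact: measurableD|exact: measurableD|].
  exact: setDS.
have /andP[p0 p1] := small P K1 (@subsetUl _ _ _) (mc _ c1) e1.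
have /andP[q0 q1] := small N K2 (@subsetUr _ _ _) (mc _ c2) e2.
rewrite ler_norml; move: p0 p1 q0 q1; rewrite (h K cK KA).
by clear; move: (fine (P A)) (fine (N A)) (fine (N K)) => a b c; lra.
Qed.

(** * From small pairings to absolute continuity *)

Section GradientVanishing.
Context {R : realType} {n : nat}.
Implicit Types (K : set 'rV[R]_n) (F : 'rV[R]_n -> R).
Local Notation Borel := (BorelRn R n).
Local Notation mu := (@lebn R n).

Definition cutoff_of K (d : R) F := [/\ forall k, Ck k F, forall x, 0 <= F x <= 1,
  forall x, K x -> F x = 1 & forall x, (forall y, K y -> d < `|x - y|) -> F x = 0].

Lemma cutoff_of_support K (d : R) F : compact K -> cutoff_of K d F ->
  exists2 r : R, 0 <= r & forall x, r < `|x| -> F x = 0.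
Proof.
move=> cK [_ _ _ F0].
have [M [_ hM]] := compact_bounded cK.
pose r := Num.max 0 (M + 1).
have Kr y : K y -> `|y| <= r.
  move=> Ky; apply: (@le_trans _ _ (M + 1)); last by rewrite le_max lexx orbT.
  by apply: (hM (M + 1)) => //; rewrite ltrDl.
exists (r + Num.max 0 d); first by rewrite addr_ge0// le_max lexx.
move=> x xr; apply: F0 => y /Kr yr.
have := ler_normB x y; have : d <= Num.max 0 d by rewrite le_max lexx orbT.
have := lerB_normD x (- y); rewrite normrN.
by move: xr yr; clear; move: (Num.max 0 d) `|x| `|y| `|x - y| => a b c e; lra.
Qed.

Lemma test_field_cutoff K (d : R) F i : compact K -> cutoff_of K d F ->
  test_field (fun y => F y *: delta_mx 0 i).
Proof.
move=> cK FK; have [r r0 F0] := cutoff_of_support cK FK; have [CF _ _ _] := FK.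
split; first by apply: Ck_smooth => k; exact: Ck_scale.
apply: (@subclosed_compact _ _ (cube 0 r)); [exact: closed_closure|exact: compact_cube|].
rewrite [X in _ `<=` X](_ : cube 0 r = closure (cube 0 r)); last by apply/closure_id; exact: closed_cube.
apply: closureS => x /=; apply: contraNP; rewrite /cube/= subr0 => /negP; rewrite -ltNge => /F0 ->.
by rewrite scale0r.
Qed.

Lemma vintegral_coord (P N : 'I_n -> {finite_measure set Borel -> \bar R}) F i :
  vintegral P N (fun y => F y *: delta_mx 0 i) =
  Rintegral (P i) setT (F : Borel -> R) - Rintegral (N i) setT (F : Borel -> R).
Proof.
rewrite /vintegral (bigD1 i)//= [X in _ + X]big1 ?addr0.
  by congr (_ - _); apply: eq_Rintegral => x _; rewrite !mxE !eqxx mulr1.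
move=> j ji.
have E (m : {finite_measure set Borel -> \bar R}) :
    Rintegral m setT ((fun y => (F y *: delta_mx 0 i) 0 j) : Borel -> R) = 0.
  rewrite /Rintegral (eq_integral (cst 0%E)) ?integral0// => y _.
  by rewrite !mxE (negbTE ji) andbF mulr0.
by rewrite !E subrr.
Qed.

(** As [K] is closed, the cutoffs converge pointwise to its indicator; the constant 1 dominates them
    and is integrable since [m] is finite. *)
Lemma cutoff_integral_cvg K (m : {finite_measure set Borel -> \bar R}) (F : nat -> 'rV[R]_n -> R) :
  compact K -> (forall k, cutoff_of K k.+1%:R^-1 (F k)) ->
  (fun k => Rintegral m setT (F k : Borel -> R)) @ \oo --> fine (m (K : set Borel)).
Proof.
move=> cK FK.
have clK : closed K by apply: compact_closed => //; exact: (@norm_hausdorff R 'rV[R]_n).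
have mK : measurable (K : set Borel) by exact: closed_measurable_Borel.
have -> : fine (m (K : set Borel)) = Rintegral m setT (\1_(K : set Borel) : Borel -> R).
  by rewrite /Rintegral integral_indic// setIT.
apply: (@Rintegral_dominated_cvg _ _ _ m _ _ (fun=> 1%E)).
- move=> k; apply: continuous_measurable_BorelRn => x; apply: differentiable_continuous.
  by have [CF _ _ _] := FK k; exact: (Ck_differentiable x (CF 0%N)).
- exact: measurable_indic.
- exact: measurable_cst.
- move=> x; rewrite indicE; have [Kx|nKx] := pselect (K x).
    rewrite (mem_set (Kx : (K : set Borel) x)) (_ : (fun k => F k x) = cst 1); first exact: cvg_cst.
    by apply/funext => k; have [_ _ F1 _] := FK k; rewrite F1.
  rewrite (memNset (nKx : ~ (K : set Borel) x)).
  have /nbhs_ballP[r /= r0 hr] : nbhs x (~` K).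
    by apply: open_nbhs_nbhs; split=> //; exact: closed_openC.
  suff : (fun k => F k x) @ \oo --> (0 : R) by [].
  apply: cvg_near_cst.
  near=> k; have [_ _ _ F0] := FK k; apply: F0 => y Ky.
  apply: (@lt_le_trans _ _ r); first by near: k; exact: near_infty_natSinv_lt (PosNum r0).
  rewrite leNgt; apply/negP => xy; apply: (hr y) => //; by rewrite -ball_normE.
- move=> k x; have [_ /(_ x)/andP[? ?] _ _] := FK k.
  by rewrite lee_fin ger0_norm.
- by rewrite integral_cst//= mul1e ltey_eq fin_num_measure.
Unshelve. all: by end_near. Qed.

(** Tested with cutoffs at scales [1/(k+1)], the pairing tends to 0 by hypothesis, while its
    absolute value tends to the difference of the masses of [K]. *)
Lemma grad_compact_eq (alpha : R) (f : 'rV[R]_n -> R)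
    (P N : 'I_n -> {finite_measure set Borel -> \bar R}) K i :
  is_frac_grad alpha f P N -> compact K ->
  (forall d : R, 0 < d -> exists2 F, cutoff_of K d F &
    `|Rintegral mu setT ((fun x => f x * frac_div alpha (fun y => F y *: delta_mx 0 i) x)
       : LebRn R n -> R)| <= d) ->
  P i (K : set Borel) = N i (K : set Borel).
Proof.
move=> gr cK hF.
have k0 (k : nat) : 0 < k.+1%:R^-1 :> R by rewrite invr_gt0.
have /choice[F FK] : forall k : nat, exists F, cutoff_of K k.+1%:R^-1 F /\
    `|Rintegral mu setT ((fun x => f x * frac_div alpha (fun y => F y *: delta_mx 0 i) x)
       : LebRn R n -> R)| <= k.+1%:R^-1.
  by move=> k; have [F ? ?] := hF _ (k0 k); exists F.
have FK1 k := proj1 (FK k).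
have cP := @cutoff_integral_cvg K (P i) F cK FK1.
have cN := @cutoff_integral_cvg K (N i) F cK FK1.
have cD : (fun k => `|Rintegral (P i) setT (F k : Borel -> R) - Rintegral (N i) setT (F k : Borel -> R)|)
    @ \oo --> `|fine (P i (K : set Borel)) - fine (N i (K : set Borel))|.
  by apply: cvg_norm; exact: cvgB.
have c0 : (fun k : nat => k.+1%:R^-1 : R) @ \oo --> (0 : R).
  exact: (@cvg_harmonic R).
have mK : measurable (K : set Borel).
  by apply: closed_measurable_Borel; apply: compact_closed => //; exact: (@norm_hausdorff R 'rV[R]_n).
have D0 : fine (P i (K : set Borel)) - fine (N i (K : set Borel)) = 0.
  apply/eqP; rewrite -normr_le0.
  apply: (ler_cvg_to cD c0); apply: nearW => k /=.
  have [_ hk] := FK k; have := gr _ (test_field_cutoff i cK (FK1 k)).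
  by rewrite vintegral_coord => E; move: hk; rewrite E normrN.
apply/eqP; rewrite -(fineK (fin_num_measure (P i) _ mK)) -(fineK (fin_num_measure (N i) _ mK)) eqe.
by rewrite -subr_eq0 D0.
Qed.

(* Unqualified, [total_variation] is the variation of a function of [realfun]. *)
Lemma total_variation_eq0 (P N : 'I_n -> {finite_measure set Borel -> \bar R}) (A : set Borel) :
  measurable A -> (forall E : set Borel, measurable E -> E `<=` A -> forall i, P i E = N i E) ->
  Defs.total_variation P N A = 0%E.
Proof.
move=> mA h; rewrite /Defs.total_variation.
rewrite [X in ereal_sup X](_ : _ = [set 0%E]) ?ereal_sup1//.
have z (E : nat -> set Borel) : (forall k, measurable (E k)) -> \bigcup_k E k = A ->
    (\sum_(k <oo) (enorm (vmeas P N (E k)))%:E)%E = 0%E.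
  move=> mE EA; apply: eseries0 => k _ _; congr EFin.
  rewrite (_ : vmeas P N (E k) = 0).
    by rewrite /enorm /dotRn big1 ?sqrtr0// => i _; rewrite mxE mulr0.
  apply/rowP => i; rewrite !mxE (h (E k))//; first by rewrite subee ?fin_num_measure.
  by rewrite -EA; exact: bigcup_sup.
apply/seteqP; split=> [_ [E [mE [_ EA]] <-]|_ ->]/=; first exact: z.
(* The trivial partition shows that the family of sums is nonempty; otherwise the supremum would be
   [-oo]. *)
pose E k : set Borel := if k is 0%N then A else set0.
have mE k : measurable (E k) by case: k => [|k]; [exact: mA|exact: measurable0].
have EA : \bigcup_k E k = A.
  apply/seteqP; split=> [x [[|k] _]//|x Ax]; by exists 0%N.
exists E; last exact: z.
split=> //; split=> //.
by move=> [|j] [|k] _ _ [x []].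
Qed.

(** Null sets are hereditary, so every compact subset of a piece of a partition of [A] is null, and
    it suffices to produce a good cutoff for each null compact set. *)
Lemma abs_cont_compact (s alpha : R) (f : 'rV[R]_n -> R)
    (P N : 'I_n -> {finite_measure set Borel -> \bar R}) :
  0 <= s -> is_frac_grad alpha f P N ->
  (forall K i, compact K -> hausdorff s K = 0%E ->
   forall d : R, 0 < d -> exists2 F, cutoff_of K d F &
    `|Rintegral mu setT ((fun x => f x * frac_div alpha (fun y => F y *: delta_mx 0 i) x)
       : LebRn R n -> R)| <= d) ->
  abs_cont_hausdorff s P N.
Proof.
move=> s0 gr h A mA A0; apply: total_variation_eq0 => // E mE EA i.
apply: eq_measure_on_compacts => // K cK KE.
apply: (grad_compact_eq gr) => //; apply: h => //.
by apply: haus_null_subset A0 => //; exact: subset_trans EA.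
Qed.

Lemma union_cutoff_on_cover (A : pred 'I_n) (L : seq ('rV[R]_n * R)) K x :
  (forall q, q \in L -> 0 < q.2) ->
  (forall x, K x -> exists2 q, q \in L & `|x - q.1| <= q.2) -> K x -> union_cutoff A L x = 1.
Proof.
move=> L0 KL Kx; have [q qL xq] := KL x Kx.
apply: (union_cutoff1 qL); apply: cutoff1; first exact: L0.
by move=> j _; have := coord_le_norm (x - q.1) j; rewrite !mxE => h; exact: le_trans h xq.
Qed.

(** Each cutoff extends to twice its radius, hence the bound [d / 2] on the radii. *)
Lemma union_cutoff_off_cover (L : seq ('rV[R]_n * R)) K (d : R) x :
  (forall q, q \in L -> K q.1 /\ 0 < q.2 <= d / 2) ->
  (forall y, K y -> d < `|x - y|) -> union_cutoff predT L x = 0.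
Proof.
move=> KL xK; apply: union_cutoff0 => q /KL[Kq /andP[q0 qd]].
by apply: cutoff_all0 => //; have := xK _ Kq; move: qd; clear; move: q.2 `|_| => a b; lra.
Qed.

(** The constant [C] of the pairing does not depend on the cover, so the cover can be chosen
    afterwards with sum at most [d / (C + 1)]. *)
Lemma supercritical_cutoff (alpha : R) (p : \bar R) (f : 'rV[R]_n -> R) K i (d : R) :
  (0 < n)%N -> 0 < alpha < 1 -> (1 <= p)%E -> in_Lp p f ->
  0 <= n%:R - alpha - n_over_p n p -> compact K ->
  hausdorff (n%:R - alpha - n_over_p n p) K = 0%E -> 0 < d ->
  exists2 F, cutoff_of K d F &
    `|Rintegral mu setT ((fun x => f x * frac_div alpha (fun y => F y *: delta_mx 0 i) x)
       : LebRn R n -> R)| <= d.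
Proof.
move=> n0 al p1 fp s0 cK K0 d0.
have [C C0 hC] := pairing_union_cutoff_le i n0 al p1 fp.
have C1 : 0 < C + 1 by rewrite ltr_wpDl.
have d20 : 0 < d / 2 by exact: divr_gt0.
have [L [Lq Ls KL]] := compact_small_cover s0 cK K0 d20 (divr_gt0 d0 C1).
have L0 (q : 'rV[R]_n * R) : q \in L -> 0 < q.2 by move=> /Lq[_ /andP[]].
exists (union_cutoff predT L).
  split.
  - by move=> k; exact: Ck_union_cutoff.
  - by move=> x; exact: union_cutoff_unit.
  - by move=> x; exact: union_cutoff_on_cover.
  - by move=> x; exact: union_cutoff_off_cover.
apply: le_trans (hC L L0) _.
apply: le_trans (ler_wpM2l C0 Ls) _.
by rewrite mulrCA ler_piMr ?(ltW d0)// ler_pdivrMr// mul1r lerDl.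
Qed.

(** The order of choices matters: the first cover fixes [th], whose Lipschitz constant and support
    determine [eps]; only then is the second cover taken, with sum at most [eps]. Localization near
    [K] comes from [th] alone. *)
Lemma subcritical_cutoff (alpha : R) (p : \bar R) (f : 'rV[R]_n -> R) K i (d : R) :
  (0 < n)%N -> 0 < alpha < 1 -> (1 <= p)%E -> (p < (n%:R / (1 - alpha))%:E)%E -> in_Lp p f ->
  compact K -> hausdorff (n%:R - 1) K = 0%E -> 0 < d ->
  exists2 F, cutoff_of K d F &
    `|Rintegral mu setT ((fun x => f x * frac_div alpha (fun y => F y *: delta_mx 0 i) x)
       : LebRn R n -> R)| <= d.
Proof.
move=> n0 al p1 pn fp cK K0 d0.
have s0 : 0 <= n%:R - 1 :> R by rewrite subr_ge0 ler1n.
have nE : n.-1%:R = n%:R - 1 :> R by rewrite -subn1 natrB.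
have d20 : 0 < d / 2 by exact: divr_gt0.
have [L [Lq _ KL]] := compact_small_cover s0 cK K0 d20 ltr01.
have L0 (q : 'rV[R]_n * R) : q \in L -> 0 < q.2 by move=> /Lq[_ /andP[]].
pose th := union_cutoff predT L.
have thK : cutoff_of K d th.
  split.
  - by move=> k; exact: Ck_union_cutoff.
  - by move=> x; exact: union_cutoff_unit.
  - by move=> x; exact: union_cutoff_on_cover.
  - by move=> x; exact: union_cutoff_off_cover.
have [r r0 th0] := cutoff_of_support cK thK.
have [Cth th01 th1 thoff] := thK.
have [l l0 thl] := union_cutoff_lipschitz predT L0.
have [eps eps0 heps] := cylindrical_pairing_small i n0 al p1 pn fp Cth thl l0 th01 r0 th0 d0.
have [M [Mq Ms KM]] := compact_small_cover s0 cK K0 ltr01 eps0.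
have M0 (q : 'rV[R]_n * R) : q \in M -> 0 < q.2 by move=> /Mq[_ /andP[]].
exists (fun y => th y * union_cutoff (predC1 i) M y); last first.
  apply: heps => //; apply: le_trans Ms; rewrite big_seq [leRHS]big_seq.
  apply: ler_sum => q /M0 q0; rewrite -(powR_mulrn _ (ltW q0)) le_eqVlt; apply/orP; left.
  by rewrite nE.
split.
- by move=> k; apply: CkM => //; exact: Ck_union_cutoff.
- move=> x; have /andP[? ?] := th01 x; have /andP[? ?] := union_cutoff_unit (predC1 i) M x.
  by rewrite mulr_ge0// mulr_ile1.
- by move=> x Kx; rewrite th1// (union_cutoff_on_cover _ M0 KM)// mulr1.
- by move=> x /thoff ->; rewrite mul0r.
Qed.

End GradientVanishing.

Unset Implicit Arguments.

Theorem theorem1p1 (R : realType) (n : nat) (alpha : R) (p : \bar R)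
  (f : 'rV[R]_n -> R)
  (P N : 'I_n -> {finite_measure set BorelRn R n -> \bar R}) :
  (0 < n)%N ->
  0 < alpha < 1 ->
  (1 <= p)%E ->
  in_BV alpha p f ->
  is_frac_grad alpha f P N ->
  (((p < (n%:R / (1 - alpha))%:E)%E ->
      abs_cont_hausdorff (n%:R - 1) P N) /\
   (((n%:R / (1 - alpha))%:E <= p)%E ->
      abs_cont_hausdorff (n%:R - alpha - n_over_p n p) P N)).

Proof.
move=> n0 al p1 [fp _] gr; have /andP[al0 al1] := al; split=> pn.
  apply: (abs_cont_compact _ gr); first by rewrite subr_ge0 ler1n.
  by move=> K i cK K0 d d0; exact: (subcritical_cutoff i n0 al p1 pn fp cK K0 d0).
(* Here [n/p <= 1 - alpha], so the dimension is at least [n - 1]; [p = +oo] counts as [n/p = 0]. *)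
have s0 : 0 <= n%:R - alpha - n_over_p n p.
  have n1 : 1 <= n%:R :> R by rewrite ler1n.
  suff : n_over_p n p <= 1 - alpha by move: n1; clear; move: (n_over_p n p) => t; lra.
  case: p p1 pn {fp} => [r|_ _|//]; rewrite /n_over_p; last by rewrite subr_ge0 ltW.
  rewrite !lee_fin => r1; rewrite ler_pdivrMr ?subr_gt0//.
  by rewrite ler_pdivrMr ?(lt_le_trans ltr01)// mulrC.
apply: (abs_cont_compact s0 gr) => K i cK K0 d d0.
exact: (supercritical_cutoff i n0 al p1 fp s0 cK K0 d0).
Qed.
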